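(* Let $n\ge2$ and $q\ge1$. Let $\widehat f_n^{(block)}$ be a block estimator with $V=[\mathbf 0,\mathbf 1]=[0,1]^d$. Assume $x_1,\ldots,x_n$ are i.i.d. random vectors in $[0,1]^d$ with a distribution $\mathbb P$ satisfying $\rho_1\mu^L_{u,v}\le\mathbb P\{x_i\in[u,v]\}\le\rho_2\mu^L_{u,v}$ for all $u\le v$, with fixed constants $0<\rho_1\le\rho_2<\infty$, where $\mu^L_{u,v}$ is the Lebesgue measure of $[u,v]$. Assume $f$ is non-decreasing and the $\varepsilon_i$ are independent with $\mathbb E\varepsilon_i=0$ and $\mathbb E|\varepsilon_i|^{q\vee2}\le\sigma^{q\vee2}$. Suppose $\Delta_{\mathbf 0,\mathbf 1}=(f(\mathbf 1)-f(\mathbf 0))/\sigma$ is bounded by a constant. Then $$R_q^*(\widehat f_n^{(block)},f)\lesssim_{q,d,\rho_1,\rho_2}\sigma^q\bigg[\Big(\frac{\Delta_{\mathbf 0,\mathbf 1}}{n^{1/d}}\Big)^{\min\{1,\frac{qd}{d+2}\}}(\log n)^{I\{\frac{qd}{d+2}=1\}}+\frac{(\log n)^{dI\{q=2\}+(d-1)I\{q>2\}}}{n^{(q/2)\wedge1}}\bigg].$$ In particular, when $q=2$ and $d\ge2$, $$R_2^*(\widehat f_n^{(block)},f)\lesssim_{d,\rho_1,\rho_2}\sigma^2\min\bigg\{1,\ \frac{\Delta_{\mathbf 0,\mathbf 1}}{n^{1/d}}(\log n)^{I\{d=2\}}+\frac{(\log n)^d}n\bigg\}.$$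
   Context: We observe $(x_i,y_i)$ with $y_i=f(x_i)+\varepsilon_i$; given the design points the noise variables are independent with the stated moment conditions. Vectors in $[0,1]^d$ are ordered coordinatewise; $[u,v]=\{x:u\le x\le v\}$; $f:[0,1]^d\to\mathbb R$ is non-decreasing if $f(u)\le f(v)$ for $u\le v$. $n_{u,v}=\#\{i:x_i\in[u,v]\}$, $n_{u,*}=\#\{i:u\le x_i\}$, $n_{*,v}=\#\{i:x_i\le v\}$; $\overline y_{[u,v]}$ is the average of the $y_i$ with $x_i\in[u,v]$. $R_q^*(\widehat f_n,f)=\int_{[0,1]^d}\mathbb E|\widehat f_n(x)-f(x)|^qdx$. Max-min and min-max estimators: $$\widehat f_n^{(max-min)}(x)=\max_{u\le x,\,n_{u,*}>0}\ \min_{x\le v,\,n_{u,v}>0}\overline y_{[u,v]},\qquad\widehat f_n^{(min-max)}(x)=\min_{x\le v,\,n_{*,v}>0}\ \max_{u\le x,\,n_{u,v}>0}\overline y_{[u,v]}.$$ A block estimator is any estimator $\widehat f_n^{(block)}$ lying, for every $x\in V$, between the minimum and the maximum of these two. $a\vee b=\max(a,b)$, $a\wedge b=\min(a,b)$, $I\{\cdot\}$ is an indicator. $A\lesssim_{\rm index}B$ means $A\le C_{\rm index}B$ with a constant depending only on the index; here the implied constants may also depend on the constant bounding $\Delta_{\mathbf 0,\mathbf 1}$. *)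

(* Defs.v *)
From HB Require Import structures.
From mathcomp Require Import all_boot all_order all_algebra.
From mathcomp Require Import all_classical all_reals all_analysis.

Set Implicit Arguments.
Unset Strict Implicit.
Unset Printing Implicit Defensive.

Import Order.TTheory GRing.Theory Num.Theory.
Import numFieldNormedType.Exports.

Local Open Scope classical_set_scope.
Local Open Scope ring_scope.

(* Lebesgue measure on R^d, with R^d represented by d.-tuple R: the Lebesgue
   measure on R^(d+1) is the image of the product of the Lebesgue measures on R
   and R^d under (a, t) |-> a :: t. *)
Section lebesgue_tuple.
Context (R : realType).
Local Open Scope ereal_scope.

Section cons.
Context (n : nat) (m : {sigma_finite_measure set (n.-tuple R) -> \bar R}).

Definition tuple_cons (p : measurableTypeR R * n.-tuple R) : n.+1.-tuple R :=
  [the n.+1.-tuple R of p.1 :: p.2].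

Lemma measurable_tuple_cons : measurable_fun [set: _] tuple_cons.
Proof. by apply: measurable_cons. Qed.

Definition lebesgue_cons : set (n.+1.-tuple R) -> \bar R :=
  pushforward (@lebesgue_measure R \x m) tuple_cons.

Let lebesgue_cons0 : lebesgue_cons set0 = 0.
Proof. by rewrite /lebesgue_cons /pushforward preimage_set0 measure0. Qed.

Let lebesgue_cons_ge0 A : 0 <= lebesgue_cons A.
Proof. by rewrite /lebesgue_cons /pushforward measure_ge0. Qed.

Let lebesgue_cons_additive : semi_sigma_additive lebesgue_cons.
Proof.
move=> F mF tF mUF; rewrite /lebesgue_cons /pushforward preimage_bigcup.
have mpre B : measurable B -> measurable (tuple_cons @^-1` B).
  by move=> mB; rewrite -[X in measurable X]setTI; exact: measurable_tuple_cons.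
apply: measure_semi_sigma_additive.
- by move=> k; exact: mpre.
- apply/trivIsetP => /= i j _ _ ij; rewrite -preimage_setI.
  by move/trivIsetP : tF => /(_ _ _ _ _ ij) ->//; rewrite preimage_set0.
- by rewrite -preimage_bigcup; exact: mpre.
Qed.

HB.instance Definition _ := isMeasure.Build _ _ _ lebesgue_cons
  lebesgue_cons0 lebesgue_cons_ge0 lebesgue_cons_additive.

Definition tuple_uncons (x : n.+1.-tuple R) : measurableTypeR R * n.-tuple R :=
  (thead x, [tuple of behead x]).

Lemma measurable_tuple_uncons : measurable_fun [set: _] tuple_uncons.
Proof.
apply/measurable_fun_pairP; split.
  exact: measurable_tnth.
exact: measurable_behead.
Qed.

Lemma tuple_consK : cancel tuple_cons tuple_uncons.
Proof.
by move=> [a t]; rewrite /tuple_uncons/=; congr pair; apply/val_inj.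
Qed.

Let lebesgue_cons_sigma_finite : sigma_finite setT lebesgue_cons.
Proof.
have /sigma_finiteP[F [TF ndF Foo]] := sigma_finiteT (@lebesgue_measure R).
have /sigma_finiteP[G [TG ndG Goo]] := sigma_finiteT m.
exists (fun k => tuple_uncons @^-1` (F k `*` G k)).
  rewrite -preimage_bigcup (_ : \bigcup_k _ = setT) ?preimage_setT//.
  rewrite -setXTT TF TG predeqE => -[x y]; split.
    by move=> [k _ []/= ? ?]; split; exists k.
  move=> [/= [k _ Fkx] [l _ Gly]]; exists (maxn k l) => //; split.
  - by move: x Fkx; exact/subsetPset/ndF/leq_maxl.
  - by move: y Gly; exact/subsetPset/ndG/leq_maxr.
move=> k; have [mF Fk] := Foo k; have [mG Gk] := Goo k; split.
  rewrite -[X in measurable X]setTI; apply: measurable_tuple_uncons => //.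
  exact: measurableX.
rewrite /lebesgue_cons /pushforward -comp_preimage.
rewrite (_ : _ \o _ = id); last by apply/funext => p; exact: tuple_consK.
by rewrite preimage_id product_measure1E// lte_mul_pinfty// ge0_fin_numE.
Qed.

HB.instance Definition _ := Measure_isSigmaFinite.Build _ _ _ lebesgue_cons
  lebesgue_cons_sigma_finite.

End cons.

Fixpoint lebesgue_tuple (d : nat) :
    {sigma_finite_measure set (d.-tuple R) -> \bar R} :=
  if d is d'.+1 then [the {sigma_finite_measure set _ -> \bar R} of
    lebesgue_cons (lebesgue_tuple d')]
  else [the {sigma_finite_measure set _ -> \bar R} of \d_([tuple] : 0.-tuple R)].

End lebesgue_tuple.

Section vectors.
Context (R : realType) (d : nat).
Implicit Types u v x : d.-tuple R.

Definition vle u v : bool := [forall j, tnth u j <= tnth v j].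

Definition box u v : set (d.-tuple R) := [set x | vle u x /\ vle x v].

Definition vcst (c : R) : d.-tuple R := [tuple c | _ < d].

Definition unit_cube : set (d.-tuple R) := box (vcst 0) (vcst 1).

Definition nondecreasing_on_cube (f : d.-tuple R -> R) : Prop :=
  forall u v, unit_cube u -> unit_cube v -> vle u v -> f u <= f v.

End vectors.
Arguments vcst {R d}.
Arguments unit_cube {R d}.

Lemma tnth_behead_lift (R : realType) (d : nat) (x : d.+1.-tuple R) (j : 'I_d) :
  tnth [tuple of behead x] j = tnth x (lift ord0 j).
Proof. by rewrite [in RHS](tuple_eta x) tnthS. Qed.

Lemma vle_cons (R : realType) (d : nat) (x y : d.+1.-tuple R) :
  vle x y =
  (thead x <= thead y) && vle [tuple of behead x] [tuple of behead y].
Proof.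
apply/forallP/andP => [xy|[xy0 /forallP xy] j].
  split; first exact: xy.
  by apply/forallP => j; rewrite !tnth_behead_lift.
case: (unliftP ord0 j) => [k ->|->]; last exact: xy0.
by have := xy k; rewrite !tnth_behead_lift.
Qed.

Lemma box_cons (R : realType) (d : nat) (u v : d.+1.-tuple R) :
  @tuple_cons R d @^-1` box u v =
  `[thead u, thead v] `*` box [tuple of behead u] [tuple of behead v].
Proof.
apply/seteqP; split => -[a t]; rewrite /box/= !vle_cons in_itv/= !theadE;
  have -> : [tuple of behead (tuple_cons (a, t))] = t by exact/val_inj.
  by move=> [/andP[-> ->] /andP[-> ->]].
by move=> [/andP[-> ->] [-> ->]].
Qed.

Lemma measurable_box (R : realType) (d : nat) (u v : d.-tuple R) :
  measurable (box u v).
Proof.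
have -> : box u v =
    \bigcap_(j in [set: 'I_d]) ((@tnth d R)^~ j @^-1` `[tnth u j, tnth v j]).
  apply/seteqP; split => x /=.
    by move=> [/forallP ux /forallP xv] j _ /=; rewrite in_itv/= ux xv.
  by move=> uxv; split; apply/forallP => j; have := uxv j I;
    rewrite /= in_itv/= => /andP[].
apply: fin_bigcap_measurable => // j _.
by rewrite -[X in measurable X]setTI; apply: measurable_tnth.
Qed.

Lemma lebesgue_tuple_box (R : realType) (d : nat) (u v : d.-tuple R) :
  vle u v ->
  lebesgue_tuple R d (box u v) = (\prod_(j < d) (tnth v j - tnth u j))%:E.
Proof.
elim: d u v => [|d ih] u v uv /=.
  rewrite big_ord0 diracE mem_set//=.
  by split; apply/forallP => -[].
rewrite /lebesgue_cons /pushforward box_cons.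
rewrite product_measure1E//; last exact: measurable_box.
rewrite ih; last first.
  by move: uv; rewrite vle_cons => /andP[].
have uv0 : thead u <= thead v by move/forallP : uv => /(_ ord0).
have luv : @lebesgue_measure R `[thead u, thead v] = (thead v - thead u)%:E.
  rewrite lebesgue_measure_itv/= lte_fin; case: ltP => // vu.
  by congr EFin; apply/esym/eqP; rewrite subr_eq0 eq_le vu uv0.
rewrite big_ord_recl EFinM; congr *%E; first exact: luv.
congr EFin; apply: eq_bigr => j _.
by rewrite !tnth_behead_lift.
Qed.

Section estimators.
Context (R : realType) (d n : nat).
Implicit Types (xs : n.-tuple (d.-tuple R)) (ys : n.-tuple R).
Implicit Types u v x : d.-tuple R.

Definition npts xs u v : nat :=
  #|[pred i : 'I_n | vle u (tnth xs i) && vle (tnth xs i) v]|.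

Definition npts_ge xs u : nat := #|[pred i : 'I_n | vle u (tnth xs i)]|.

Definition npts_le xs v : nat := #|[pred i : 'I_n | vle (tnth xs i) v]|.

Definition ybar xs ys u v : R :=
  (\sum_(i < n | vle u (tnth xs i) && vle (tnth xs i) v) tnth ys i) /
  (npts xs u v)%:R.

(* u and v range over the unit cube. Since ybar xs ys u v only depends on which
   design points lie in [u, v], the sups and infs below are over finite sets;
   when n > 0 and x and the design points are in the cube these sets are
   nonempty, so that sup and inf are max and min. *)
Definition maxmin xs ys x : R :=
  sup [set inf [set ybar xs ys u v | v in
          [set v | [/\ unit_cube v, vle x v & (0 < npts xs u v)%N]]] | u in
    [set u | [/\ unit_cube u, vle u x & (0 < npts_ge xs u)%N]]].

Definition minmax xs ys x : R :=
  inf [set sup [set ybar xs ys u v | u in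
          [set u | [/\ unit_cube u, vle u x & (0 < npts xs u v)%N]]] | v in
    [set v | [/\ unit_cube v, vle x v & (0 < npts_le xs v)%N]]].

Definition design_in_cube xs : Prop := forall i, unit_cube (tnth xs i).

(* An estimator is a measurable function of the data and of the point of the
   cube where it is evaluated. *)
Definition block_estimator
    (fhat : n.-tuple (d.-tuple R) -> n.-tuple R -> d.-tuple R -> R) : Prop :=
  measurable_fun
    [set p : (n.-tuple (d.-tuple R) * n.-tuple R) * d.-tuple R |
      design_in_cube p.1.1 /\ unit_cube p.2]
    (fun p => fhat p.1.1 p.1.2 p.2) /\
  (forall xs ys x, design_in_cube xs -> unit_cube x ->
    Num.min (maxmin xs ys x) (minmax xs ys x) <= fhat xs ys x <=
    Num.max (maxmin xs ys x) (minmax xs ys x)).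

End estimators.

Section model.
Context (R : realType) (d n : nat) (dT : measure_display)
  (T : measurableType dT) (P : probability T R).
Variables (X : 'I_n -> {RV P >-> d.-tuple R}) (eps : 'I_n -> {RV P >-> R}).
Local Open Scope ereal_scope.

Definition design (w : T) : n.-tuple (d.-tuple R) := [tuple X i w | i < n].

Definition responses (f : d.-tuple R -> R) (w : T) : n.-tuple R :=
  [tuple (f (X i w) + eps i w)%R | i < n].

(* Taking some of the A i equal to setT gives the product rule for every
   subfamily. *)
Definition iid_with_law (law : probability (d.-tuple R) R) : Prop :=
  (forall i A, measurable A -> distribution P (X i) A = law A) /\
  (forall A : 'I_n -> set (d.-tuple R), (forall i, measurable (A i)) ->
    P (\bigcap_(i in [set: 'I_n]) (X i @^-1` A i)) =
    \prod_(i < n) P (X i @^-1` A i)).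

Definition law_between (rho1 rho2 : R) (law : probability (d.-tuple R) R) :
    Prop :=
  forall u v, unit_cube u -> unit_cube v -> vle u v ->
    rho1%:E * lebesgue_tuple R d (box u v) <= law (box u v) <=
    rho2%:E * lebesgue_tuple R d (box u v).

(* Given the design, the eps i are independent and eps i has the regular
   conditional distribution kap i (design w). *)
Definition independent_given_design
    (kap : 'I_n -> R.-pker (n.-tuple (d.-tuple R)) ~> R) : Prop :=
  forall (A : set (n.-tuple (d.-tuple R))) (B : 'I_n -> set R),
    measurable A -> (forall i, measurable (B i)) ->
    P (design @^-1` A `&` \bigcap_(i in [set: 'I_n]) (eps i @^-1` B i)) =
    \int[P]_(w in design @^-1` A) \prod_(i < n) kap i (design w) (B i).

Definition noise_model (q sigma : R) : Prop :=
  exists kap : 'I_n -> R.-pker (n.-tuple (d.-tuple R)) ~> R,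
    independent_given_design kap /\
    {ae P, forall w, forall i : 'I_n,
      \int[kap i (design w)]_e e%:E = 0 /\
      \int[kap i (design w)]_e (`|e| `^ Num.max q 2)%:E <=
        (sigma `^ Num.max q 2)%:E}.

Record random_design_model (rho1 rho2 q sigma : R)
    (law : probability (d.-tuple R) R) (f : d.-tuple R -> R) : Prop := {
  model_cube : forall i w, unit_cube (X i w);
  model_iid : iid_with_law law;
  model_law : law_between rho1 rho2 law;
  model_mono : nondecreasing_on_cube f;
  model_noise : noise_model q sigma
}.

(* f is not assumed to be Borel: a non-decreasing f on the cube need not be,
   but it is Lebesgue measurable. The integral of a nonnegative function is
   the supremum over the simple functions below it, so that for such f it is
   the integral with respect to the completed measure. *)
Definition risk (q : R) (f : d.-tuple R -> R)
    (fhat : n.-tuple (d.-tuple R) -> n.-tuple R -> d.-tuple R -> R) : \bar R :=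
  \int[lebesgue_tuple R d]_(x in unit_cube)
    'E_P[fun w => (`|fhat (design w) (responses f w) x - f x| `^ q)%R].

End model.

Definition Delta01 (R : realType) (d : nat) (f : d.-tuple R -> R)
    (sigma : R) : R :=
  (f (vcst 1) - f (vcst 0)) / sigma.

(* Main.v *)
Require Import Defs.
From mathcomp Require Import all_boot all_order all_algebra.
From mathcomp Require Import all_classical all_reals all_analysis measurable_realfun.
From mathcomp Require Import ring lra zify.

Set Implicit Arguments.
Unset Strict Implicit.
Unset Printing Implicit Defensive.

Import Order.TTheory GRing.Theory Num.Theory.
Import numFieldNormedType.Exports.

Local Open Scope classical_set_scope.
Local Open Scope ring_scope.

(** The proof has three ingredients: a reduction to one-sided errors, a maximal
    inequality for noise averages over boxes, and a multiscale choice of the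
    upper corner of the box at each point.

    Reduction. Let [v] be any point above [x] such that some design point lies
    in the box between [x] and [v], or [v] is the upper corner of the cube. Both
    the max-min and the min-max estimator at [x] are then at most [f v] plus the
    largest average of the noise over the nonempty boxes with lower corner [u]
    below [x] and upper corner [v] ([block_upper]). The reflection of the cube
    through its centre, together with a change of sign of the data, exchanges
    the two estimators, so the same bound serves for the lower side
    ([block_lower]). Hence it is enough to bound every number that satisfies
    [one_sided], for the design and for the reflected design.

    Noise. Fix [v] and let [u] range between [b'] and [b], where the number of
    points expected from [b'] to [v] is at most a constant times one plus the
    number expected from [b] to [v]. The maximal noise sum is at most the maximum
    over families of indices cut out by one threshold per coordinate. Given the design, symmetrization, one
    Levy reflection per coordinate and the Khintchine inequality bound its
    moments by those of a single sum ([maximal_inequality]). One divides by the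
    number of points in the smallest box; the two random counts are decoupled by
    the inequality between the arithmetic and geometric means and are controlled
    by moments of the binomial distribution. If [N] is the expected number of
    points from [b] to [v], the q-th moment of the maximal average is of order
    sigma^q max(1, N)^(-q/2) ([shell_noise_bound]). Lower corners that are
    further away are covered by dyadic pieces, whose contributions form a
    geometric series ([peel_noise_bound]).

    Choice of the upper corner. The upper corner of the cube is always allowed
    and its bias is bounded. Cutting the cube into the shells where the
    coordinates of [x] are at dyadic distances [2^-a_j] from 1, its noise term
    integrates to the sum over [a] of 2^-|a| max(1, n 2^-|a|)^(-q/2), which is
    the second term of the rate ([boundary_sum]). In a shell that is expected to
    contain design points there are finer grids, of levels [k = 0, 1, ...]. A
    cell is steep if [f] increases by more than the noise level of the cell over
    that cell and the next one on the diagonal. For [x] in a cell that is not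
    steep the upper corner of the next cell is a good choice of [v], so one
    takes the first level at which the cell of [x] is not steep; the error is
    then of the order of the noise level of the steep cell one level before
    ([one_sided_bounded]). As [f] is monotone, its increments along the
    diagonals of a grid telescope up to the boundary of the grid
    ([sum_increments]), so few cells are steep ([card_steep]). The volume of the
    steep cells of a shell is at most of order
    min(1, 2^-k Delta_a sqrt(n 2^-(|a| + k d))) times that of the shell, where
    Delta_a is the increment of [f] over the shell divided by sigma, and the sum
    over shells and levels of these volumes times the q-th powers of the noise
    levels is the first term of the rate ([bias_sum]).

    Both [f] and the error as a function of the noise may fail to be measurable,
    but the integral of a nonnegative function, being a supremum over simple
    functions, is monotone all the same ([le_integral_ge0]); so all errors are
    dominated by measurable functions before they are integrated. *)

(** * Conditional Jensen inequality *)

Section mixture.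
Local Open Scope ereal_scope.
Context d d' (T : measurableType d) (S : measurableType d') (R : realType).
Variables (P : {measure set T -> \bar R}) (kap : T -> {measure set S -> \bar R}).
Variable w : T -> R.
Hypothesis mkap : forall C, measurable C -> measurable_fun setT (fun t => kap t C : \bar R).
Hypothesis mw : measurable_fun setT w.
Hypothesis w0 : forall t, (0 <= w t)%R.

Definition mixture (C : set S) := \int[P]_t ((w t)%:E * kap t C).

Import HBNNSimple.

Let mixture_nnsfun (h : {nnsfun S >-> R}) :
  measurable_fun setT (fun t => \int[kap t]_s (h s)%:E) /\
  \int[P]_t ((w t)%:E * \int[kap t]_s (h s)%:E) = sintegral mixture h.
Proof.
have hE t : \int[kap t]_s (h s)%:E =
    \sum_(x \in range h) x%:E * kap t (h @^-1` [set x]).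
  by rewrite integralT_nnsfun sintegralE.
have mh t x : x \in range h -> measurable_fun setT
    (fun t => x%:E * kap t (h @^-1` [set x])).
  by move=> _; apply: measurable_funeM; exact: mkap.
split.
  rewrite (_ : (fun t => _) = (fun t => \sum_(x \in range h)
      x%:E * kap t (h @^-1` [set x]))); last by apply/funext.
  apply: emeasurable_fsum => // x.
  by apply: measurable_funeM; exact: mkap.
under eq_integral.
  move=> t _; rewrite hE ge0_mule_fsumr//; last first.
    by move=> x; exact: nnsfun_mulemu_ge0.
  over.
rewrite ge0_integral_fsum//; last 2 first.
- move=> x; apply: emeasurable_funM => //; first exact/measurable_EFinP.
  by apply: measurable_funeM; exact: mkap.
- by move=> x t _; apply: mule_ge0; [rewrite lee_fin|exact: nnsfun_mulemu_ge0].
rewrite /sintegral (fsbig_widen (range h) setT)//=; last first.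
  move=> x [_ /= /preimage10 ->]; rewrite integral0_eq// => t _.
  by rewrite measure0 !mule0.
apply: eq_fsbigr => x _; rewrite /mixture.
have [x0|x0] := ltP x 0%R.
  have hx0 : h @^-1` [set x] = set0 by exact: preimage_nnfun0.
  rewrite !hx0 integral0_eq; last by move=> t _; rewrite measure0 !mule0.
  by rewrite integral0_eq ?mule0// => t _; rewrite measure0 mule0.
rewrite -ge0_integralZl//.
- by apply: eq_integral => t _; rewrite muleCA.
- by apply: emeasurable_funM => //; [exact/measurable_EFinP|exact: mkap].
- by move=> t _; rewrite mule_ge0 ?lee_fin ?measure_ge0.
Qed.

Lemma integral_mixture (h : S -> \bar R) (mh : measurable_fun setT h) :
  (forall s, 0 <= h s) ->
  \int[P]_t ((w t)%:E * \int[kap t]_s h s) =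
  limn (fun n => sintegral mixture (nnsfun_approx measurableT mh n)).
Proof.
move=> h0; pose g n := nnsfun_approx measurableT mh n.
have ndg m n t : (m <= n)%N ->
    \int[kap t]_s (g m s)%:E <= \int[kap t]_s (g n s)%:E.
  move=> mn; apply: ge0_le_integral => //.
  - by move=> s _; rewrite lee_fin.
  - exact/measurable_EFinP.
  - exact/measurable_EFinP.
  - by move=> s _; rewrite lee_fin; exact/lefP/nd_nnsfun_approx.
have hlim t : \int[kap t]_s h s = limn (fun n => \int[kap t]_s (g n s)%:E).
  rewrite -monotone_convergence//.
  - apply: eq_integral => s _; apply/esym/cvg_lim => //.
    by apply: cvg_nnsfun_approx.
  - by move=> n; exact/measurable_EFinP.
  - by move=> n s _; rewrite lee_fin.
  - by move=> s _ m n mn; rewrite lee_fin; exact/lefP/nd_nnsfun_approx.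
transitivity (\int[P]_t limn (fun n => (w t)%:E * \int[kap t]_s (g n s)%:E)).
  apply: eq_integral => t _; rewrite hlim.
  have cg : cvgn (fun n => \int[kap t]_s (g n s)%:E).
    by apply: ereal_nondecreasing_is_cvgn => m n mn; exact: ndg.
  apply/esym/cvg_lim => //.
  exact: cvgeZl.
rewrite monotone_convergence//; last 3 first.
- by move=> n; apply: emeasurable_funM => //; [exact/measurable_EFinP|exact: (mixture_nnsfun (g n)).1].
- by move=> n t _; rewrite mule_ge0 ?lee_fin// integral_ge0// => s _; rewrite lee_fin.
- by move=> t _ m n mn; rewrite lee_wpmul2l ?lee_fin ?ndg.
by apply/congr_lim/funext => n; exact: (mixture_nnsfun (g n)).2.
Qed.

End mixture.

Section eq_mixture.
Import HBNNSimple.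

(** Nonnegative measurable functions are limits of simple ones, so a mixture of
    measures is determined by its values on sets. This is what turns the product
    rule for the noise, which speaks of sets, into a rule for integrals. *)
Lemma eq_integral_mixture d1 d2 d' (T1 : measurableType d1)
    (T2 : measurableType d2) (S : measurableType d') (R : realType)
    (P1 : {measure set T1 -> \bar R}) (P2 : {measure set T2 -> \bar R})
    (kap1 : T1 -> {measure set S -> \bar R})
    (kap2 : T2 -> {measure set S -> \bar R}) (w1 : T1 -> R) (w2 : T2 -> R)
    (h : S -> \bar R) :
  (forall C, measurable C -> measurable_fun setT (fun t => kap1 t C : \bar R)) ->
  (forall C, measurable C -> measurable_fun setT (fun t => kap2 t C : \bar R)) ->
  measurable_fun setT w1 -> measurable_fun setT w2 ->
  (forall t, 0 <= w1 t) -> (forall t, 0 <= w2 t) ->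
  measurable_fun setT h -> (forall s, 0 <= h s)%E ->
  (forall C, measurable C ->
    (\int[P1]_t ((w1 t)%:E * kap1 t C) = \int[P2]_t ((w2 t)%:E * kap2 t C))%E) ->
  (\int[P1]_t ((w1 t)%:E * \int[kap1 t]_s h s) =
   \int[P2]_t ((w2 t)%:E * \int[kap2 t]_s h s))%E.
Proof.
move=> mk1 mk2 mw1 mw2 w10 w20 mh h0 eqC.
rewrite (integral_mixture P1 mk1 mw1 w10 mh h0).
rewrite (integral_mixture P2 mk2 mw2 w20 mh h0).
apply/congr_lim/funext => n; rewrite /sintegral; apply: eq_fsbigr => x _.
by congr (_ * _)%E; apply: eqC.
Qed.

End eq_mixture.

Lemma measurable_inf_seq d (T : measurableType d) (R : realType)
    (h : nat -> T -> R) :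
  (forall n, measurable_fun setT (h n)) ->
  (forall t, has_lbound (range (h ^~ t))) ->
  measurable_fun setT (fun t => inf (range (h ^~ t))).
Proof.
move=> mh lh; have := @measurable_fun_infs _ _ _ setT h 0%N (fun t _ => lh t) mh.
apply: eq_measurable_fun => t _ /=; rewrite /infs/= /sdrop; congr inf.
by apply/seteqP; split => _ [n _ <-]; exists n.
Qed.

(** If [xi] is centered given [J], then h(J, 0) has at most the mean of
    h(J, xi) for convex h. Centering is stated with the positive and the negative
    part, so that all integrals are of nonnegative functions. *)
Section conditional_jensen.
Context d d' (T : measurableType d) (S : measurableType d') (R : realType).
Variables (P : probability T R) (J : T -> S) (xi : T -> R).
Hypotheses (mJ : measurable_fun setT J) (mxi : measurable_fun setT xi).
Hypothesis xi_int : (\int[P]_t (`|xi t|)%:E < +oo)%E.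
Hypothesis xi_centered : forall C, measurable C ->
  (\int[P]_(t in J @^-1` C) (xi^\+ t)%:E =
   \int[P]_(t in J @^-1` C) (xi^\- t)%:E)%E.

Import HBNNSimple.

Let mJC C : measurable C -> measurable (J @^-1` C).
Proof. by move=> mC; rewrite -[X in measurable X]setTI; exact: mJ. Qed.

Let integral_mix (w : T -> R) (g : S -> R) : (forall t, 0 <= w t) ->
  measurable_fun setT w -> measurable_fun setT g -> (forall s, 0 <= g s) ->
  (\int[P]_t (w t * g (J t))%:E =
   \int[P]_t ((w t)%:E * \int[\d_(J t)]_s (g s)%:E))%E.
Proof.
move=> w0 mw mg g0; apply: eq_integral => t _.
rewrite integral_dirac// ?diracT ?mul1e//; exact/measurable_EFinP.
Qed.

Let centered_fun (g : S -> R) : measurable_fun setT g -> (forall s, 0 <= g s) ->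
  (\int[P]_t (xi^\+ t * g (J t))%:E = \int[P]_t (xi^\- t * g (J t))%:E)%E.
Proof.
move=> mg g0.
have mxp : measurable_fun setT (xi^\+) by exact: measurable_funrpos.
have mxn : measurable_fun setT (xi^\-) by exact: measurable_funrneg.
have mdir C : measurable C -> measurable_fun setT (fun t => \d_(J t) C : \bar R).
  move=> mC; under eq_fun do rewrite diracE -indicE.
  apply/measurable_EFinP.
  exact: (measurableT_comp (measurable_indic mC) mJ).
have mg' : measurable_fun setT (EFin \o g) by exact/measurable_EFinP.
rewrite (integral_mix _ mxp mg g0) ?(integral_mix _ mxn mg g0); [|exact: funrneg_ge0|exact: funrpos_ge0].
apply: eq_integral_mixture => //.
move=> C mC.
have E (w : T -> R) : (\int[P]_t ((w t)%:E * \d_(J t) C) =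
    \int[P]_(t in J @^-1` C) (w t)%:E)%E.
  rewrite [in RHS]integral_mkcond; apply: eq_integral => t _.
  rewrite patchE/= diracE/=; case: ifPn => [|/negP]; rewrite inE/=.
    by move=> CJ; rewrite mem_set// mule1.
  by move=> CJ; rewrite memNset// mule0.
by rewrite !E xi_centered.
Qed.

Variable h : S -> R -> R.
Hypothesis h0 : forall s x, 0 <= h s x.
Hypothesis mh : forall x, measurable_fun setT (h ^~ x).
Hypothesis mhxi : measurable_fun setT (fun t => h (J t) (xi t)).
Hypothesis h_convex : forall s x y l, 0 <= l <= 1 ->
  h s (l * x + (1 - l) * y) <= l * h s x + (1 - l) * h s y.

(** The right derivative of [h s] at 0, as an infimum of secant slopes. *)
Let slope n s : R := (h s (n.+1%:R^-1) - h s 0) * n.+1%:R.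
Let g s : R := inf (range (slope ^~ s)).

Let slope_ge s n t : t < 0 -> (h s t - h s 0) / t <= slope n s.
Proof.
move=> t0; rewrite /slope.
have n0 : 0 < n.+1%:R :> R by rewrite ltr0n.
set e := n.+1%:R^-1; have e0 : 0 < e by rewrite invr_gt0.
have et : 0 < e - t by rewrite subr_gt0 (lt_trans t0).
have := @h_convex s e t (- t / (e - t)).
have -> : 0 <= - t / (e - t) <= 1.
  by apply/andP; split; [apply: divr_ge0; lra|rewrite ler_pdivrMr// mul1r; lra].
have -> : - t / (e - t) * e + (1 - - t / (e - t)) * t = 0.
  by field; rewrite gt_eqF.
move=> /(_ isT) H.
have {}H : h s 0 * (e - t) <= - t * h s e + e * h s t.
  have -> : - t * h s e + e * h s t =
    (- t / (e - t) * h s e + (1 - - t / (e - t)) * h s t) * (e - t).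
    by field; rewrite gt_eqF.
  by rewrite ler_pM2r.
rewrite -[X in _ <= _ * X]invrK -/e ler_pdivlMr//.
by rewrite mulrAC ler_ndivrMr//; lra.
Qed.

Let slope_lb s : has_lbound (range (slope ^~ s)).
Proof.
exists ((h s (-1) - h s 0) / (-1)) => _ [n _ <-].
by apply: slope_ge; rewrite ltrN10.
Qed.

Let mg : measurable_fun setT g.
Proof.
apply: measurable_inf_seq => // n; apply: measurable_funM => //.
by apply: measurable_funB; exact: mh.
Qed.

Let g_subgradient s t : h s 0 + g s * t <= h s t.
Proof.
have [t0|t0|->] := ltgtP t 0; last by rewrite mulr0 addr0.
- suff : (h s t - h s 0) / t <= g s by rewrite ler_ndivrMr//; lra.
  apply: lb_le_inf; first by exists (slope 0 s), 0%N.
  by move=> _ [n _ <-]; exact: slope_ge.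
- have [n nt] : exists n : nat, n.+1%:R^-1 < t.
    have [n _ nP] := near_infty_natSinv_lt (PosNum t0); exists n.
    exact: (nP n (leqnn n)).
  have gs : g s <= slope n s by apply: ge_inf => //; exists n.
  suff : slope n s * t <= h s t - h s 0.
    rewrite -lerBrDl; apply: le_trans; exact: ler_wpM2r (ltW t0) _ _ gs.
  rewrite /slope; have n0 : 0 < n.+1%:R :> R by rewrite ltr0n.
  move: nt; rewrite -[X in _ * X * t]invrK.
  set e := n.+1%:R^-1 => et.
  have e0 : 0 < e by rewrite invr_gt0.
  have := @h_convex s t 0 (e / t).
  have -> : 0 <= e / t <= 1.
    by apply/andP; split; [apply: divr_ge0; lra|rewrite ler_pdivrMr// mul1r; lra].
  have -> : e / t * t + (1 - e / t) * 0 = e by field; rewrite gt_eqF.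
  move=> /(_ isT) H.
  rewrite mulrAC ler_pdivrMr//.
  suff : h s e * t <= e * h s t + (t - e) * h s 0 by lra.
  have -> : e * h s t + (t - e) * h s 0 =
     (e / t * h s t + (1 - e / t) * h s 0) * t by field; rewrite gt_eqF.
  by rewrite ler_pM2r.
Qed.

(* The subgradient at 0 need not be integrable against xi, so it is truncated
   and the truncation removed by monotone convergence. *)
Let gM (M : nat) s : R := if `|g s| <= M%:R then g s else 0.

Let mgM M : measurable_fun setT (gM M).
Proof.
apply: measurable_fun_ifT => //.
by apply: measurable_fun_ler => //; exact: measurableT_comp.
Qed.

Let gM_le M s : `|gM M s| <= M%:R.
Proof. by rewrite /gM; case: ifPn => //; rewrite normr0. Qed.

Let D M : set T := [set t | `|g (J t)| <= M%:R].

Let mD M : measurable (D M).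
Proof.
apply: (mJC (C := [set s | `|g s| <= M%:R])).
rewrite -[X in measurable X]setTI.
by apply: measurable_fun_ler => //; exact: measurableT_comp.
Qed.

Let trunc_jensen M :
  (\int[P]_(t in D M) (h (J t) 0)%:E <= \int[P]_t (h (J t) (xi t))%:E)%E.
Proof.
have mp : measurable_fun setT ((gM M)^\+) by exact: measurable_funrpos.
have mn : measurable_fun setT ((gM M)^\-) by exact: measurable_funrneg.
have mxp : measurable_fun setT (xi^\+) by exact: measurable_funrpos.
have mxn : measurable_fun setT (xi^\-) by exact: measurable_funrneg.
have fin (a : S -> R) (y : T -> R) : measurable_fun setT a -> measurable_fun setT y ->
    (forall s, 0 <= a s <= M%:R) -> (forall t, 0 <= y t <= `|xi t|) ->
    (\int[P]_t (y t * a (J t))%:E < +oo)%E.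
  move=> ma my aM yx.
  apply: (@le_lt_trans _ _ (\int[P]_t (M%:R%:E * (`|xi t|)%:E))%E); last first.
    rewrite ge0_integralZl//; last exact/measurable_EFinP/measurableT_comp.
    by rewrite lte_mul_pinfty.
  apply: ge0_le_integral => //.
  - by move=> t _; rewrite lee_fin mulr_ge0//; [case/andP: (yx t)|case/andP: (aM (J t))].
  - by apply/measurable_EFinP/measurable_funM => //; exact: measurableT_comp.
  - by apply: measurable_funeM; exact/measurable_EFinP/measurableT_comp.
  - move=> t _; rewrite -EFinM lee_fin mulrC.
    case/andP: (yx t) => y0 yx'; case/andP: (aM (J t)) => a0 aM'.
    by rewrite ler_pM.
have pM s : 0 <= (gM M)^\+ s <= M%:R.
  rewrite funrpos_ge0/= (le_trans _ (gM_le M s))// /funrpos ge_max ler_norm/=.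
  exact: normr_ge0.
have nM s : 0 <= (gM M)^\- s <= M%:R.
  rewrite funrneg_ge0/= (le_trans _ (gM_le M s))// /funrneg ge_max -normrN ler_norm/=.
  exact: normr_ge0.
have xp t : 0 <= xi^\+ t <= `|xi t|.
  by rewrite funrpos_ge0/= /funrpos ge_max ler_norm/= normr_ge0.
have xn t : 0 <= xi^\- t <= `|xi t|.
  by rewrite funrneg_ge0/= /funrneg ge_max -normrN ler_norm/= normr_ge0.
have eqp := centered_fun mp (fun s => funrpos_ge0 (gM M) s).
have eqn := centered_fun mn (fun s => funrneg_ge0 (gM M) s).
have finp := fin _ _ mp mxp pM xp; have finn := fin _ _ mn mxp nM xp.
have m2 (a : S -> R) (y : T -> R) : measurable_fun setT a -> measurable_fun setT y ->
    measurable_fun setT (fun t => (y t * a (J t))%:E).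
  by move=> ma my; apply/measurable_EFinP/measurable_funM => //; exact: measurableT_comp.
have mh0 : measurable_fun setT (fun t => (h (J t) 0)%:E).
  apply/measurable_EFinP.
  exact: (measurableT_comp (mh 0) mJ).
have mhD : measurable_fun setT ((fun t => (h (J t) 0)%:E) \_ (D M)).
  by apply/(measurable_restrictT _ _).1 => //; exact: measurable_funTS.
have hD0 t : (0 <= ((fun t => (h (J t) 0)%:E) \_ (D M)) t)%E.
  by rewrite patchE; case: ifPn => // _; rewrite lee_fin.
have nn (a : S -> R) (y : T -> R) : (forall s, 0 <= a s <= M%:R) ->
    (forall t, 0 <= y t <= `|xi t|) -> forall t, setT t -> (0 <= (y t * a (J t))%:E)%E.
  by move=> aM yx t _; rewrite lee_fin mulr_ge0//; [case/andP: (yx t)|case/andP: (aM (J t))].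
suff : (\int[P]_(t in D M) (h (J t) 0)%:E +
        (\int[P]_t (xi^\+ t * (gM M)^\+ (J t))%:E +
         \int[P]_t (xi^\- t * (gM M)^\- (J t))%:E) <=
        \int[P]_t (h (J t) (xi t))%:E +
        (\int[P]_t (xi^\- t * (gM M)^\+ (J t))%:E +
         \int[P]_t (xi^\+ t * (gM M)^\- (J t))%:E))%E.
  rewrite -eqp -eqn leeD2rE//.
  rewrite fin_numD; apply/andP; split; rewrite ge0_fin_numE//; apply: integral_ge0 => t tT; exact: nn.
rewrite integral_mkcond -!ge0_integralD//=; last 12 first.
all: try exact: nn.
all: try exact: m2.
all: try by move=> t _; rewrite adde_ge0//; exact: nn.
all: try by apply: emeasurable_funD; exact: m2.
all: try by move=> t _; rewrite lee_fin.
all: try exact/measurable_EFinP.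
apply: ge0_le_integral => //.
- by move=> t _; rewrite adde_ge0// adde_ge0//; exact: nn.
- by apply: emeasurable_funD => //; apply: emeasurable_funD; exact: m2.
- by apply: emeasurable_funD; [exact/measurable_EFinP|apply: emeasurable_funD; exact: m2].
move=> t _; rewrite patchE; case: ifPn => [|/negP]; rewrite inE /D/= => gt.
- rewrite lee_fin; have := g_subgradient (J t) (xi t).
  have <- : gM M (J t) = g (J t) by rewrite /gM gt.
  have xE : xi t = xi^\+ t - xi^\- t by rewrite -[in LHS](funrposBneg xi).
  have gE : gM M (J t) = (gM M)^\+ (J t) - (gM M)^\- (J t).
    by rewrite -[in LHS](funrposBneg (gM M)).
  rewrite gE [in X in _ * X]xE; lra.
- have -> : (gM M)^\+ (J t) = 0.
    by rewrite /funrpos /gM; case: ifPn => // _; rewrite maxxx.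
  have -> : (gM M)^\- (J t) = 0.
    by rewrite /funrneg /gM; case: ifPn => // _; rewrite oppr0 maxxx.
  by rewrite !mulr0 !adde0 lee_fin.
Qed.

Lemma conditional_jensen :
  (\int[P]_t (h (J t) 0)%:E <= \int[P]_t (h (J t) (xi t))%:E)%E.
Proof.
have mh0 : measurable_fun setT (fun t => (h (J t) 0)%:E).
  apply/measurable_EFinP.
  exact: (measurableT_comp (mh 0) mJ).
have DT : \bigcup_M D M = setT.
  apply/seteqP; split => // t _.
  exists (Num.truncn `|g (J t)|).+1 => //=.
  by rewrite /D/= ltW// truncnS_gt.
have ndD : nondecreasing_seq D.
  move=> m n mn; apply/subsetPset => t; rewrite /D/= => /le_trans; apply.
  by rewrite ler_nat.
have := @ge0_nondecreasing_set_cvg_integral _ _ _ D (fun t => (h (J t) 0)%:E) P ndD mD.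
move=> /(_ (fun i => measurable_funTS mh0) (fun i x _ => h0 _ _)).
rewrite DT => cvgI.
have <- := cvg_lim (@ereal_hausdorff R) cvgI.
apply: lime_le; first by apply/cvg_ex; eexists; exact: cvgI.
by apply: nearW => M; exact: trunc_jensen.
Qed.

End conditional_jensen.

(** * Moments and centering of the noise *)
Section rectangles.
Context d (R : realType) (D : measurableType d) (n : nat).

Definition rectangle (A : set D) (B : 'I_n -> set R) : set (D * n.-tuple R) :=
  [set p | A p.1 /\ forall j, B j (tnth p.2 j)].

Definition rectangles : set (set (D * n.-tuple R)) :=
  [set C | exists A B, [/\ measurable A, forall j, measurable (B j) &
    C = rectangle A B]].

Lemma setI_rectangles : setI_closed rectangles.
Proof.
move=> _ _ [A [B [mA mB ->]]] [A' [B' [mA' mB' ->]]].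
exists (A `&` A'), (fun j => B j `&` B' j); split.
- exact: measurableI.
- by move=> j; exact: measurableI.
- apply/seteqP; split => -[x y]; rewrite /rectangle/=.
    by move=> [[Ax By] [A'x B'y]].
  by move=> [[Ax A'x] By]; split; split => // j; case: (By j).
Qed.

Lemma measurable_rectangle A B : measurable A -> (forall j, measurable (B j)) ->
  measurable (rectangle A B).
Proof.
move=> mA mB; have -> : rectangle A B = (fst @^-1` A) `&`
    \bigcap_(j in [set: 'I_n]) ((fun p => tnth p.2 j) @^-1` B j).
  apply/seteqP; split => x [Ax Bx]; split => //= j; first by move=> _; exact: Bx.
  exact: (Bx j I).
apply: measurableI.
  by rewrite -[X in measurable X]setTI; exact: measurable_fst.
apply: fin_bigcap_measurable => // j _.
rewrite -[X in measurable X]setTI.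
by apply: (measurableT_comp (measurable_tnth j) measurable_snd).
Qed.

Lemma measurable_rectangles :
  @measurable _ (D * n.-tuple R)%type = <<s rectangles >>.
Proof.
apply/seteqP; split; last first.
  apply: smallest_sub; first exact: sigma_algebra_measurable.
  by move=> _ [A [B [mA mB ->]]]; exact: measurable_rectangle.
pose G := g_sigma_algebraType rectangles.
pose idG : G -> D * n.-tuple R := id.
have rect A B : measurable A -> (forall j, measurable (B j)) ->
    measurable (rectangle A B : set G).
  by move=> mA mB; apply: sub_sigma_algebra; exists A, B.
have mid : measurable_fun setT idG.
  apply/measurable_fun_pairP; split.
    move=> _ A mA; rewrite setTI; have := rect A (fun=> setT) mA (fun=> measurableT).
    by congr measurable; apply/seteqP; split => x; rewrite /rectangle//= => -[].
  apply/measurable_fun_tnthP => j _ B mB; rewrite setTI.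
  have := rect setT (fun i => if i == j then B else setT) measurableT.
  have H i : measurable (if i == j then B else setT) by case: ifP.
  move=> /(_ H); congr measurable; apply/seteqP; split => x; rewrite /rectangle/=.
    by move=> [_ /(_ j)]; rewrite eqxx.
  by move=> Bx; split => // i; case: ifP => // /eqP ->.
by move=> C mC; have := mid measurableT C mC; rewrite setTI.
Qed.

End rectangles.

Lemma measurable_normr_powR d (T : measurableType d) (R : realType) (f : T -> R)
    (p : R) :
  measurable_fun setT f -> measurable_fun setT (fun t => `|f t| `^ p).
Proof.
move=> mf; apply: (measurableT_comp (measurable_powR p)).
exact: measurableT_comp.
Qed.

Section noise.
Context (R : realType) (d n : nat) (dT : measure_display)
  (T : measurableType dT) (P : probability T R).
Variables (X : 'I_n -> {RV P >-> d.-tuple R}) (eps : 'I_n -> {RV P >-> R}).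
Variable kap : 'I_n -> R.-pker (n.-tuple (d.-tuple R)) ~> R.
Hypothesis indep : independent_given_design X eps kap.
Variables (p sigma : R).
Hypothesis p_ge2 : 2 <= p.
Hypothesis moments : {ae P, forall w, forall i : 'I_n,
      (\int[kap i (design X w)]_e e%:E = 0)%E /\
      (\int[kap i (design X w)]_e (`|e| `^ p)%:E <= (sigma `^ p)%:E)%E}.

Lemma measurable_design : measurable_fun setT (design X).
Proof.
apply/measurable_fun_tnthP => i.
rewrite (_ : _ \o _ = X i); first exact: measurable_funPT.
by apply/funext => w /=; rewrite tnth_mktuple.
Qed.

Let mkapD i (C : set R) : measurable C ->
  measurable_fun setT (fun w => kap i (design X w) C : \bar R).
Proof.
move=> mC; exact: measurableT_comp (measurable_kernel (kap i) _ mC) measurable_design.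
Qed.

Let mkap_integral i (h : R -> \bar R) : measurable_fun setT h ->
  (forall e, 0 <= h e)%E ->
  measurable_fun setT (fun w => \int[kap i (design X w)]_e h e)%E.
Proof.
move=> mh h0.
apply: (measurable_fun_integral_kernel (l := fun w => kap i (design X w))) => //.
by move=> C mC; exact: mkapD.
Qed.

Let mdesign A : measurable A -> measurable (design X @^-1` A).
Proof. by move=> mA; rewrite -[X in measurable X]setTI; exact: measurable_design. Qed.

Let meps i B : measurable B -> measurable (eps i @^-1` B).
Proof. by move=> mB; rewrite -[X in measurable X]setTI; exact: measurable_funPT. Qed.

Let kfin i w C : measurable C -> kap i (design X w) C \is a fin_num.
Proof.
move=> mC; rewrite ge0_fin_numE//.
apply: (@le_lt_trans _ _ (kap i (design X w) setT)).
  by apply: le_measure => //; rewrite inE.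
by rewrite prob_kernel ltry.
Qed.

Let others (i : 'I_n) (A : set (n.-tuple (d.-tuple R))) (B : 'I_n -> set R) : set T :=
  design X @^-1` A `&` \bigcap_(j in [set j | j != i]) (eps j @^-1` B j).

Let mothers i A B : measurable A -> (forall j, measurable (B j)) ->
  measurable (others i A B).
Proof.
move=> mA mB; apply: measurableI; first exact: mdesign.
apply: fin_bigcap_measurable => [|j _]; last exact: meps.
exact: finite_finset.
Qed.

Let weight i A B w : R :=
  \1_(design X @^-1` A) w * \prod_(j < n | j != i) fine (kap j (design X w) (B j)).

Let mweight i A B : measurable A -> (forall j, measurable (B j)) ->
  measurable_fun setT (weight i A B).
Proof.
move=> mA mB; apply: measurable_funM.
  exact/measurable_indic/mdesign.
under eq_fun do rewrite big_mkcond.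
apply: measurable_prod => j _; have [_|//] := boolP (j != i).
apply/measurable_EFinP; rewrite (_ : _ \o _ = fun w => kap j (design X w) (B j)).
  exact: mkapD.
by apply/funext => w /=; rewrite fineK ?kfin.
Qed.

Let weight_ge0 i A B w : (forall j, measurable (B j)) -> 0 <= weight i A B w.
Proof.
move=> mB; rewrite mulr_ge0//.
by apply: prodr_ge0 => j _; rewrite fine_ge0.
Qed.

(** Conditionally on the design and on the other noise variables, [eps i] has
    the law [kap i]. *)
Let integral_eps i A B (h : R -> \bar R) : measurable A ->
  (forall j, measurable (B j)) -> measurable_fun setT h -> (forall e, 0 <= h e)%E ->
  (\int[P]_(w in others i A B) h (eps i w) =
   \int[P]_w ((weight i A B w)%:E * \int[kap i (design X w)]_e h e))%E.
Proof.
move=> mA mB mh h0.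
have mdir C : measurable C -> measurable_fun setT (fun t => \d_(eps i t) C : \bar R).
  move=> mC; under eq_fun do rewrite diracE -indicE.
  apply/measurable_EFinP.
  exact: (measurableT_comp (measurable_indic mC) (measurable_funPT (eps i))).
have mo := mothers i mA mB.
transitivity (\int[P]_w ((\1_(others i A B) w)%:E * \int[\d_(eps i w)]_e h e))%E.
  rewrite integral_mkcond; apply: eq_integral => w _.
  rewrite integral_dirac// diracT mul1e patchE indicE.
  by case: ifP => _; rewrite ?mul1e ?mul0e.
apply: eq_integral_mixture => //.
- exact: mkapD.
- exact: mweight.
- by move=> w; exact: weight_ge0.
move=> C mC.
pose B' j := if j == i then C else B j.
have mB' j : measurable (B' j) by rewrite /B'; case: ifP.
have := indep mA mB'.
have -> : design X @^-1` A `&` \bigcap_(j in [set: 'I_n]) (eps j @^-1` B' j) =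
    others i A B `&` eps i @^-1` C.
  rewrite /others; apply/seteqP; split => w.
    move=> [Aw Bw]; split; last by have := Bw i I; rewrite /B' /= eqxx.
    by split => // j /= ji; have := Bw j I; rewrite /B'/= (negbTE ji).
  move=> [[Aw Bw] Cw]; split => // j _; rewrite /B' /=.
  by case: eqVneq => [->//|ji]; exact: Bw.
move=> H; transitivity (P (others i A B `&` eps i @^-1` C)).
  rewrite -(setIT (_ `&` _)) -integral_indic//; last first.
    by apply: measurableI => //; exact: meps.
  apply: eq_integral => w _; rewrite /= !indicE diracE in_setI -EFinM.
  have -> : (eps i w \in C) = (w \in eps i @^-1` C) by apply/idP/idP; rewrite !inE.
  by case: (_ \in _); case: (_ \in _); rewrite /= ?mulr1 ?mulr0.
rewrite H [LHS]integral_mkcond; apply: eq_integral => w _.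
rewrite patchE /weight indicE; case: ifP => wA; last by rewrite !mul0r mul0e.
rewrite mul1r (bigD1 i)//= /B' eqxx muleC; congr (_ * _)%E.
rewrite (big_morph EFin EFinM erefl); apply: eq_bigr => j ji.
by rewrite (negbTE ji) fineK ?kfin.
Qed.

Let setT_others i (A : set (n.-tuple (d.-tuple R))) :
  others i A (fun=> setT) = design X @^-1` A.
Proof. by apply/seteqP; split => w //= -[]. Qed.

(** The bound is localized to events of the design because the numbers of points
    in boxes will be fixed before the noise is integrated. *)
Lemma noise_moment i A : measurable A ->
  (\int[P]_(w in design X @^-1` A) (`|eps i w| `^ p)%:E <=
   (sigma `^ p)%:E * P (design X @^-1` A))%E.
Proof.
move=> mA; rewrite -(setT_others i A).
have mpow : measurable_fun setT (fun e : R => (`|e| `^ p)%:E).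
  exact/measurable_EFinP/measurable_normr_powR.
rewrite (integral_eps i (h := fun e => (`|e| `^ p)%:E))//.
rewrite setT_others -integral_cst; last exact: mdesign.
rewrite [leRHS]integral_mkcond; apply: ae_ge0_le_integral => //.
- by move=> w _; rewrite mule_ge0 ?lee_fin ?weight_ge0// integral_ge0.
- by apply: emeasurable_funM; [exact/measurable_EFinP/mweight|exact: mkap_integral].
- by move=> w _; apply: erestrict_ge0 => ? _; rewrite /= lee_fin powR_ge0.
- by apply/(measurable_restrictT _ _).1 => //; exact: mdesign.
have := moments; apply: filterS => w /(_ i)[_ H] _.
rewrite patchE /weight indicE big1 ?mulr1; last first.
  by move=> j _; rewrite prob_kernel.
by case: ifP => _; rewrite ?mul1e ?mul0e.
Qed.

Lemma noise_integrable i : (\int[P]_w (`|eps i w|)%:E < +oo)%E.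
Proof.
have mpow : measurable_fun setT (fun w => (`|eps i w| `^ p)%:E).
  exact/measurable_EFinP/measurable_normr_powR.
apply: (@le_lt_trans _ _ (\int[P]_w (1 + (`|eps i w| `^ p)%:E))%E).
  apply: ge0_le_integral => //.
  - exact/measurable_EFinP/measurableT_comp.
  - by apply: emeasurable_funD.
  move=> w _; rewrite -EFinD lee_fin.
  have [e1|e1] := leP `|eps i w| 1; first by rewrite (le_trans e1)// lerDl powR_ge0.
  rewrite -[leLHS]powRr1// (le_trans _ (_ : `|eps i w| `^ p <= _))//; last by rewrite lerDr.
  by rewrite ler_powR ?ltW// (lt_le_trans _ p_ge2)// ltr1n.
rewrite ge0_integralD//.
apply: lte_add_pinfty.
  rewrite integral_cst// mul1e.
  exact: le_lt_trans (probability_le1 P measurableT) (ltry _).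
have := noise_moment i measurableT; rewrite preimage_setT.
rewrite (_ : P setT = 1%E) ?mule1 => [H|]; last exact: probability_setT.
by rewrite (le_lt_trans H)// ltry.
Qed.

Let centered_others i A B : measurable A -> (forall j, measurable (B j)) ->
  (\int[P]_(w in others i A B) ((eps i)^\+ w)%:E =
   \int[P]_(w in others i A B) ((eps i)^\- w)%:E)%E.
Proof.
move=> mA mB.
have mp : measurable_fun setT (fun e : R => (Num.max e 0)%:E).
  by apply/measurable_EFinP; exact: measurable_maxr.
have mn : measurable_fun setT (fun e : R => (Num.max (- e) 0)%:E).
  by apply/measurable_EFinP; apply: measurable_maxr => //; exact: measurableT_comp.
have p0 (e : R) : (0 <= (Num.max e 0)%:E)%E by rewrite lee_fin le_max lexx orbT.
have n0 (e : R) : (0 <= (Num.max (- e) 0)%:E)%E by rewrite lee_fin le_max lexx orbT.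
have := integral_eps i mA mB mp p0; rewrite /funrpos /= => ->.
have := integral_eps i mA mB mn n0; rewrite /funrneg /= => ->.
apply: ge0_ae_eq_integral => //.
- by apply: emeasurable_funM; [exact/measurable_EFinP/mweight|exact: mkap_integral].
- by apply: emeasurable_funM; [exact/measurable_EFinP/mweight|exact: mkap_integral].
- by move=> w _; rewrite mule_ge0 ?lee_fin ?weight_ge0// integral_ge0.
- by move=> w _; rewrite mule_ge0 ?lee_fin ?weight_ge0// integral_ge0.
have := moments; apply: filterS => w /(_ i)[H0 H] _; congr (_ * _)%E.
set mu := kap i (design X w).
have fin (h : R -> R) : measurable_fun setT h -> (forall e, 0 <= h e <= `|e|) ->
    (\int[mu]_e (h e)%:E)%E \is a fin_num.
  move=> mh hle; rewrite ge0_fin_numE; last first.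
    by apply: integral_ge0 => e _; rewrite lee_fin; case/andP: (hle e).
  have mpow : measurable_fun setT (fun e : R => (`|e| `^ p)%:E).
    exact/measurable_EFinP/measurable_normr_powR.
  apply: (@le_lt_trans _ _ (\int[mu]_e (1 + (`|e| `^ p)%:E))%E).
    apply: ge0_le_integral => //.
    - by move=> e _; rewrite lee_fin; case/andP: (hle e).
    - exact/measurable_EFinP.
    - by apply: emeasurable_funD.
    move=> e _; rewrite -EFinD lee_fin; apply: (@le_trans _ _ `|e|).
      by case/andP: (hle e).
    have [e1|e1] := leP `|e| 1; first by rewrite (le_trans e1)// lerDl powR_ge0.
    rewrite -[leLHS]powRr1// (le_trans _ (_ : `|e| `^ p <= _))//; last by rewrite lerDr.
    by rewrite ler_powR ?ltW// (lt_le_trans _ p_ge2)// ltr1n.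
  rewrite ge0_integralD//.
  apply: lte_add_pinfty; last by rewrite (le_lt_trans H)// ltry.
  rewrite integral_cst// mul1e /mu prob_kernel; exact: ltry.
have fp : (\int[mu]_e (Num.max e 0)%:E)%E \is a fin_num.
  apply: fin; first exact: measurable_maxr.
  by move=> e; rewrite le_max lexx orbT/= ge_max ler_norm normr_ge0.
have fn : (\int[mu]_e (Num.max (- e) 0)%:E)%E \is a fin_num.
  apply: fin; first by apply: measurable_maxr => //; exact: measurableT_comp.
  by move=> e; rewrite le_max lexx orbT/= ge_max -normrN ler_norm normr_ge0.
have Ep : (\int[mu]_e (fun x : R => x%:E)^\+ e = \int[mu]_e (Num.max e 0)%:E)%E.
  by apply: eq_integral => e _; rewrite funeposE EFin_max.
have En : (\int[mu]_e (fun x : R => x%:E)^\- e = \int[mu]_e (Num.max (- e) 0)%:E)%E.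
  by apply: eq_integral => e _; rewrite funenegE EFin_max.
move: H0; rewrite integralE Ep En -(fineK fp) -(fineK fn) -EFinB => -[].
by move=> /subr0_eq ->.
Qed.

(** The design and the noise variables but the [i]-th, whose slot is filled with
    0 so that the target does not depend on [i]. *)
Definition zeroed i w : n.-tuple (d.-tuple R) * n.-tuple R :=
  (design X w, [tuple if j == i then 0 else eps j w | j < n]).

Lemma measurable_zeroed i : measurable_fun setT (zeroed i).
Proof.
apply: measurable_fun_pair; first exact: measurable_design.
apply/measurable_fun_tnthP => j.
rewrite (_ : _ \o _ = fun w => if j == i then 0 else eps j w); last first.
  by apply/funext => w /=; rewrite tnth_mktuple.
by case: eqP => // _; exact: measurable_funPT.
Qed.

(** The identity holds on rectangles by the product rule, and the pi-lambda
    theorem extends it to the events that [zeroed i] generates. *)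
Lemma noise_centered i C : measurable C ->
  (\int[P]_(w in zeroed i @^-1` C) ((eps i)^\+ w)%:E =
   \int[P]_(w in zeroed i @^-1` C) ((eps i)^\- w)%:E)%E.
Proof.
have mJ C' : measurable C' -> measurable (zeroed i @^-1` C').
  by move=> mC'; rewrite -[X in measurable X]setTI; exact: measurable_zeroed.
have mp : measurable_fun setT (fun w => ((eps i)^\+ w)%:E).
  exact/measurable_EFinP/measurable_funrpos.
have mn : measurable_fun setT (fun w => ((eps i)^\- w)%:E).
  exact/measurable_EFinP/measurable_funrneg.
have setTe : (\int[P]_w ((eps i)^\+ w)%:E = \int[P]_w ((eps i)^\- w)%:E)%E.
  have := centered_others i (@measurableT _ _) (fun=> measurableT).
  by rewrite setT_others preimage_setT.
move=> mC; have : <<s @rectangles _ R _ n >> C by rewrite -measurable_rectangles.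
apply: (dynkin_induction (P := [set C | (\int[P]_(w in zeroed i @^-1` C) ((eps i)^\+ w)%:E =
   \int[P]_(w in zeroed i @^-1` C) ((eps i)^\- w)%:E)%E])) => /=.
- exact: measurable_rectangles.
- exact: setI_rectangles.
- by rewrite preimage_setT.
- move=> _ [A [B [mA mB ->]]] /=.
  have [B0|B0] := pselect (B i 0).
    have -> : zeroed i @^-1` rectangle A B = others i A B.
      apply/seteqP; split => w.
        move=> [Aw Bw]; split => // j /= ji; have := Bw j.
        by rewrite tnth_mktuple (negbTE ji).
      move=> [Aw Bw]; split => // j; rewrite tnth_mktuple.
      by case: eqVneq => [->//|ji]; exact: Bw.
    exact: centered_others.
  have -> : zeroed i @^-1` rectangle A B = set0.
    apply/seteqP; split => // w [_ /(_ i)].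
    by rewrite tnth_mktuple eqxx.
  by rewrite !integral_set0.
- move=> S mS eqS; rewrite preimage_setC.
  have finP (f : T -> R) : measurable_fun setT f -> (forall w, 0 <= f w <= `|eps i w|) ->
      (\int[P]_(w in zeroed i @^-1` S) (f w)%:E)%E \is a fin_num.
    move=> mf fle; rewrite ge0_fin_numE; last first.
      by apply: integral_ge0 => w _; rewrite lee_fin; case/andP: (fle w).
    apply: le_lt_trans (noise_integrable i).
    apply: (@le_trans _ _ (\int[P]_w (f w)%:E)%E).
      apply: ge0_subset_integral => //; [exact: mJ|exact/measurable_EFinP|].
      by move=> w _; rewrite lee_fin; case/andP: (fle w).
    apply: ge0_le_integral => //.
    + by move=> w _; rewrite lee_fin; case/andP: (fle w).
    + exact/measurable_EFinP.
    + exact/measurable_EFinP/measurableT_comp.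
    + by move=> w _; rewrite lee_fin; case/andP: (fle w).
  have fp : (\int[P]_(w in zeroed i @^-1` S) ((eps i)^\+ w)%:E)%E \is a fin_num.
    apply: finP; first exact: measurable_funrpos.
    by move=> w; rewrite funrpos_ge0/= /funrpos ge_max ler_norm normr_ge0.
  have split_ (f : T -> R) : measurable_fun setT (fun w => (f w)%:E) ->
      (forall w, 0 <= f w) ->
      (\int[P]_w (f w)%:E = \int[P]_(w in zeroed i @^-1` S) (f w)%:E +
        \int[P]_(w in ~` (zeroed i @^-1` S)) (f w)%:E)%E.
    move=> mf f0; rewrite -(setvU (zeroed i @^-1` S)) ge0_integral_setU//.
    - by rewrite addeC.
    - by apply: measurableC; exact: mJ.
    - exact: mJ.
    - by rewrite setvU.
    - by move=> w _; rewrite lee_fin.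
    - by rewrite disj_set2E setICl eqxx.
  move: setTe; rewrite (split_ _ mp (funrpos_ge0 _)) (split_ _ mn (funrneg_ge0 _)).
  rewrite -eqS ![(\int[P]_(w in zeroed i @^-1` S) _ + _)%E]addeC.
  by move=> /(congr1 (fun z => z - \int[P]_(w in zeroed i @^-1` S) ((eps i)^\+ w)%:E)%E); rewrite !addeK.
- move=> F mF tF eqF; rewrite preimage_bigcup.
  have tJF : trivIset setT (fun k => zeroed i @^-1` F k).
    apply/trivIsetP => k l _ _ kl; rewrite -preimage_setI.
    by move/trivIsetP : tF => /(_ _ _ I I kl) ->; rewrite preimage_set0.
  have mJF k : measurable (zeroed i @^-1` F k) by exact: mJ.
  rewrite ge0_integral_bigcup//; [|exact: measurable_funTS|].
    rewrite ge0_integral_bigcup//; [|exact: measurable_funTS|].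
      by apply: eq_eseriesr => k _; exact: eqF.
    by move=> w _; rewrite lee_fin funrneg_ge0.
  by move=> w _; rewrite lee_fin funrpos_ge0.
Qed.

End noise.

(** * Random signs *)
Section powR_facts.
Context (R : realType).
Implicit Types a t s y p : R.

Lemma powR_le_expR p y : 0 < p -> 0 <= y -> y `^ p <= p `^ p * expR y.
Proof.
move=> p0; rewrite le_eqVlt => /predU1P[<-|y0].
  by rewrite powR0 ?gt_eqF// mulr_ge0 ?powR_ge0 ?expR_ge0.
have yp : 0 < y / p by rewrite divr_gt0.
have -> : y `^ p = (y / p * p) `^ p by rewrite divfK// gt_eqF.
rewrite (powRM _ (ltW yp) (ltW p0)) [leLHS]mulrC ler_wpM2l ?powR_ge0//.
rewrite {1}/powR gt_eqF// ler_expR.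
rewrite -[leRHS](divfK (lt0r_neq0 p0)) [leLHS]mulrC (ler_wpM2r (ltW p0))//.
exact/ltW/ln_sublinear.
Qed.

(** Young's inequality for a / t and 1 with exponent [s], scaled by t `^ s. *)
Lemma powR_tangent a t s : 0 <= a -> 0 < t -> 1 <= s ->
  t `^ s + s * t `^ (s - 1) * (a - t) <= a `^ s.
Proof.
move=> a0 t0; rewrite le_eqVlt => /predU1P[<-|s1].
  by rewrite subrr powRr0 (powRr1 (ltW t0)) (powRr1 a0); lra.
have s0 : 0 < s by rewrite (lt_trans _ s1).
have q0 : 0 < (1 - s^-1)^-1 by rewrite invr_gt0 subr_gt0 invf_lt1.
have u0 : 0 <= a / t by rewrite divr_ge0// ltW.
have := conjugate_powR (p := s) (q := (1 - s^-1)^-1) u0 ler01.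
rewrite !s0 !q0 invrK subrKC powR1 mul1r mulr1 => /(_ isT isT erefl) H.
have -> : a = a / t * t by rewrite divfK// gt_eqF.
rewrite (powRM _ u0 (ltW t0)) [X in _ * (_ - X)](_ : t = 1 * t) ?mul1r//.
have ts : t `^ s = t `^ (s - 1) * t.
  by rewrite mulrC mulr_powRB1// (ltW t0).
have -> : t `^ s + s * t `^ (s - 1) * (a / t * t - t) =
    (1 + s * (a / t - 1)) * t `^ s by rewrite ts; ring.
rewrite ler_wpM2r ?powR_ge0//.
have : s * (a / t) <= s * ((a / t) `^ s / s + (1 - s^-1)) by apply: ler_wpM2l => //; exact: ltW.
have -> : s * ((a / t) `^ s / s + (1 - s^-1)) = (a / t) `^ s + s - 1.
  by field; rewrite gt_eqF.
lra.
Qed.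

Lemma power_mean (I : finType) (A : {pred I}) (a : I -> R) s : 1 <= s ->
  (forall i, 0 <= a i) ->
  (\sum_(i in A) a i) `^ s <= #|A|%:R `^ (s - 1) * \sum_(i in A) a i `^ s.
Proof.
move=> s1 a0; set m : R := #|A|%:R; set S := \sum_(i in A) a i.
have S0 : 0 <= S by rewrite sumr_ge0.
have s0 : 0 < s by rewrite (lt_le_trans _ s1).
have [S00|Sn0] := eqVneq S 0.
  rewrite S00 powR0 ?gt_eqF// mulr_ge0 ?powR_ge0// sumr_ge0// => i _.
  exact: powR_ge0.
have m0 : 0 < m.
  rewrite ltr0n lt0n; apply: contra Sn0 => /eqP/card0_eq A0.
  by rewrite /S big_pred0.
have Sp : 0 < S by rewrite lt_def Sn0.
have t0 : 0 < S / m by rewrite divr_gt0.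
have : \sum_(i in A) ((S / m) `^ s + s * (S / m) `^ (s - 1) * (a i - S / m)) <=
    \sum_(i in A) a i `^ s by apply: ler_sum => i _; exact: powR_tangent.
rewrite big_split/= -mulr_sumr sumrB !sumr_const -(mulr_natr ((S / m) `^ s)) -(mulr_natr (S / m)) -/m -/S.
rewrite divfK ?gt_eqF// subrr mulr0 addr0 => H.
have -> : S `^ s = m `^ (s - 1) * ((S / m) `^ s * m).
  rewrite mulrCA [X in _ * X]mulrC mulr_powRB1 ?(ltW m0)//.
  by rewrite -(powRM _ (ltW t0) (ltW m0)) divfK ?gt_eqF.
by rewrite ler_wpM2l ?powR_ge0.
Qed.

(** The exponent 2 y^2 instead of the optimal y^2 / 2 makes the bound follow from
    expR z >= 1 + z alone. *)
Lemma cosh_le_expR y : expR y + expR (- y) <= 2 * expR (2 * y ^+ 2).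
Proof.
wlog y0 : y / 0 <= y => [H|].
  have [/H//|/ltW y0] := leP 0 y.
  by have := H (- y); rewrite oppr_ge0 opprK sqrrN addrC; exact.
have [y2|y2] := leP (1 / 2) y.
  have : expR y <= expR (2 * y ^+ 2) by rewrite ler_expR; nra.
  have : expR (- y) <= expR (2 * y ^+ 2) by rewrite ler_expR; nra.
  lra.
have h1 : expR y <= (1 - y)^-1.
  have y1 : 0 < 1 - y by lra.
  rewrite -[leLHS]invrK lef_pV2 ?posrE ?invr_gt0 ?expR_gt0//.
  by rewrite -expRN expR_ge1Dx.
have h2 : expR (- y) <= (1 + y)^-1.
  have y1 : 0 < 1 + y by lra.
  by rewrite expRN lef_pV2 ?posrE ?expR_gt0// expR_ge1Dx.
have h3 : 1 + 2 * y ^+ 2 <= expR (2 * y ^+ 2) by exact: expR_ge1Dx.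
apply: (le_trans (lerD h1 h2)); apply: (@le_trans _ _ (2 * (1 + 2 * y ^+ 2))); last lra.
have d0 : 0 < 1 - y ^+ 2 by nra.
have -> : (1 - y)^-1 + (1 + y)^-1 = 2 / (1 - y ^+ 2).
  field.
  by apply/and3P; split; rewrite gt_eqF//; nra.
rewrite ler_pdivrMr//.
have w0 : 0 <= y ^+ 2 by exact: sqr_ge0.
have w1 : y ^+ 2 <= 1 / 2 by nra.
by move: w0 w1; set w := y ^+ 2 => w0 w1; nra.
Qed.

End powR_facts.

Section rademacher.
Local Close Scope classical_set_scope.
Context (R : realType) (n : nat).
Implicit Types (r : {ffun 'I_n -> bool}) (z : 'I_n -> R).

(** Signs are boolean functions, so that the expectation over independent
    random signs is a finite average. *)
Definition flip r z : 'I_n -> R := fun i => (-1) ^+ r i * z i.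

(** After normalizing by the Euclidean norm, powers are dominated by
    exponentials, and the exponential moments of the signed sum factor. *)
Lemma khintchine p z : 0 < p ->
  \sum_r `|\sum_i flip r z i| `^ p <=
  (2 ^ n)%:R * (2 * expR 2 * p `^ p) * (\sum_i z i ^+ 2) `^ (p / 2).
Proof.
move=> p0; set V := \sum_i z i ^+ 2.
have V0 : 0 <= V by apply: sumr_ge0 => i _; exact: sqr_ge0.
have p20 : 0 < p / 2 by rewrite divr_gt0.
have [V00|Vn0] := eqVneq V 0.
  rewrite big1 ?V00 ?powR0 ?mulr0 ?gt_eqF// => r _.
  rewrite big1 ?normr0 ?powR0 ?gt_eqF// => i _; rewrite /flip.
  have /psumr_eq0P -/(_ (fun i _ => sqr_ge0 (z i))) H := V00.
  by have /eqP := H i isT; rewrite sqrf_eq0 => /eqP ->; rewrite mulr0.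
pose s := Num.sqrt V.
have s0 : 0 < s by rewrite sqrtr_gt0 lt_def Vn0.
have sV : V `^ (p / 2) = s `^ p.
  by rewrite /s -powR12_sqrt// -powRrM mulrC.
have exp_sum (e : R) : e ^+ 2 = 1 ->
    \sum_r expR (e * (\sum_i flip r z i) / s) <= (2 ^ n)%:R * expR 2.
  move=> e1.
  have -> : \sum_r expR (e * (\sum_i flip r z i) / s) =
      \sum_(r : {ffun 'I_n -> bool}) \prod_i expR (e * ((-1) ^+ r i * z i) / s).
    by apply: eq_bigr => r _; rewrite mulr_sumr mulr_suml expR_sum.
  rewrite -(bigA_distr_bigA (fun i (b : bool) => expR (e * ((-1) ^+ b * z i) / s))).
  have -> : (2 ^ n)%:R * expR 2 = \prod_(i < n) (2 * expR (2 * (z i / s) ^+ 2)) :> R.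
    rewrite big_split/= prodr_const card_ord natrX -expR_sum -mulr_sumr.
    under eq_bigr do rewrite expr_div_n.
    by rewrite -mulr_suml -/V /s sqr_sqrtr// divff// mulr1.
  apply: ler_prod => i _; rewrite sumr_ge0 => [/=|b _]; last exact: expR_ge0.
  rewrite big_bool/= expr1 expr0 mul1r mulN1r.
  have -> : expR (2 * (z i / s) ^+ 2) = expR (2 * (e * z i / s) ^+ 2).
    by rewrite -[e * z i / s]mulrA [in RHS]exprMn e1 mul1r.
  rewrite addrC mulrN mulNr; exact: cosh_le_expR.
rewrite sV.
have step r : `|\sum_i flip r z i| `^ p <= s `^ p * p `^ p *
    (expR (1 * (\sum_i flip r z i) / s) + expR (-1 * (\sum_i flip r z i) / s)).
  set S := \sum_i _.
  have -> : `|S| = s * (`|S| / s) by rewrite mulrC divfK// gt_eqF.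
  rewrite (powRM _ (ltW s0)) ?divr_ge0 ?(ltW s0)// -mulrA ler_wpM2l ?powR_ge0//.
  apply: (le_trans (powR_le_expR p0 _)); first by rewrite divr_ge0 ?(ltW s0).
  rewrite ler_wpM2l ?powR_ge0// mul1r mulN1r.
  have [S0|S0] := leP 0 S; first by rewrite ger0_norm// lerDl expR_ge0.
  by rewrite ltr0_norm// mulNr lerDr expR_ge0.
apply: (le_trans (ler_sum _ (fun r _ => step r))).
rewrite -mulr_sumr big_split/=.
have e1 := exp_sum 1 (expr1n _ _); have e2 := exp_sum (-1) (sqrr_sign R 1).
have := ler_wpM2l (mulr_ge0 (powR_ge0 s p) (powR_ge0 p p)) (lerD e1 e2).
move=> H; apply: (le_trans H).
by rewrite le_eqVlt; apply/orP; left; apply/eqP; ring.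
Qed.

(** On functions of all indices, so that its value on a set of indices is its
    value at a function that vanishes outside the set. *)
Definition seminorm (N : ('I_n -> R) -> R) :=
  [/\ forall z, 0 <= N z, forall z1 z2, N (fun i => z1 i + z2 i) <= N z1 + N z2 &
   forall c z, N (fun i => c * z i) = `|c| * N z].

(** [None] is a threshold below all levels. *)
Definition above (t : 'I_n -> R) (k : option 'I_n) : {set 'I_n} :=
  if k is Some k' then [set i | t k' <= t i] else [set: 'I_n].

Definition keep (A : {set 'I_n}) z : 'I_n -> R :=
  fun i => if i \in A then z i else 0.

Lemma above_chain t k l : (above t k \subset above t l) || (above t l \subset above t k).
Proof.
case: k l => [k|] [l|] /=; rewrite ?finset.subsetT ?orbT//.
have [kl|lk] := leP (t k) (t l); apply/orP.
  by right; apply/fintype.subsetP => i; rewrite !inE; exact: le_trans.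
by left; apply/fintype.subsetP => i; rewrite !inE; apply: le_trans; exact: ltW.
Qed.

Section levy.
Variables (N : ('I_n -> R) -> R) (t : 'I_n -> R) (z : 'I_n -> R) (lam : R).
Hypothesis Nsemi : seminorm N.

Let bad k r := lam < N (keep (above t k) (flip r z)).
Let first r : {set 'I_n} := [set i | [forall k, bad k r ==> (i \in above t k)]].
Let tau r : {ffun 'I_n -> bool} :=
  [ffun i => if i \in first r then r i else ~~ r i].

(* The sets [above t k] form a chain, so the smallest one that exceeds the
   threshold is the intersection of all of them. *)
Let first_above r k0 : bad k0 r -> exists2 k, bad k r & first r = above t k.
Proof.
move=> bk0.
case: (@arg_minnP _ k0 (bad^~ r) (fun k => #|above t k|) bk0) => k bk kmin.
exists k => //; apply/setP => i; rewrite inE; apply/forallP/idP => [/(_ k)|ik l].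
  by rewrite bk.
apply/implyP => bl; have := above_chain t k l => /orP[/fintype.subsetP/(_ _ ik)//|lk].
have /eqP -> // : above t l == above t k by rewrite eqEcard lk kmin.
Qed.

Let tau_bad r l : above t l \subset first r -> bad l (tau r) = bad l r.
Proof.
move=> lf; rewrite /bad; congr (_ < N _); apply/funext => i.
rewrite /keep /flip; case: ifP => // il.
by rewrite ffunE (fintype.subsetP lf).
Qed.

Let first_tau r k0 : bad k0 r -> first (tau r) = first r.
Proof.
move=> bk0; have [k bk fk] := first_above bk0.
have bkt : bad k (tau r) by rewrite tau_bad ?fk.
have [l bl fl] := first_above bkt; apply/eqP; rewrite finset.eqEsubset; apply/andP; split.
  by rewrite fk; apply/fintype.subsetP => i; rewrite inE => /forallP/(_ k); rewrite bkt.
rewrite fl; have := above_chain t k l => /orP[kl|lk]; first by rewrite fk.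
apply/fintype.subsetP => i; rewrite inE => /forallP/(_ l).
by rewrite -tau_bad ?fk// bl.
Qed.

Let tauK r k0 : bad k0 r -> tau (tau r) = r.
Proof.
move=> bk0; apply/ffunP => i; rewrite ffunE (first_tau bk0) ffunE.
by case: (i \in first r) => //; rewrite negbK.
Qed.

(** Reflecting all signs outside the first index set on which the threshold is
    exceeded is an involution, and the partial sum over that set is the mean of
    the two full sums; so one of them exceeds the threshold as well. *)
Lemma levy_count :
  (#|[set r | [exists k, (lam < N (keep (above t k) (flip r z)))%R]]| <=
   2 * #|[set r | (lam < N (flip r z))%R]|)%N.
Proof.
set B := [set r | _]; set G := [set r | _].
have BG r : r \in B -> (r \in G) || (tau r \in G).
  rewrite !inE => /existsP[k0 bk0]; have [k bk fk] := first_above bk0.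
  apply: contraLR bk; rewrite negb_or -!leNgt => /andP[G1 G2].
  have [N0 NT NZ] := Nsemi.
  have -> : keep (above t k) (flip r z) =
      (fun i => 2^-1 * (flip r z i + flip (tau r) z i)).
    apply/funext => i; rewrite /keep /flip ffunE fk; case: ifP => _.
      by field.
    by case: (r i); rewrite /= ?expr0 ?expr1; field.
  rewrite NZ ger0_norm//.
  by have := NT (flip r z) (flip (tau r) z); lra.
have sub : B \subset G :|: [set r in B | tau r \in G].
  apply/fintype.subsetP => r rB; rewrite inE; have /orP[->//|tG] := BG _ rB.
  by rewrite [_ \in [set _ in _ | _]]inE rB tG orbT.
apply: (leq_trans (subset_leq_card sub)).
apply: (leq_trans (leq_card_setU _ _)).
rewrite mul2n -addnn leq_add2l.
have injt : {in [set r in B | tau r \in G] &, injective tau}.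
  have ex r : r \in [set r in B | tau r \in G] -> exists k, bad k r.
    by rewrite !inE => /andP[/existsP].
  move=> r1 r2 /ex[k1 b1] /ex[k2 b2] e.
  by rewrite -(tauK b1) -(tauK b2) e.
rewrite -(card_in_imset injt); apply: subset_leq_card.
by apply/fintype.subsetP => x /imsetP[r]; rewrite inE => /andP[_ tG] ->.
Qed.

End levy.

End rademacher.

(** Domination of the counting functions implies domination of the sums, by
    integrating over the threshold. *)
Lemma sum_le_of_count (R : realType) (I : finType) (F G : I -> R) c :
  (forall i, 0 <= F i) -> (forall i, 0 <= G i) ->
  (forall lam, 0 <= lam ->
    (#|[set i | (lam < F i)%R]%SET| <= c * #|[set i | (lam < G i)%R]%SET|)%N) ->
  \sum_i F i <= c%:R * \sum_i G i.
Proof.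
move=> F0 G0 FG.
have layer (H : I -> R) : (forall i, 0 <= H i) ->
    ((\sum_i H i)%:E = \int[@lebesgue_measure R]_x
      (\sum_(i : I) (\1_(`[0%R, H i[%classic) x)%:E))%E.
  move=> H0; rewrite ge0_integral_sum//; last first.
    by move=> i; exact/measurable_EFinP/measurable_indic.
  rewrite -sumEFin; apply: eq_bigr => i _.
  rewrite integral_indic// setIT.
  transitivity (@lebesgue_measure R `[0, H i[%classic) => //.
  rewrite lebesgue_measure_itv/= lte_fin.
  have [|] := ltP 0 (H i); first by rewrite oppr0 adde0.
  by move=> Hi; congr EFin; apply/eqP; rewrite eq_le Hi H0.
have mlayer (H : I -> R) : measurable_fun setT (fun x : R =>
    (\sum_(i : I) (\1_(`[0%R, H i[%classic) x)%:E)%E).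
  by apply: emeasurable_sum => i; exact/measurable_EFinP/measurable_indic.
rewrite -lee_fin EFinM (layer _ F0) (layer _ G0) -ge0_integralZl;
  [|by []|exact: mlayer|by move=> x _; apply: sume_ge0|by rewrite lee_fin].
apply: ge0_le_integral.
- by [].
- by move=> x _; apply: sume_ge0.
- exact: mlayer.
- by apply: measurable_funeM; exact: mlayer.
move=> x _; rewrite !sumEFin -EFinM lee_fin.
have cnt (H : I -> R) : \sum_(i : I) \1_(`[0, H i[%classic) x =
    if 0 <= x then (#|[set i | (x < H i)%R]%SET|)%:R else 0 :> R.
  have [x0|x0] := leP 0 x.
    rewrite -sum1_card natr_sum [RHS]big_mkcond/=; apply: eq_bigr => i _.
    rewrite indicE inE; case: (boolP (x < H i)) => xH.
      by rewrite mem_set//= in_itv/= x0.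
    by rewrite memNset//= in_itv/= x0/=; exact/negP.
  rewrite big1// => i _; rewrite indicE memNset//= in_itv/=.
  by move=> /andP[/le_lt_trans/(_ x0)]; rewrite ltxx.
rewrite !cnt; case: ifP => x0; last by rewrite mulr0.
by rewrite -natrM ler_nat FG.
Qed.

Section level_norm.
Local Close Scope classical_set_scope.
Context (R : realType) (n : nat).
Implicit Types (r : {ffun 'I_n -> bool}) (z t : 'I_n -> R) (ts : seq ('I_n -> R)).

(** The largest absolute value of a sum of [z] over a set of indices cut out by
    one threshold for each of the levels [ts]. The thresholds range over the
    values of the levels only, so that the maximum is finite and measurable. *)
Fixpoint level_norm ts z : R :=
  if ts is t :: ts' then
    \big[Num.max/0]_(k : option 'I_n) level_norm ts' (keep (above t k) z)
  else `|\sum_i z i|.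

Lemma keepD A z1 z2 : keep A (fun i => z1 i + z2 i) =
  (fun i => keep A z1 i + keep A z2 i).
Proof. by apply/funext => i; rewrite /keep; case: ifP => //; rewrite addr0. Qed.

Lemma keepZ A c z : keep A (fun i => c * z i) = (fun i => c * keep A z i).
Proof. by apply/funext => i; rewrite /keep; case: ifP => //; rewrite mulr0. Qed.

Lemma level_norm_seminorm ts : seminorm (level_norm ts).
Proof.
elim: ts => [|t ts [N0 NT NZ]]; split => /=.
- by move=> z; exact: normr_ge0.
- by move=> z1 z2; rewrite big_split/= ler_normD.
- by move=> c z; rewrite -mulr_sumr normrM.
- by move=> z; exact: bigmax_ge_id.
- move=> z1 z2; apply/bigmax_leP; split.
    by rewrite addr_ge0// bigmax_ge_id.
  move=> k _; rewrite keepD (le_trans (NT _ _))//.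
  by apply: lerD; apply: le_bigmax.
- move=> c z; under eq_bigr do rewrite keepZ NZ.
  by rewrite (big_morph (fun x => `|c| * x) (id1 := 0) (op1 := Num.max)) ?mulr0//
     => x y; rewrite maxr_pMr.
Qed.

(** An arbitrary threshold selects the same indices as the smallest level above
    it. *)
Lemma level_norm_ge (I : Type) (s : seq I) (t : I -> 'I_n -> R) (c : I -> R) z :
  `|\sum_(i | all (fun j => c j <= t j i) s) z i| <= level_norm [seq t j | j <- s] z.
Proof.
elim: s z => [|j s IH] z //=.
have [[k0 ck0]|nok] := pselect (exists k, c j <= t j k); last first.
  rewrite big1 ?normr0 ?bigmax_ge_id// => i /andP[ci _].
  by exfalso; apply: nok; exists i.
case: (@arg_minP _ _ _ k0 (fun k => c j <= t j k) (t j) ck0) => k ck kmin.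
apply: le_trans (le_bigmax _ _ (Some k)); apply: le_trans (IH _).
rewrite le_eqVlt; apply/orP; left; apply/eqP; congr `|_|.
rewrite [RHS]big_mkcond [LHS]big_mkcond/=; apply: eq_bigr => i _.
rewrite /keep inE.
have -> : (t j k <= t j i) = (c j <= t j i).
  by apply/idP/idP => [|/kmin//]; exact: le_trans.
by case: (c j <= t j i) => //=; case: ifP.
Qed.

(** One application of [levy_count] for each level, to the seminorm made of the
    remaining levels. *)
Lemma level_norm_levy ts z p : 0 < p ->
  \sum_r level_norm ts (flip r z) `^ p <=
  (2 ^ size ts)%:R * \sum_r `|\sum_i flip r z i| `^ p.
Proof.
move=> p0; elim: ts => [|t ts IH] /=; first by rewrite mul1r.
have [N0 NT NZ] := level_norm_seminorm ts.
apply: (@le_trans _ _ (2%:R * \sum_r level_norm ts (flip r z) `^ p)); last first.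
  by rewrite expnS natrM -mulrA ler_wpM2l.
apply: sum_le_of_count => [r|r|lam lam0]; [exact: powR_ge0|exact: powR_ge0|].
have pow_lt (x : R) : 0 <= x -> (lam < x `^ p) = (lam `^ p^-1 < x).
  move=> x0; rewrite !ltNge; congr (~~ _); apply/idP/idP => H.
    rewrite -[x](@powRr1 _ _ x0) -(mulfV (lt0r_neq0 p0)) powRrM.
    by apply: ge0_ler_powR; rewrite ?nnegrE ?powR_ge0// invr_ge0 ltW.
  rewrite -[lam](@powRr1 _ _ lam0) -(mulVf (lt0r_neq0 p0)) powRrM.
  by apply: ge0_ler_powR; rewrite ?nnegrE ?powR_ge0// ltW.
have := levy_count t z (lam `^ p^-1) (level_norm_seminorm ts).
set B := [set r | _]; set G := [set r | _].
have -> : B = [set r | lam < (level_norm (t :: ts) (flip r z)) `^ p].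
  apply/setP => r; rewrite !inE pow_lt; last exact: bigmax_ge_id.
  apply/existsP/idP => [[k Hk]|]; first exact: lt_le_trans Hk (le_bigmax _ _ _).
  rewrite ltNge => H; apply/existsP; apply: contraNT H => /existsPn H.
  apply/bigmax_leP; split; first exact: powR_ge0.
  by move=> k _; have := H k; rewrite -leNgt.
have -> : G = [set r | lam < (level_norm ts (flip r z)) `^ p].
  by apply/setP => r; rewrite !inE pow_lt.
by [].
Qed.

Definition sign_const (p : R) : R := 2 * expR 2 * p `^ p.

(** The Levy, Khintchine and power mean inequalities, in this order. *)
Lemma level_norm_average ts (A : {set 'I_n}) z p : 2 <= p ->
  \sum_r level_norm ts (flip r (keep A z)) `^ p <=
  (2 ^ n)%:R * ((2 ^ size ts)%:R * sign_const p * #|A|%:R `^ (p / 2 - 1) *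
    \sum_(i in A) `|z i| `^ p).
Proof.
move=> p2; have p0 : 0 < p by rewrite (lt_le_trans _ p2).
apply: (le_trans (level_norm_levy ts _ p0)).
have sc0 : 0 <= sign_const p by rewrite !mulr_ge0 ?powR_ge0 ?expR_ge0.
have -> : forall a b c e g : R, a * (b * c * e * g) = b * (a * c * (e * g)).
  by move=> *; ring.
apply: ler_wpM2l => //.
apply: (le_trans (khintchine _ p0)); rewrite -/(sign_const p).
apply: ler_wpM2l; first exact: mulr_ge0.
have -> : \sum_i keep A z i ^+ 2 = \sum_(i in A) z i ^+ 2.
  rewrite [RHS]big_mkcond/=; apply: eq_bigr => i _.
  by rewrite /keep; case: ifP => //; rewrite expr0n.
have p21 : 1 <= p / 2 by rewrite ler_pdivlMr// mul1r.
apply: (le_trans (power_mean A p21 (fun i => sqr_ge0 (z i)))).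
rewrite ler_wpM2l ?powR_ge0//; apply: ler_sum => i _.
rewrite -real_normK ?num_real// -powR_mulrn// -powRrM.
by rewrite (_ : 2%:R * (p / 2) = p)//; field.
Qed.

End level_norm.

Lemma measurable_bigmax d (T : measurableType d) (R : realType) (I : Type)
    (s : seq I) (f : I -> T -> R) :
  (forall i, measurable_fun setT (f i)) ->
  measurable_fun setT (fun x => \big[Num.max/0]_(i <- s) f i x).
Proof.
move=> mf; elim: s => [|i s IH].
  by under eq_fun do rewrite big_nil; exact: measurable_cst.
under eq_fun do rewrite big_cons.
exact: measurable_maxr.
Qed.

Lemma measurable_level_norm d (T : measurableType d) (R : realType) (n : nat)
    (J : Type) (s : seq J) (lev : J -> T -> 'I_n -> R) (z : T -> 'I_n -> R) :
  (forall j i, measurable_fun setT (fun x => lev j x i)) ->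
  (forall i, measurable_fun setT (fun x => z x i)) ->
  measurable_fun setT (fun x => level_norm [seq lev j x | j <- s] (z x)).
Proof.
move=> ml; elim: s z => [|j s IH] z mz /=.
  by apply: measurableT_comp => //; exact: measurable_sum.
apply: measurable_bigmax => k.
apply: (IH (fun x => keep (above (lev j x) k) (z x))) => i.
rewrite /keep; apply: measurable_fun_ifT => //.
case: k => [k|] /=; last by under eq_fun do rewrite inE; exact: measurable_cst.
under eq_fun do rewrite inE.
exact: measurable_fun_ler.
Qed.

Lemma seminorm_powR_convex (R : realType) (n : nat) (N : ('I_n -> R) -> R)
    (p : R) z0 z1 l :
  seminorm N -> 1 <= p -> 0 <= l <= 1 ->
  N (fun i => l * z0 i + (1 - l) * z1 i) `^ p <=
  l * N z0 `^ p + (1 - l) * N z1 `^ p.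
Proof.
move=> [N0 NT NZ] p1 /andP[l0 l1].
have p0 : 0 < p by rewrite (lt_le_trans _ p1).
have l1' : 0 <= 1 - l by rewrite subr_ge0.
set m := l * N z0 + (1 - l) * N z1.
have m0 : 0 <= m by rewrite addr_ge0// mulr_ge0.
apply: (@le_trans _ _ (m `^ p)).
  apply: ge0_ler_powR; rewrite ?nnegrE ?(ltW p0)//.
  by rewrite (le_trans (NT _ _))// !NZ !ger0_norm.
move: m0; rewrite le_eqVlt => /predU1P[<-|m0].
  by rewrite powR0 ?gt_eqF// addr_ge0// mulr_ge0// powR_ge0.
have t0 := ler_wpM2l l0 (powR_tangent (N0 z0) m0 p1).
have t1 := ler_wpM2l l1' (powR_tangent (N0 z1) m0 p1).
apply: le_trans (lerD t0 t1); rewrite le_eqVlt; apply/orP; left; apply/eqP.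
by rewrite /m; ring.
Qed.

Lemma powR_addM (R : realType) (a b p : R) : 0 <= a -> 0 <= b -> 0 <= p ->
  (a + b) `^ p <= 2 `^ p * (a `^ p + b `^ p).
Proof.
move=> a0 b0 p0; wlog ab : a b a0 b0 / a <= b => [H|].
  have [/H|/ltW ba] := leP a b; first exact.
  by rewrite addrC [X in _ * X]addrC; exact: H.
apply: (@le_trans _ _ ((2 * b) `^ p)).
  by apply: ge0_ler_powR; rewrite ?nnegrE ?addr_ge0 ?mulr_ge0//; lra.
by rewrite powRM// ler_wpM2l ?powR_ge0// lerDr powR_ge0.
Qed.

(** * The maximal inequality *)
Section maximal_inequality.
Context (R : realType) (d n : nat) (dT : measure_display)
  (T : measurableType dT) (P : probability T R).
Variables (X : 'I_n -> {RV P >-> d.-tuple R}) (eps : 'I_n -> {RV P >-> R}).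
Variable kap : 'I_n -> R.-pker (n.-tuple (d.-tuple R)) ~> R.
Hypothesis indep : independent_given_design X eps kap.
Variables (p sigma : R).
Hypothesis p_ge2 : 2 <= p.
Hypothesis moments : {ae P, forall w, forall i : 'I_n,
      (\int[kap i (design X w)]_e e%:E = 0)%E /\
      (\int[kap i (design X w)]_e (`|e| `^ p)%:E <= (sigma `^ p)%:E)%E}.
Variables (m : nat) (lev : 'I_m -> n.-tuple (d.-tuple R) -> 'I_n -> R).
Hypothesis mlev : forall j i, measurable_fun setT (fun D => lev j D i).
Variables (A : set (n.-tuple (d.-tuple R))) (So : {set 'I_n}).
Hypothesis mA : measurable A.

Let ts D : seq ('I_n -> R) := [seq lev j D | j <- enum 'I_m].
Let Phi r D (z : 'I_n -> R) : R :=
  \1_A D * level_norm (ts D) (flip r (keep So z)) `^ p.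
Let noise w : 'I_n -> R := fun i => eps i w.

Let p_gt0 : 0 < p. Proof. by rewrite (lt_le_trans _ p_ge2). Qed.
Let p_ge1 : 1 <= p. Proof. by rewrite (le_trans _ p_ge2)// ler1n. Qed.

Let Phi_ge0 r D z : 0 <= Phi r D z.
Proof. by rewrite mulr_ge0// powR_ge0. Qed.

Let measurable_Phi d' (S : measurableType d') r
    (D : S -> n.-tuple (d.-tuple R)) (z : S -> 'I_n -> R) :
  measurable_fun setT D -> (forall i, measurable_fun setT (z ^~ i)) ->
  measurable_fun setT (fun s => Phi r (D s) (z s)).
Proof.
move=> mD mz; apply: measurable_funM.
  exact: (measurableT_comp (measurable_indic mA) mD).
apply: (measurableT_comp (measurable_powR p)).
apply: (measurable_level_norm _ (lev := fun j s => lev j (D s))) => [j i|i].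
  exact: (measurableT_comp (mlev j i) mD).
rewrite /flip /keep; apply: measurable_funM => //.
by case: (i \in So).
Qed.

Let meps i : measurable_fun setT (eps i). Proof. exact: measurable_funPT. Qed.

(* Replacing one noise variable by 0 does not increase the mean, by convexity
   and centering. *)
Let zero_one r (U : {set 'I_n}) i :
  (\int[P]_w (Phi r (design X w) (keep (finset.setD U (finset.set1 i)) (noise w)))%:E <=
   \int[P]_w (Phi r (design X w) (keep U (noise w)))%:E)%E.
Proof.
pose h (s : n.-tuple (d.-tuple R) * n.-tuple R) (x : R) : R :=
  Phi r s.1 (keep U (fun j => if j == i then x else tnth s.2 j)).
have h1 w : h (zeroed X eps i w) (eps i w) = Phi r (design X w) (keep U (noise w)).
  rewrite /h /=; congr (Phi r _ (keep U _)); apply/funext => j.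
  by rewrite /noise tnth_mktuple; case: eqP => // ->.
have h0 w : h (zeroed X eps i w) 0 =
    Phi r (design X w) (keep (finset.setD U (finset.set1 i)) (noise w)).
  rewrite /h /=; congr (Phi r _ _); apply/funext => j.
  rewrite /keep /noise !inE tnth_mktuple.
  by case: eqP => //= _; case: ifP.
under eq_integral do rewrite -h0.
under [leRHS]eq_integral do rewrite -h1.
apply: conditional_jensen.
- exact: measurable_zeroed.
- exact: meps.
- exact: (noise_integrable indep p_ge2 moments).
- by move=> C mC; exact: (noise_centered indep p_ge2 moments).
- by move=> s x; exact: Phi_ge0.
- move=> x; apply: measurable_Phi; first exact: measurable_fst.
  move=> j; rewrite /keep; case: (j \in U) => //.
  case: (j == i) => //.
  exact: (measurableT_comp (measurable_tnth j) measurable_snd).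
- under eq_fun do rewrite h1.
  apply: measurable_Phi; first exact: measurable_design.
  by move=> j; rewrite /keep /noise; case: (j \in U).
- move=> s x y l l01; rewrite /h /Phi.
  have [N0 NT NZ] := level_norm_seminorm (ts s.1).
  set z := fun x => flip r (keep So (keep U (fun j => if j == i then x else tnth s.2 j))).
  have -> : flip r (keep So (keep U (fun j => if j == i then l * x + (1 - l) * y
      else tnth s.2 j))) = (fun j => l * z x j + (1 - l) * z y j).
    apply/funext => j; rewrite /z /flip /keep.
    by case: (j \in So); case: (j \in U); case: (j == i); ring.
  have := @seminorm_powR_convex _ _ _ p (z x) (z y) l (level_norm_seminorm (ts s.1)) p_ge1 l01.
  have iA : 0 <= \1_A s.1 :> R by [].
  move=> /(ler_wpM2l iA) H; apply: (le_trans H).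
  by rewrite -/(z x) -/(z y) le_eqVlt; apply/orP; left; apply/eqP; ring.
Qed.

Let zero_out r (U : {set 'I_n}) :
  (\int[P]_w (Phi r (design X w) (keep U (noise w)))%:E <=
   \int[P]_w (Phi r (design X w) (noise w))%:E)%E.
Proof.
have H (s : seq 'I_n) :
    (\int[P]_w (Phi r (design X w) (keep [set i | i \notin s]%SET (noise w)))%:E <=
     \int[P]_w (Phi r (design X w) (noise w))%:E)%E.
  elim: s => [|i s IH].
    rewrite (_ : (fun w => _) = (fun w => (Phi r (design X w) (noise w))%:E))//.
    apply/funext => w; congr (Phi r _ _)%:E.
    by apply/funext => i; rewrite /keep inE.
  apply: le_trans IH; rewrite (_ : [set j | _]%SET =
      finset.setD [set j | j \notin s]%SET (finset.set1 i)); first exact: zero_one.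
  by apply/setP => j; rewrite !inE negb_or.
have := H (enum (finset.setC U)); rewrite (_ : [set i | _]%SET = U)//.
by apply/setP => i; rewrite inE mem_enum inE negbK.
Qed.

(** For a fixed pattern [r] of signs the noise is the difference of two signed
    versions of itself in which the variables of one sign are replaced by 0, and
    each of these has at most the moment of the whole signed noise. *)
Let symmetrization r :
  (\int[P]_w (\1_A (design X w) *
      level_norm (ts (design X w)) (keep So (noise w)) `^ p)%:E <=
   (2 * 2 `^ p)%:E * \int[P]_w (Phi r (design X w) (noise w))%:E)%E.
Proof.
pose I := [set i | ~~ r i]%SET.
have mPhi U : measurable_fun setT (fun w => (Phi r (design X w) (keep U (noise w)))%:E).
  apply/measurable_EFinP/measurable_Phi; first exact: measurable_design.
  by move=> i; rewrite /keep /noise; case: (i \in U).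
have mPhi' : measurable_fun setT (fun w => (Phi r (design X w) (noise w))%:E).
  by apply/measurable_EFinP/measurable_Phi => //; exact: measurable_design.
apply: (@le_trans _ _ ((2 `^ p)%:E *
  (\int[P]_w (Phi r (design X w) (keep I (noise w)))%:E +
   \int[P]_w (Phi r (design X w) (keep (finset.setC I) (noise w)))%:E))%E); last first.
  rewrite [in leRHS]mulrC EFinM -muleA lee_wpmul2l ?lee_fin ?powR_ge0//.
  by rewrite mule_natl mule2n leeD ?zero_out.
rewrite -ge0_integralD//; last 2 first.
- by move=> w _; rewrite lee_fin.
- by move=> w _; rewrite lee_fin.
rewrite -ge0_integralZl; [|by []|exact: emeasurable_funD|
  by move=> w _; rewrite adde_ge0 ?lee_fin|by rewrite lee_fin powR_ge0].
apply: ge0_le_integral => //.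
- by move=> w _; rewrite lee_fin mulr_ge0 ?powR_ge0.
- apply/measurable_EFinP/measurable_funM.
    exact: (measurableT_comp (measurable_indic mA) (measurable_design X)).
  apply: (measurableT_comp (measurable_powR p)).
  apply: (measurable_level_norm _ (lev := fun j w => lev j (design X w))) => [j i|i].
    exact: (measurableT_comp (mlev j i) (measurable_design X)).
  by rewrite /keep /noise; case: (i \in So).
- by apply: measurable_funeM; exact: emeasurable_funD.
move=> w _; rewrite -EFinD -EFinM lee_fin /Phi -mulrDr mulrCA ler_wpM2l//.
have [N0 NT NZ] := level_norm_seminorm (ts (design X w)).
set x := keep So (noise w).
apply: le_trans (powR_addM (N0 _) (N0 _) (ltW p_gt0)).
apply: ge0_ler_powR; rewrite ?nnegrE ?addr_ge0 ?(ltW p_gt0)//.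
set x1 := flip r _; set x2 := flip r _.
have -> : x = (fun i => x1 i + (-1) * x2 i).
  apply/funext => i; rewrite /x /x1 /x2 /flip /keep !inE.
  by case: (i \in So); case: (r i); rewrite /= ?expr0 ?expr1; ring.
by apply: (le_trans (NT _ _)); rewrite NZ normrN1 mul1r.
Qed.

Definition maximal_const : R := 2 * 2 `^ p * ((2 ^ m)%:R * sign_const p).

(** The maximal sum over the sets of indices cut out by thresholds on [m] levels
    has the moments of a single sum, up to a factor 2^m from the Levy
    inequality. *)
Lemma maximal_inequality :
  (\int[P]_(w in design X @^-1` A)
     (level_norm (ts (design X w)) (keep So (noise w)) `^ p)%:E <=
   (maximal_const * #|So|%:R `^ (p / 2) * sigma `^ p)%:E *
   P (design X @^-1` A))%E.
Proof.
set I0 := (\int[P]_(w in _) _)%E.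
have mPhi r : measurable_fun setT (fun w => (Phi r (design X w) (noise w))%:E).
  by apply/measurable_EFinP/measurable_Phi => //; exact: measurable_design.
have mDA : measurable (design X @^-1` A).
  by rewrite -[X in measurable X]setTI; exact: measurable_design.
have sc0 : 0 <= sign_const p by rewrite !mulr_ge0 ?powR_ge0 ?expR_ge0.
have I0E : I0 = (\int[P]_w (\1_A (design X w) *
      level_norm (ts (design X w)) (keep So (noise w)) `^ p)%:E)%E.
  rewrite /I0 integral_mkcond; apply: eq_integral => w _.
  rewrite patchE indicE (_ : (w \in _) = (design X w \in A)).
    by case: ifP => _; rewrite ?mul1r ?mul0r.
  by apply/idP/idP; rewrite !inE.
have c2 : 0 <= 2 * 2 `^ p :> R by rewrite mulr_ge0 ?powR_ge0.
have H1 : ((2 ^ n)%:R%:E * I0 <= (2 * 2 `^ p)%:E *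
    \int[P]_w (\sum_r Phi r (design X w) (noise w))%:E)%E.
  under [in leRHS]eq_integral do rewrite -sumEFin.
  rewrite ge0_integral_sum//; last by move=> r w _; rewrite lee_fin.
  rewrite ge0_sume_distrr; last first.
    by move=> r _; apply: integral_ge0 => w _; rewrite lee_fin.
  apply: (@le_trans _ _ (\sum_(r : {ffun 'I_n -> bool}) I0)%E); last first.
    by apply: lee_sum => r _; rewrite I0E; exact: symmetrization.
  rewrite big_const card_ffun card_bool card_ord -/(_ ^ n)%N.
  rewrite mule_natl; elim: (2 ^ n)%N => [|k IH]; first by rewrite mule0n.
  by rewrite iterS muleS leeD2l.
pose c := (2 ^ m)%:R * sign_const p * #|So|%:R `^ (p / 2 - 1).
have c0 : 0 <= c by rewrite !mulr_ge0 ?powR_ge0.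
have mom i : (\int[P]_(w in design X @^-1` A) (`|eps i w| `^ p)%:E <=
   (sigma `^ p)%:E * P (design X @^-1` A))%E.
  exact: (noise_moment indep moments).
have meP i : measurable_fun setT (fun w => (`|eps i w| `^ p)%:E).
  exact/measurable_EFinP/measurable_normr_powR.
have H2 : (\int[P]_w (\sum_r Phi r (design X w) (noise w))%:E <=
    ((2 ^ n)%:R * c)%:E *
    \sum_(i in So) \int[P]_(w in design X @^-1` A) (`|eps i w| `^ p)%:E)%E.
  rewrite -[X in (_ * X)%E]big_enum/= -ge0_integral_sum//;
    last by move=> i; exact: measurable_funTS.
  have mS : measurable_fun setT (fun w => (\sum_(i in So) `|eps i w| `^ p)%:E).
    apply/measurable_EFinP; under eq_fun do rewrite -big_enum.
    apply: measurable_sum => i; exact: measurable_normr_powR.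
  rewrite integral_mkcond.
  set F := (_ \_ _)%E.
  have mF : measurable_fun setT F.
    apply/(measurable_restrictT _ _).1 => //.
    by apply: emeasurable_sum => i; exact: measurable_funTS.
  have F0 w : setT w -> (0 <= F w)%E.
    move=> _; apply: erestrict_ge0 => // w' _; apply: sume_ge0 => i _.
    by rewrite lee_fin powR_ge0.
  rewrite -ge0_integralZl; [|by []|exact: mF|exact: F0|by rewrite lee_fin mulr_ge0].
  apply: ge0_le_integral => //.
  - by move=> w _; rewrite lee_fin sumr_ge0.
  - apply/measurable_EFinP; apply: measurable_sum => r.
    by have /measurable_EFinP := mPhi r.
  - exact: measurable_funeM.
  move=> w _; rewrite /F patchE.
  have -> : (w \in design X @^-1` A) = (design X w \in A).
    by apply/idP/idP; rewrite !inE.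
  rewrite /Phi -mulr_sumr indicE; case: ifP => wA; last by rewrite mul0r mule0.
  rewrite mul1r sumEFin -EFinM lee_fin big_enum/=.
  apply: (le_trans (level_norm_average _ _ _ p_ge2)).
  by rewrite /ts size_map size_enum_ord /c mulrA.
have H3 : ((2 ^ n)%:R%:E * I0 <= (2 ^ n)%:R%:E *
    ((maximal_const * #|So|%:R `^ (p / 2) * sigma `^ p)%:E * P (design X @^-1` A)))%E.
  apply: (le_trans H1).
  apply: (le_trans (lee_wpmul2l _ H2)); first by rewrite lee_fin.
  have H4 : (\sum_(i in So) \int[P]_(w in design X @^-1` A) (`|eps i w| `^ p)%:E <=
      #|So|%:R%:E * ((sigma `^ p)%:E * P (design X @^-1` A)))%E.
    apply: (le_trans (lee_sum _ (fun i _ => mom i))).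
    rewrite big_const mule_natl; elim: #|So| => [|k IH]; first by rewrite mule0n.
    by rewrite iterS muleS leeD2l.
  rewrite muleA -EFinM.
  apply: (le_trans (lee_wpmul2l _ H4)); first by rewrite lee_fin (mulr_ge0 c2)// mulr_ge0.
  rewrite !muleA -!EFinM le_eqVlt; apply/orP; left; apply/eqP; congr (_%:E * _)%E.
  have -> : #|So|%:R `^ (p / 2) = #|So|%:R * #|So|%:R `^ (p / 2 - 1) :> R.
    by rewrite mulr_powRB1// divr_gt0.
  by rewrite /c /maximal_const; ring.
by rewrite lee_pmul2l// ?fin_numE// ?lte_fin ?ltr0n ?expn_gt0 in H3.
Qed.

End maximal_inequality.

(** Interpolation from the exponent [p] down to [q] with a free threshold [t];
    it serves when [q < 2], where only the second moment is under control. *)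
Lemma powR_split (R : realType) (y t p q : R) : 0 <= y -> 0 < t -> 0 < q -> q <= p ->
  y `^ q <= t `^ (q - p) * y `^ p + t `^ q.
Proof.
move=> y0 t0 q0 qp; have [yt|ty] := leP y t.
  have : y `^ q <= t `^ q by apply: ge0_ler_powR; rewrite ?nnegrE ?(ltW q0) ?(ltW t0).
  have : 0 <= t `^ (q - p) * y `^ p by rewrite mulr_ge0 ?powR_ge0.
  lra.
have yp : 0 < y by exact: lt_trans ty.
have -> : y `^ q = y `^ (q - p) * y `^ p.
  by rewrite -powRD ?subrK//; apply/implyP => _; rewrite gt_eqF.
have H : y `^ (q - p) <= t `^ (q - p).
  rewrite -opprB !powRN lef_pV2 ?posrE ?powR_gt0//.
  by apply: ge0_ler_powR; rewrite ?nnegrE ?(ltW yp) ?(ltW t0) ?subr_ge0// ltW.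
have := ler_wpM2r (powR_ge0 y p) H; have := powR_ge0 t q; lra.
Qed.

(** * Moments of the number of design points *)
Section binomial.
Local Close Scope classical_set_scope.
Context (R : realType) (n : nat) (b : R).
Hypotheses (b0 : 0 <= b) (b1 : b <= 1).
Implicit Types S : {set 'I_n}.

(** The probability that [S] is the set of successes of [n] independent trials. *)
Definition trials_pr S : R := \prod_(i < n) (if i \in S then b else 1 - b).

Lemma trials_pr_ge0 S : 0 <= trials_pr S.
Proof. by apply: prodr_ge0 => i _; case: ifP; rewrite ?subr_ge0. Qed.

Lemma trials_mgf l :
  \sum_(S : {set 'I_n}) expR (l * #|S|%:R) * trials_pr S = (1 + b * (expR l - 1)) ^+ n.
Proof.
have -> : (1 + b * (expR l - 1)) ^+ n =
    \prod_(i < n) \sum_(c : bool) (if c then expR l * b else 1 - b).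
  by rewrite prodr_const card_ord big_bool/=; congr (_ ^+ _); ring.
rewrite bigA_distr_bigA /=.
pose h (S : {set 'I_n}) : {ffun 'I_n -> bool} := [ffun i => i \in S].
pose g (f : {ffun 'I_n -> bool}) : {set 'I_n} := [set i | f i].
rewrite (reindex h) /=; last first.
  apply: onW_bij; exists g => [S|f]; first by apply/setP => i; rewrite inE ffunE.
  by apply/ffunP => i; rewrite ffunE inE.
apply: eq_bigr => S _.
have -> : expR (l * #|S|%:R) = \prod_(i < n) (if i \in S then expR l else 1).
  rewrite -big_mkcond/= prodr_const mulrC expRM_natl//.
rewrite -big_split/=; apply: eq_bigr => i _.
by rewrite ffunE; case: ifP; rewrite ?mul1r.
Qed.

Lemma trials_pr_sum : \sum_(S : {set 'I_n}) trials_pr S = 1.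
Proof.
have := trials_mgf 0; rewrite expR0 subrr mulr0 addr0 expr1n => <-.
by apply: eq_bigr => S _; rewrite mul0r expR0 mul1r.
Qed.

Lemma trials_mgf_le l : \sum_(S : {set 'I_n}) expR (l * #|S|%:R) * trials_pr S <=
  expR (n%:R * b * (expR l - 1)).
Proof.
rewrite trials_mgf -mulrA expRM_natl lerXn2r ?nnegrE ?expR_ge0//.
- rewrite (_ : 1 + _ = (1 - b) + b * expR l); last by ring.
  by rewrite addr_ge0 ?subr_ge0 ?mulr_ge0 ?expR_ge0.
- exact: expR_ge1Dx.
Qed.

(** Powers are dominated by exponentials of rate 1 / (2 M). *)
Lemma trials_moment s M : 0 < s -> 1 <= M -> n%:R * b <= M ->
  \sum_(S : {set 'I_n}) #|S|%:R `^ s * trials_pr S <= s `^ s * 2 `^ s * expR 1 * M `^ s.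
Proof.
move=> s0 M1 nbM; have M0 : 0 < M by rewrite (lt_le_trans _ M1).
pose l := (2 * M)^-1; have l0 : 0 < l by rewrite invr_gt0 mulr_gt0.
have step S : #|S|%:R `^ s <= s `^ s * 2 `^ s * M `^ s * expR (l * #|S|%:R).
  have lS : 0 <= l * #|S|%:R by rewrite mulr_ge0// ltW.
  have -> : #|S|%:R `^ s = 2 `^ s * M `^ s * (l * #|S|%:R) `^ s.
    rewrite -(powRM _ (ler0n _ 2) (ltW M0)) -(powRM _ (mulr_ge0 (ler0n _ 2) (ltW M0)) lS).
    congr (_ `^ _).
    by rewrite mulrA mulfV ?mul1r// gt_eqF// mulr_gt0.
  have := ler_wpM2l (mulr_ge0 (powR_ge0 2 s) (powR_ge0 M s)) (powR_le_expR s0 lS).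
  move=> H; apply: (le_trans H).
  by rewrite le_eqVlt; apply/orP; left; apply/eqP; ring.
apply: (@le_trans _ _ (s `^ s * 2 `^ s * M `^ s *
    \sum_(S : {set 'I_n}) expR (l * #|S|%:R) * trials_pr S)).
  rewrite mulr_sumr; apply: ler_sum => S _; rewrite mulrA.
  by apply: ler_wpM2r => //; exact: trials_pr_ge0.
rewrite [leRHS](_ : _ = s `^ s * 2 `^ s * M `^ s * expR 1); last by ring.
apply: ler_wpM2l; first by rewrite !mulr_ge0 ?powR_ge0.
apply: (le_trans (trials_mgf_le _)); rewrite ler_expR.
have l12 : l <= 2^-1 by rewrite lef_pV2 ?posrE ?mulr_gt0// ler_peMr.
have el : expR l - 1 <= M^-1.
  have h : expR l <= (1 - l)^-1.
    rewrite -[leLHS]invrK lef_pV2 ?posrE ?invr_gt0 ?expR_gt0//; last lra.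
    by rewrite -expRN expR_ge1Dx.
  have h2 : (1 - l)^-1 <= 1 + 2 * l by rewrite invf_ple ?posrE; [|lra|lra]; rewrite -[leLHS]mul1r ler_pdivrMr; [nra|lra].
  have -> : M^-1 = 2 * l by rewrite /l invfM mulrA mulfV ?mul1r.
  lra.
apply: (@le_trans _ _ (n%:R * b * M^-1)).
  by apply: ler_wpM2l => //; exact: mulr_ge0.
by rewrite ler_pdivrMr// mul1r.
Qed.

Definition inv_moment_const (c s : R) : R := 1 + (1 + s `^ s) * (c / 4) `^ (- s).

(** Either the number of successes is at least the fraction [y] of its mean, or
    the exponential Markov inequality makes the event rare. *)
Lemma trials_inv_moment s c N : 0 < s -> 0 < c -> 0 <= N -> c * N <= n%:R * b ->
  \sum_(S : {set 'I_n}) (Num.max 1 #|S|%:R) `^ (- s) * trials_pr S <=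
  inv_moment_const c s * (Num.max 1 N) `^ (- s).
Proof.
move=> s0 c0 N0 cN.
have K0 : 0 <= (1 + s `^ s) * (c / 4) `^ (- s).
  by rewrite mulr_ge0 ?addr_ge0 ?powR_ge0.
have le1 S : (Num.max 1 #|S|%:R) `^ (- s) <= 1 :> R.
  rewrite powRN invf_le1 ?powR_gt0 ?lt_max ?ltr01//.
  have m1 : 1 <= Num.max 1 #|S|%:R :> R by rewrite le_max lexx.
  by have := ler_powR m1 (ltW s0); rewrite powRr0.
have [N1|N1] := leP N 1.
  rewrite /inv_moment_const powR1 mulr1.
  apply: (@le_trans _ _ (\sum_(S : {set 'I_n}) trials_pr S)); last by rewrite trials_pr_sum lerDl.
  by apply: ler_sum => S _; rewrite ler_piMl// trials_pr_ge0.
pose y := c * N / 4; have y0 : 0 < y by rewrite !mulr_gt0// (lt_trans _ N1).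
have step S : (Num.max 1 #|S|%:R) `^ (- s) <= y `^ (- s) + expR y * expR (-1 * #|S|%:R).
  have [yk|ky] := leP y #|S|%:R.
    rewrite (@le_trans _ _ (y `^ (- s)))//; last by rewrite lerDl mulr_ge0 ?expR_ge0.
    rewrite !powRN lef_pV2 ?posrE ?powR_gt0 ?lt_max ?ltr01//.
    apply: ge0_ler_powR.
    - exact: ltW.
    - by rewrite nnegrE ltW.
    - by rewrite nnegrE le_max ler01.
    - by rewrite le_max yk orbT.
  rewrite (le_trans (le1 S))// -expRD.
  have : 0 <= y `^ (- s) by exact: powR_ge0.
  have : 1 + (y + -1 * #|S|%:R) <= expR (y + -1 * #|S|%:R) by exact: expR_ge1Dx.
  lra.
apply: (@le_trans _ _ (y `^ (- s) + expR y * expR (n%:R * b * (expR (-1) - 1)))).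
  apply: (@le_trans _ _ (\sum_(S : {set 'I_n}) (y `^ (- s) * trials_pr S +
      expR y * (expR (-1 * #|S|%:R) * trials_pr S)))).
    apply: ler_sum => S _; rewrite mulrA -mulrDl.
    by apply: ler_wpM2r; rewrite ?trials_pr_ge0.
  rewrite big_split/= -!mulr_sumr trials_pr_sum mulr1 lerD2l.
  by apply: ler_wpM2l; rewrite ?expR_ge0// trials_mgf_le.
have e2 : expR (-1) - 1 <= - 2^-1 :> R.
  have : expR (-1) <= 2^-1 :> R.
    by rewrite expRN lef_pV2 ?posrE ?expR_gt0// -[leLHS]/(1 + 1) expR_ge1Dx.
  lra.
have e3 : expR y * expR (n%:R * b * (expR (-1) - 1)) <= expR (- y).
  rewrite -expRD ler_expR.
  have : n%:R * b * (expR (-1) - 1) <= n%:R * b * - 2^-1.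
    by apply: ler_wpM2l; rewrite ?mulr_ge0.
  rewrite /y; lra.
have e4 : expR (- y) <= s `^ s * y `^ (- s).
  rewrite expRN powRN -[leRHS]/(s `^ s / y `^ s) ler_pdivlMr ?powR_gt0//.
  by rewrite mulrC ler_pdivrMr ?expR_gt0// powR_le_expR ?(ltW y0).
have yE : y `^ (- s) = (c / 4) `^ (- s) * N `^ (- s).
  by rewrite -powRM ?divr_ge0 ?(ltW c0)//; congr (_ `^ _); rewrite /y; ring.
have := powR_ge0 N (- s); rewrite /inv_moment_const => Ns0.
rewrite yE in e4 *; move: e3 e4; set u := (c / 4) `^ (- s); set v := N `^ (- s); set a := s `^ s.
move=> e3 e4; rewrite -/v in Ns0; lra.
Qed.

End binomial.

Section point_sets.
Context (R : realType) (d n : nat).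

Definition point_set (B : set (d.-tuple R)) (D : n.-tuple (d.-tuple R)) : {set 'I_n} :=
  [set i | tnth D i \in B]%SET.

Lemma measurable_point_set B S : measurable B ->
  measurable [set D | point_set B D = S].
Proof.
move=> mB; have -> : [set D | point_set B D = S] =
    \bigcap_(i in [set: 'I_n]) ((@tnth n (d.-tuple R))^~ i @^-1`
      (if i \in S then B else ~` B)).
  apply/seteqP; split => D /=.
    move=> <- i _ /=; rewrite inE; case: ifPn; first by rewrite inE.
    by move=> /negP; rewrite inE.
  move=> H; apply/setP => i; rewrite inE; have := H i I; rewrite /=.
  by case: ifP => _ Bi; [exact: mem_set|exact: memNset].
apply: fin_bigcap_measurable => // i _.
rewrite -[X in measurable X]setTI; apply: measurable_tnth => //.
by case: ifP => _ //; exact: measurableC.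
Qed.

End point_sets.

(** * Noise averages between two boxes *)
Section noise_over_boxes.
Context (R : realType) (d n : nat) (dT : measure_display)
  (T : measurableType dT) (P : probability T R).
Variables (X : 'I_n -> {RV P >-> d.-tuple R}) (eps : 'I_n -> {RV P >-> R}).
Variable law : probability (d.-tuple R) R.
Hypothesis iid : iid_with_law X law.

Lemma point_set_pr B (S : {set 'I_n}) : measurable B ->
  P (design X @^-1` [set D | point_set B D = S]) =
  (trials_pr (fine (law B)) S)%:E.
Proof.
move=> mB; pose A i := if i \in S then B else ~` B.
have mA i : measurable (A i).
  by rewrite /A; case: ifP => _ //; exact: measurableC.
have -> : design X @^-1` [set D | point_set B D = S] =
    \bigcap_(i in [set: 'I_n]) (X i @^-1` A i).
  apply/seteqP; split => w /=.
    move=> e i _; rewrite /A -e inE tnth_mktuple; case: ifPn => /=; first by rewrite inE.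
    by move=> /negP; rewrite inE.
  move=> H; apply/setP => i; rewrite inE tnth_mktuple; have := H i I; rewrite /A /=.
  by case: ifP => _ Bi; [exact: mem_set|exact: memNset].
rewrite iid.2// /trials_pr (big_morph EFin EFinM erefl); apply: eq_bigr => i _.
have <- : distribution P (X i) (A i) = P (X i @^-1` A i) by [].
have fB : law B \is a fin_num by exact: fin_num_measure.
rewrite iid.1// /A; case: ifP => _; first by rewrite fineK.
by rewrite probability_setC// EFinB fineK.
Qed.

Variables (p q sigma : R).
Hypotheses (q_gt0 : 0 < q) (qp : q <= p) (p_ge2 : 2 <= p) (sigma_gt0 : 0 < sigma).
Variable kap : 'I_n -> R.-pker (n.-tuple (d.-tuple R)) ~> R.
Hypothesis indep : independent_given_design X eps kap.
Hypothesis moments : {ae P, forall w, forall i : 'I_n,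
      (\int[kap i (design X w)]_e e%:E = 0)%E /\
      (\int[kap i (design X w)]_e (`|e| `^ p)%:E <= (sigma `^ p)%:E)%E}.
Variables (m : nat) (lev : 'I_m -> n.-tuple (d.-tuple R) -> 'I_n -> R).
Hypothesis mlev : forall j i, measurable_fun setT (fun D => lev j D i).

Let ts D : seq ('I_n -> R) := [seq lev j D | j <- enum 'I_m].
Let noise w : 'I_n -> R := fun i => eps i w.

Let mnorm So : measurable_fun setT
  (fun w => level_norm (ts (design X w)) (keep So (noise w))).
Proof.
apply: (measurable_level_norm _ (lev := fun j w => lev j (design X w))) => [j i|i].
  exact: (measurableT_comp (mlev j i) (measurable_design X)).
by rewrite /keep /noise; case: (i \in So) => //; exact: measurable_funPT.
Qed.

Let norm_ge0 D z : 0 <= level_norm (ts D) z.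
Proof. by have [N0 _ _] := level_norm_seminorm (ts D). Qed.

Let p_gt0 : 0 < p. Proof. exact: lt_le_trans p_ge2. Qed.

Lemma maximal_inequality_q A (So : {set 'I_n}) : measurable A ->
  (\int[P]_(w in design X @^-1` A)
     (level_norm (ts (design X w)) (keep So (noise w)) `^ q)%:E <=
   ((maximal_const p m + 1) * #|So|%:R `^ (q / 2) * sigma `^ q)%:E *
   P (design X @^-1` A))%E.
Proof.
move=> mA; have mDA : measurable (design X @^-1` A).
  by rewrite -[X in measurable X]setTI; exact: measurable_design.
have C0 : 0 <= maximal_const p m.
  by rewrite !mulr_ge0 ?powR_ge0 ?expR_ge0.
have rhs0 : (0 <= ((maximal_const p m + 1) * #|So|%:R `^ (q / 2) * sigma `^ q)%:E *
   P (design X @^-1` A))%E.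
  by rewrite mule_ge0// lee_fin !mulr_ge0 ?powR_ge0 ?addr_ge0.
have [So0|] := eqVneq #|So| 0%N.
  rewrite (le_trans _ rhs0)// integral0_eq// => w _.
  have -> : keep So (noise w) = (fun i => 0 * (fun=> 0) i).
    apply/funext => i; rewrite /keep mulr0; case: ifP => // iS.
    by have := card0_eq So0 i; rewrite inE iS.
  have [_ _ NZ] := level_norm_seminorm (ts (design X w)).
  by rewrite NZ normr0 mul0r powR0 ?gt_eqF.
rewrite -lt0n => So_gt0; set k : R := #|So|%:R.
have k0 : 0 < k by rewrite ltr0n.
pose t := k `^ (2^-1) * sigma; have t0 : 0 < t by rewrite mulr_gt0 ?powR_gt0.
have tE s : t `^ s = k `^ (s / 2) * sigma `^ s.
  by rewrite powRM ?powR_ge0 ?ltW// -powRrM [2^-1 * _]mulrC.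
apply: (@le_trans _ _ (\int[P]_(w in design X @^-1` A)
   ((t `^ (q - p))%:E * (level_norm (ts (design X w)) (keep So (noise w)) `^ p)%:E
     + (t `^ q)%:E))%E).
  apply: ge0_le_integral => //.
  - by move=> w _; rewrite lee_fin powR_ge0.
  - apply/measurable_EFinP/measurable_funTS.
    exact: (measurableT_comp (measurable_powR q) (mnorm So)).
  - apply: emeasurable_funD => //; apply: measurable_funeM.
    apply/measurable_EFinP/measurable_funTS.
    exact: (measurableT_comp (measurable_powR p) (mnorm So)).
  - by move=> w _; rewrite -EFinM -EFinD lee_fin; exact: powR_split.
have mp : measurable_fun (design X @^-1` A) (fun w =>
    (level_norm (ts (design X w)) (keep So (noise w)) `^ p)%:E).
  apply/measurable_EFinP/measurable_funTS.
  exact: (measurableT_comp (measurable_powR p) (mnorm So)).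
rewrite ge0_integralD; [|exact: mDA|
  by move=> w _; rewrite -EFinM lee_fin mulr_ge0 ?powR_ge0|
  exact: measurable_funeM|by move=> w _; rewrite lee_fin powR_ge0|
  exact: measurable_cst].
rewrite integral_cst// ge0_integralZl; [|exact: mDA|exact: mp|
  by move=> w _; rewrite lee_fin powR_ge0|by rewrite lee_fin powR_ge0].
have H := maximal_inequality indep p_ge2 moments mlev So mA.
have H2 := lee_wpmul2l (_ : 0 <= (t `^ (q - p))%:E)%E H.
apply: (le_trans (leeD2r _ (H2 _))); first by rewrite lee_fin powR_ge0.
rewrite muleA -EFinM -ge0_muleDl ?lee_fin ?mulr_ge0 ?powR_ge0//.
rewrite le_eqVlt; apply/orP; left; apply/eqP; congr (_ * _)%E.
rewrite -EFinD; congr EFin.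
have -> : maximal_const p m * #|So|%:R `^ (p / 2) * sigma `^ p =
  maximal_const p m * t `^ p by rewrite tE mulrA.
have -> : (maximal_const p m + 1) * k `^ (q / 2) * sigma `^ q =
  (maximal_const p m + 1) * t `^ q by rewrite tE mulrA.
have -> : t `^ q = t `^ (q - p) * t `^ p.
  by rewrite -powRD ?subrK//; apply/implyP => _; rewrite gt_eqF.
ring.
Qed.

Variables (B B' : set (d.-tuple R)) (c1 c2 N : R).
Hypotheses (mB : measurable B) (mB' : measurable B').
Hypotheses (c1_gt0 : 0 < c1) (c2_ge1 : 1 <= c2) (N_ge0 : 0 <= N).
Hypothesis lawB : c1 * N <= n%:R * fine (law B).
Hypothesis lawB' : n%:R * fine (law B') <= c2 * Num.max 1 N.

(** The q-th power of a quotient: the maximal noise sum over the subsets of the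
    larger box [B'] cut out by thresholds, by the number of points in the smaller
    box [B]. It dominates the q-th powers of the noise averages over all boxes
    in between. *)
Definition shell_noise w : R :=
  level_norm (ts (design X w)) (keep (point_set B' (design X w)) (noise w)) `^ q *
  Num.max 1 #|point_set B (design X w)|%:R `^ (- q).

Definition shell_const : R := (maximal_const p m + 1) *
  (q `^ q * 2 `^ q * expR 1 * c2 `^ q + inv_moment_const c1 (2 * q)).

Let event (S : {set 'I_n} * {set 'I_n}) : set (n.-tuple (d.-tuple R)) :=
  [set D | point_set B' D = S.1] `&` [set D | point_set B D = S.2].

Let mevent S : measurable (event S).
Proof. by apply: measurableI; exact: measurable_point_set. Qed.

Let mdesign A : measurable A -> measurable (design X @^-1` A).
Proof. by move=> mA; rewrite -[X in measurable X]setTI; exact: measurable_design. Qed.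

Let summand (S : {set 'I_n} * {set 'I_n}) w : R :=
  \1_(design X @^-1` event S) w *
  (level_norm (ts (design X w)) (keep S.1 (noise w)) `^ q *
   Num.max 1 #|S.2|%:R `^ (- q)).

Let shell_noiseE w : shell_noise w = \sum_S summand S w.
Proof.
pose S0 := (point_set B' (design X w), point_set B (design X w)).
rewrite (bigD1 S0)//= big1 ?addr0; last first.
  move=> S SS0; rewrite /summand indicE memNset ?mul0r// => -[/= e1 e2].
  by move: SS0; rewrite /S0 e1 e2 -surjective_pairing eqxx.
by rewrite /summand indicE mem_set ?mul1r//; split.
Qed.

Let msummand S : measurable_fun setT (summand S).
Proof.
apply: measurable_funM; first exact/measurable_indic/mdesign.
apply: measurable_funM => //.
exact: (measurableT_comp (measurable_powR q) (mnorm S.1)).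
Qed.

Lemma measurable_shell_noise : measurable_fun setT shell_noise.
Proof.
rewrite (_ : shell_noise = fun w => \sum_S summand S w); last first.
  by apply/funext => w; exact: shell_noiseE.
exact: measurable_sum.
Qed.

Lemma shell_noise_ge0 w : 0 <= shell_noise w.
Proof. by rewrite mulr_ge0 ?powR_ge0. Qed.

Let summand_ge0 S w : 0 <= summand S w.
Proof. by rewrite mulr_ge0// mulr_ge0 ?powR_ge0. Qed.

Let N1 := Num.max 1 N.
Let N1_gt0 : 0 < N1. Proof. by rewrite lt_max ltr01. Qed.
Let C0 : 0 <= maximal_const p m + 1.
Proof. by rewrite addr_ge0// !mulr_ge0 ?powR_ge0 ?expR_ge0. Qed.

(** Splitting the product by the arithmetic-geometric mean inequality decouples
    the number of points in the outer box from that in the inner box. *)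
Let decouple (S : {set 'I_n} * {set 'I_n}) :
  #|S.1|%:R `^ (q / 2) * Num.max 1 #|S.2|%:R `^ (- q) <=
  #|S.1|%:R `^ q * N1 `^ (- (3 * q / 2)) +
  Num.max 1 #|S.2|%:R `^ (- (2 * q)) * N1 `^ (3 * q / 2) :> R.
Proof.
set a : R := #|S.1|%:R; set b : R := Num.max 1 _.
have b0 : 0 < b by rewrite lt_max ltr01.
have a0 : 0 <= a by [].
pose u := a `^ (q / 2) * N1 `^ (- (3 * q / 4)).
pose v := b `^ (- q) * N1 `^ (3 * q / 4).
have sqr (x s : R) : (x `^ s) * (x `^ s) = x `^ (2 * s).
  by rewrite -expr2 -powR_mulrn ?powR_ge0// -powRrM mulrC.
have -> : a `^ q * N1 `^ (- (3 * q / 2)) = u * u.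
  by rewrite /u mulrACA !sqr; congr (_ `^ _ * _ `^ _); field.
have -> : b `^ (- (2 * q)) * N1 `^ (3 * q / 2) = v * v.
  by rewrite /v mulrACA !sqr; congr (_ `^ _ * _ `^ _); field.
have -> : a `^ (q / 2) * b `^ (- q) = u * v.
  rewrite /u /v mulrACA -(powRD (x := N1)) ?addNr ?powRr0 ?mulr1//.
  by apply/implyP => _; rewrite gt_eqF.
have : 0 <= u by rewrite mulr_ge0 ?powR_ge0.
have : 0 <= v by rewrite mulr_ge0 ?powR_ge0.
nra.
Qed.

Let pr (S : {set 'I_n} * {set 'I_n}) : R := fine (P (design X @^-1` event S)).
Let prE S : P (design X @^-1` event S) = (pr S)%:E.
Proof. by rewrite fineK// fin_num_measure//; exact: mdesign. Qed.

Let pr_ge0 S : 0 <= pr S. Proof. exact: fine_ge0. Qed.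

Let marginal (f : {set 'I_n} -> {set 'I_n} * {set 'I_n}) A :
  measurable A ->
  design X @^-1` A = \bigcup_(S in [set: {set 'I_n}]) (design X @^-1` event (f S)) ->
  trivIset setT (fun S => design X @^-1` event (f S)) ->
  (\sum_S pr (f S))%:E = P (design X @^-1` A).
Proof.
move=> mA AE tE; rewrite AE.
rewrite measure_fin_bigcup; [|exact: finite_finset|exact: tE|
  by move=> S _; exact: mdesign].
rewrite -sumEFin fsbig_seq ?index_enum_uniq//.
rewrite (_ : [set` index_enum _] = setT); last first.
  by apply/seteqP; split => // S _ /=; rewrite mem_index_enum.
by apply: eq_fsbigr => S _; exact/esym/prE.
Qed.

Let pr1 (phi : {set 'I_n} -> R) :
  \sum_S phi S.1 * pr S = \sum_S phi S * trials_pr (fine (law B')) S.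
Proof.
rewrite -(pair_bigA _ (fun S1 S2 => phi S1 * pr (S1, S2)))/=.
apply: eq_bigr => S1 _; rewrite -mulr_sumr; congr (_ * _).
apply: EFin_inj; rewrite -point_set_pr//; apply: marginal.
- exact: measurable_point_set.
- apply/seteqP; split => w /=; first by exists (point_set B (design X w)).
  by move=> [S _ []].
- apply/trivIsetP => S S' _ _ SS'; apply/seteqP; split => // w [[/= _ e] [/= _ e']].
  by move: SS'; rewrite -e -e' eqxx.
Qed.

Let pr2 (phi : {set 'I_n} -> R) :
  \sum_S phi S.2 * pr S = \sum_S phi S * trials_pr (fine (law B)) S.
Proof.
rewrite -(pair_bigA _ (fun S1 S2 => phi S2 * pr (S1, S2)))/= exchange_big/=.
apply: eq_bigr => S2 _; rewrite -mulr_sumr; congr (_ * _).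
apply: EFin_inj; rewrite -point_set_pr//.
apply: (marginal (f := fun S1 => (S1, S2))).
- exact: measurable_point_set.
- apply/seteqP; split => w /=; first by exists (point_set B' (design X w)).
  by move=> [S _ []].
- apply/trivIsetP => S S' _ _ SS'; apply/seteqP; split => // w [[/= e _] [/= e' _]].
  by move: SS'; rewrite -e -e' eqxx.
Qed.

Let summand_integral S : (\int[P]_w (summand S w)%:E <=
  ((maximal_const p m + 1) * sigma `^ q *
   ((#|S.1|%:R `^ q * N1 `^ (- (3 * q / 2)) +
     Num.max 1 #|S.2|%:R `^ (- (2 * q)) * N1 `^ (3 * q / 2)) * pr S))%:E)%E.
Proof.
pose b : R := Num.max 1 #|S.2|%:R `^ (- q); have b0 : 0 <= b by exact: powR_ge0.
have -> : (\int[P]_w (summand S w)%:E = b%:E *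
    \int[P]_(w in design X @^-1` event S)
      (level_norm (ts (design X w)) (keep S.1 (noise w)) `^ q)%:E)%E.
  rewrite [in RHS]integral_mkcond -ge0_integralZl.
  - apply: eq_integral => w _; rewrite /summand patchE indicE -/b.
    by case: ifP => _; rewrite ?mul0r ?mule0// mul1r -EFinM mulrC.
  - by [].
  - apply/(measurable_restrictT _ _).1; first exact: mdesign.
    apply/measurable_EFinP/measurable_funTS.
    exact: (measurableT_comp (measurable_powR q) (mnorm S.1)).
  - by move=> w _; apply: erestrict_ge0 => w' _; rewrite lee_fin powR_ge0.
  - by rewrite lee_fin.
apply: (le_trans (lee_wpmul2l _ (maximal_inequality_q S.1 (mevent S)))).
  by rewrite lee_fin.
rewrite prE -!EFinM lee_fin.
rewrite [leLHS](_ : _ = (maximal_const p m + 1) * sigma `^ q *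
   (#|S.1|%:R `^ (q / 2) * b * pr S)); last by ring.
apply: ler_wpM2l; first by rewrite mulr_ge0 ?powR_ge0.
by apply: ler_wpM2r => //; exact: decouple.
Qed.

(** On each event that fixes the points in both boxes the maximal inequality
    applies; after decoupling, the sum over these events involves each count
    separately. *)
Lemma shell_noise_bound :
  (\int[P]_w (shell_noise w)%:E <=
   (shell_const * sigma `^ q * Num.max 1 N `^ (- (q / 2)))%:E)%E.
Proof.
under eq_integral do rewrite shell_noiseE -sumEFin.
rewrite ge0_integral_sum; [|by []|by move=> S; apply/measurable_EFinP; exact: msummand|
  by move=> S w _; rewrite lee_fin].
apply: (le_trans (lee_sum _ (fun S _ => summand_integral S))).
rewrite sumEFin lee_fin -mulr_sumr.
have law01 A : measurable A -> 0 <= fine (law A) <= 1.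
  move=> mA; rewrite fine_ge0//= -lee_fin fineK ?fin_num_measure//.
  exact: probability_le1.
have -> : \sum_(S : {set 'I_n} * {set 'I_n})
    (#|S.1|%:R `^ q * N1 `^ (- (3 * q / 2)) +
     Num.max 1 #|S.2|%:R `^ (- (2 * q)) * N1 `^ (3 * q / 2)) * pr S =
    N1 `^ (- (3 * q / 2)) * (\sum_(S : {set 'I_n}) #|S|%:R `^ q * trials_pr (fine (law B')) S) +
    N1 `^ (3 * q / 2) * (\sum_(S : {set 'I_n}) Num.max 1 #|S|%:R `^ (- (2 * q)) *
       trials_pr (fine (law B)) S).
  rewrite -(pr1 (fun S => #|S|%:R `^ q)) -(pr2 (fun S => Num.max 1 #|S|%:R `^ (- (2 * q)))).
  rewrite !mulr_sumr -big_split/=; apply: eq_bigr => S _; ring.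
have /andP[b'0 b'1] := law01 _ mB'; have /andP[b0 b1] := law01 _ mB.
have c2N : 1 <= c2 * N1.
  by rewrite -[leLHS]mulr1 ler_pM// le_max lexx.
have H1 := trials_moment b'0 b'1 q_gt0 c2N lawB'.
have q20 : 0 < 2 * q by rewrite mulr_gt0.
have H2 := trials_inv_moment b0 b1 q20 c1_gt0 N_ge0 lawB.
rewrite (powRM _ (le_trans ler01 c2_ge1) (ltW N1_gt0)) mulrA in H1.
rewrite -/N1 in H2 *.
have := ler_wpM2l (powR_ge0 N1 (- (3 * q / 2))) H1.
have := ler_wpM2l (powR_ge0 N1 (3 * q / 2)) H2.
have NE r s t : r + s = t -> N1 `^ r * N1 `^ s = N1 `^ t.
  by move=> <-; rewrite powRD//; apply/implyP => _; rewrite gt_eqF.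
rewrite [N1 `^ (3 * q / 2) * (_ * N1 `^ _)]mulrCA (NE _ _ (- (q / 2))); last by field.
rewrite [N1 `^ (- (3 * q / 2)) * (_ * N1 `^ _)]mulrCA (NE _ _ (- (q / 2))); last by field.
move=> G2 G1.
apply: (le_trans (ler_wpM2l _ (lerD G1 G2))); first by rewrite mulr_ge0 ?powR_ge0.
by rewrite le_eqVlt; apply/orP; left; apply/eqP; rewrite /shell_const -/N1; ring.
Qed.

End noise_over_boxes.

(** * Block estimators and the reflection of the cube *)

Section vectors.
Context (R : realType) (d : nat).
Implicit Types u v x : d.-tuple R.

Lemma vleP u v : reflect (forall j, tnth u j <= tnth v j) (vle u v).
Proof. exact: forallP. Qed.

Lemma vle_trans u v x : vle u v -> vle v x -> vle u x.
Proof. by move=> /vleP uv /vleP vx; apply/vleP => j; exact: le_trans (vx j). Qed.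

Lemma unit_cube0 : unit_cube (vcst 0 : d.-tuple R).
Proof. by split; apply/vleP => j; rewrite !tnth_mktuple. Qed.

Lemma unit_cube1 : unit_cube (vcst 1 : d.-tuple R).
Proof. by split; apply/vleP => j; rewrite !tnth_mktuple. Qed.

Definition reflection x : d.-tuple R := [tuple 1 - tnth x j | j < d].

Lemma reflectionK : involutive reflection.
Proof.
by move=> x; apply: eq_from_tnth => j; rewrite !tnth_mktuple opprB addrC subrK.
Qed.

Lemma vle_reflection u v : vle (reflection u) (reflection v) = vle v u.
Proof.
apply/vleP/vleP => H j; have := H j; rewrite !tnth_mktuple; lra.
Qed.

Lemma reflection0 : reflection (vcst 0) = vcst 1.
Proof. by apply: eq_from_tnth => j; rewrite !tnth_mktuple subr0. Qed.

Lemma reflection1 : reflection (vcst 1) = vcst 0.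
Proof. by rewrite -reflection0 reflectionK. Qed.

Lemma unit_cube_reflection x : unit_cube (reflection x) <-> unit_cube x.
Proof.
have key y : unit_cube y -> unit_cube (reflection y).
  move=> [/vleP a /vleP b]; split; apply/vleP => j; have := a j; have := b j;
  rewrite !tnth_mktuple; lra.
by split => /key //; rewrite reflectionK.
Qed.

End vectors.

Section estimator_bounds.
Context (R : realType) (d n : nat).
Implicit Types (xs : n.-tuple (d.-tuple R)) (ys : n.-tuple R) (u v x : d.-tuple R).

Lemma ybar_norm_le xs ys u v : `|ybar xs ys u v| <= \sum_i `|tnth ys i|.
Proof.
rewrite /ybar normrM normfV [X in _ / X]ger0_norm//.
have S0 : 0 <= \sum_i `|tnth ys i| by rewrite sumr_ge0.
have [->|k0] := posnP (npts xs u v); first by rewrite invr0 mulr0.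
rewrite ler_pdivrMr ?ltr0n//; apply: (le_trans (ler_norm_sum _ _ _)).
apply: (@le_trans _ _ (\sum_i `|tnth ys i|)).
  by rewrite [leRHS](bigID (fun i => vle u (tnth xs i) && vle (tnth xs i) v))/= lerDl sumr_ge0.
by rewrite ler_peMr// ler1n.
Qed.

Lemma leq_npts xs u u' v : vle u' u -> (npts xs u v <= npts xs u' v)%N.
Proof.
move=> u'u; apply: subset_leq_card; apply/fintype.subsetP => i.
by rewrite !inE => /andP[ui ->]; rewrite (vle_trans u'u ui).
Qed.

Lemma npts_le_ge xs u v : (npts xs u v <= npts_le xs v)%N.
Proof.
by apply: subset_leq_card; apply/fintype.subsetP => i; rewrite !inE => /andP[].
Qed.

Section design.
Variable xs : n.-tuple (d.-tuple R).
Hypotheses (n_gt0 : (0 < n)%N) (xs_cube : design_in_cube xs).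

Lemma npts_0v v : npts xs (vcst 0) v = npts_le xs v.
Proof. by apply: eq_card => i; rewrite !inE; have [-> _] := xs_cube i. Qed.

Lemma npts_u1 u : npts xs u (vcst 1) = npts_ge xs u.
Proof. by apply: eq_card => i; rewrite !inE; have [_ ->] := xs_cube i; rewrite andbT. Qed.

Lemma npts_ge0 : npts_ge xs (vcst 0) = n.
Proof.
rewrite -[RHS]card_ord; apply: eq_card => i; rewrite !inE.
by have [-> _] := xs_cube i.
Qed.

Variables (ys : n.-tuple R) (x v : d.-tuple R) (b : R).
Hypotheses (x_cube : unit_cube x) (v_cube : unit_cube v) (xv : vle x v).
Hypothesis v_ok : (0 < npts xs x v)%N \/ v = vcst 1.
Hypothesis ybar_le : forall u, unit_cube u -> vle u x -> (0 < npts xs u v)%N ->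
  ybar xs ys u v <= b.

Lemma maxmin_le : maxmin xs ys x <= b.
Proof.
apply: ge_sup.
  exists (inf [set ybar xs ys (vcst 0) v | v in
          [set v | [/\ unit_cube v, vle x v & (0 < npts xs (vcst 0) v)%N]]]).
  exists (vcst 0) => //; split; [exact: unit_cube0|by case: x_cube|].
  by rewrite npts_ge0.
move=> _ [u [uc ux nu] <-].
have nuv : (0 < npts xs u v)%N.
  case: v_ok => [nxv|->]; last by rewrite npts_u1.
  exact: leq_trans nxv (leq_npts _ _ ux).
apply: le_trans (ybar_le uc ux nuv); apply: ge_inf; last by exists v.
exists (- \sum_i `|tnth ys i|) => _ [v' _ <-].
by have := ybar_norm_le xs ys u v'; rewrite ler_norml => /andP[].
Qed.

Lemma minmax_le : minmax xs ys x <= b.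
Proof.
have nv : (0 < npts_le xs v)%N.
  case: v_ok => [nxv|->]; first exact: leq_trans nxv (npts_le_ge _ _ _).
  by rewrite -npts_0v npts_u1 npts_ge0.
have zero_ok v' : (0 < npts_le xs v')%N ->
    [/\ unit_cube (vcst 0 : d.-tuple R), vle (vcst 0) x & (0 < npts xs (vcst 0) v')%N].
  by move=> nv'; split; [exact: unit_cube0|by case: x_cube|rewrite npts_0v].
apply: (@le_trans _ _ (sup [set ybar xs ys u v | u in
    [set u | [/\ unit_cube u, vle u x & (0 < npts xs u v)%N]]])); last first.
  apply: ge_sup; first by exists (ybar xs ys (vcst 0) v), (vcst 0) => //; exact: zero_ok.
  by move=> _ [u [uc ux nu] <-]; exact: ybar_le.
apply: ge_inf; last by exists v.
exists (- \sum_i `|tnth ys i|) => _ [v' [_ _ nv'] <-].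
apply: (@le_trans _ _ (ybar xs ys (vcst 0) v')).
  by have := ybar_norm_le xs ys (vcst 0) v'; rewrite ler_norml => /andP[].
apply: ub_le_sup; last by exists (vcst 0) => //; exact: zero_ok.
exists (\sum_i `|tnth ys i|) => _ [u _ <-].
by have := ybar_norm_le xs ys u v'; rewrite ler_norml => /andP[].
Qed.

End design.

Definition reflect_design xs : n.-tuple (d.-tuple R) :=
  [tuple reflection (tnth xs i) | i < n].

Definition oppose ys : n.-tuple R := [tuple - tnth ys i | i < n].

Lemma reflect_designK : involutive reflect_design.
Proof.
by move=> xs; apply: eq_from_tnth => i; rewrite !tnth_mktuple reflectionK.
Qed.

Lemma opposeK : involutive oppose.
Proof. by move=> ys; apply: eq_from_tnth => i; rewrite !tnth_mktuple opprK. Qed.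

Lemma npts_reflect xs u v :
  npts (reflect_design xs) (reflection v) (reflection u) = npts xs u v.
Proof.
by apply: eq_card => i; rewrite !inE tnth_mktuple !vle_reflection andbC.
Qed.

Lemma npts_ge_reflect xs u : npts_ge (reflect_design xs) (reflection u) = npts_le xs u.
Proof. by apply: eq_card => i; rewrite !inE tnth_mktuple !vle_reflection. Qed.

Lemma ybar_reflect xs ys u v :
  ybar (reflect_design xs) (oppose ys) (reflection v) (reflection u) = - ybar xs ys u v.
Proof.
rewrite /ybar npts_reflect -mulNr -sumrN; congr (_ / _).
by apply: eq_big => i; rewrite ?tnth_mktuple// !vle_reflection andbC.
Qed.

Lemma sup_opp (A : set R) : sup [set - x | x in A] = - inf A.
Proof. by rewrite /inf opprK. Qed.

Lemma inf_opp (A : set R) : inf [set - x | x in A] = - sup A.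
Proof.
rewrite /inf; congr (- sup _); apply/seteqP; split => [_ [_ [y Ay <-] <-]|y Ay].
  by rewrite opprK.
by exists (- y); [exists y|rewrite opprK].
Qed.

(** The reflection turns infima over upper corners into suprema over lower
    corners. *)
Lemma minmax_reflect xs ys x :
  minmax xs ys x = - maxmin (reflect_design xs) (oppose ys) (reflection x).
Proof.
rewrite /minmax /maxmin -inf_opp; congr inf.
set S := [set v | _]; set S' := [set u | _].
have -> : S' = (@reflection R d) @` S.
  apply/seteqP; split => [u [uc ux nu]|_ [v [vc xv nv] <-]].
    exists (reflection u); last by rewrite reflectionK.
    split; first exact/unit_cube_reflection.
      by rewrite -vle_reflection reflectionK.
    by rewrite -npts_ge_reflect reflectionK.
  split; first exact/unit_cube_reflection.
    by rewrite vle_reflection.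
  by rewrite npts_ge_reflect.
rewrite !image_comp; apply: eq_imagel => v [vc xv nv] /=.
rewrite -sup_opp; congr sup; apply/seteqP; split => [_ [u [uc ux nu] <-]|_ [_ [w [wc xw nw] <-] <-]].
  exists (ybar (reflect_design xs) (oppose ys) (reflection v) (reflection u)).
    exists (reflection u) => //; split; first exact/unit_cube_reflection.
      by rewrite vle_reflection.
    by rewrite npts_reflect.
  by rewrite ybar_reflect opprK.
exists (reflection w).
  split; first exact/unit_cube_reflection.
    by rewrite -vle_reflection reflectionK.
  by rewrite -npts_reflect reflectionK.
by rewrite -[w in RHS]reflectionK ybar_reflect opprK.
Qed.

Lemma maxmin_reflect xs ys x :
  maxmin xs ys x = - minmax (reflect_design xs) (oppose ys) (reflection x).
Proof. by rewrite minmax_reflect opprK !reflectionK reflect_designK opposeK. Qed.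

(** All design points of the box are below its upper corner, where [f] is
    larger. *)
Lemma average_le xs ys f (es : 'I_n -> R) u v K :
  design_in_cube xs -> unit_cube v -> nondecreasing_on_cube f ->
  (forall i, tnth ys i = f (tnth xs i) + es i) -> (0 < npts xs u v)%N ->
  `|\sum_(i | vle u (tnth xs i) && vle (tnth xs i) v) es i| <= K * (npts xs u v)%:R ->
  ybar xs ys u v <= f v + K.
Proof.
move=> xc vc fm ysE nuv H; rewrite /ybar ler_pdivrMr ?ltr0n// mulrDl.
under eq_bigr do rewrite ysE.
rewrite big_split/=; apply: lerD; last exact: le_trans (ler_norm _) H.
apply: (@le_trans _ _ (\sum_(i | vle u (tnth xs i) && vle (tnth xs i) v) f v)).
  by apply: ler_sum => i /andP[_ iv]; exact: fm.
by rewrite sumr_const mulr_natr.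
Qed.

Variable fhat : n.-tuple (d.-tuple R) -> n.-tuple R -> d.-tuple R -> R.
Hypothesis block : block_estimator fhat.
Hypothesis n_gt0 : (0 < n)%N.

Lemma block_upper xs ys f es x v K :
  design_in_cube xs -> nondecreasing_on_cube f ->
  (forall i, tnth ys i = f (tnth xs i) + es i) ->
  unit_cube x -> unit_cube v -> vle x v -> (0 < npts xs x v)%N \/ v = vcst 1 ->
  (forall u, unit_cube u -> vle u x -> (0 < npts xs u v)%N ->
     `|\sum_(i | vle u (tnth xs i) && vle (tnth xs i) v) es i| <= K * (npts xs u v)%:R) ->
  fhat xs ys x <= f v + K.
Proof.
move=> xc fm ysE cx cv xv vok H; have /andP[_ H2] := block.2 _ ys _ xc cx.
apply: (le_trans H2); rewrite ge_max; apply/andP; split.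
  apply: (maxmin_le n_gt0 xc cx cv xv vok) => u uc ux nu.
  exact: (average_le xc cv fm ysE nu (H _ uc ux nu)).
apply: (minmax_le n_gt0 xc cx cv xv vok) => u uc ux nu.
exact: (average_le xc cv fm ysE nu (H _ uc ux nu)).
Qed.

Lemma nondecreasing_reflect f : nondecreasing_on_cube f ->
  nondecreasing_on_cube (fun x : d.-tuple R => - f (reflection x)).
Proof.
move=> fm u v uc vc uv; rewrite lerN2; apply: fm.
- exact/unit_cube_reflection.
- exact/unit_cube_reflection.
- by rewrite vle_reflection.
Qed.

Lemma block_lower xs ys f es x v K :
  design_in_cube xs -> nondecreasing_on_cube f ->
  (forall i, tnth ys i = f (tnth xs i) + es i) ->
  unit_cube x -> unit_cube v -> vle x v ->
  (0 < npts (reflect_design xs) x v)%N \/ v = vcst 1 ->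
  (forall u, unit_cube u -> vle u x -> (0 < npts (reflect_design xs) u v)%N ->
     `|\sum_(i | vle u (tnth (reflect_design xs) i) &&
         vle (tnth (reflect_design xs) i) v) es i| <=
     K * (npts (reflect_design xs) u v)%:R) ->
  - fhat xs ys (reflection x) <= - f (reflection v) + K.
Proof.
move=> xc fm ysE cx cv xv vok H.
have cx' : unit_cube (reflection x) by exact/unit_cube_reflection.
have /andP[H1 _] := block.2 _ ys _ xc cx'.
have xc' : design_in_cube (reflect_design xs).
  by move=> i; rewrite tnth_mktuple; apply/unit_cube_reflection; exact: xc.
have ysE' i : tnth (oppose ys) i = - f (reflection (tnth (reflect_design xs) i)) + - es i.
  by rewrite !tnth_mktuple ysE reflectionK opprD.
have H' u : unit_cube u -> vle u x -> (0 < npts (reflect_design xs) u v)%N ->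
    ybar (reflect_design xs) (oppose ys) u v <= - f (reflection v) + K.
  move=> uc ux nu.
  apply: (average_le xc' cv (nondecreasing_reflect fm) ysE' nu).
  by rewrite sumrN normrN; exact: H.
have e1 := maxmin_reflect xs ys (reflection x).
have e2 := minmax_reflect xs ys (reflection x).
rewrite reflectionK in e1 e2.
rewrite lerNl; apply: le_trans H1; rewrite le_min e1 e2 !lerN2.
rewrite (maxmin_le n_gt0 xc' cx cv xv vok H') andbT.
exact: (minmax_le n_gt0 xc' cx cv xv vok H').
Qed.

End estimator_bounds.

(** * Sums over grids *)

Section sums.
Local Close Scope classical_set_scope.
Context (R : realType).

Lemma geometric_sum_le (x : R) K : 0 <= x -> x < 1 ->
  \sum_(k < K) x ^+ k <= (1 - x)^-1.
Proof.
move=> x0 x1; have d0 : 0 < 1 - x by rewrite subr_gt0.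
rewrite -[leRHS]mul1r ler_pdivlMr//.
have -> : (\sum_(k < K) x ^+ k) * (1 - x) = 1 - x ^+ K.
  elim: K => [|K IH]; first by rewrite big_ord0 mul0r expr0 subrr.
  by rewrite big_ord_recr/= mulrDl IH exprS; ring.
by rewrite lerBlDr lerDl exprn_ge0.
Qed.

Lemma powR_expn (x s : R) k : 0 <= x -> (x ^+ k) `^ s = (x `^ s) ^+ k.
Proof.
move=> x0; rewrite -(powR_mulrn k x0) -powRrM mulrC powRrM.
by rewrite powR_mulrn// powR_ge0.
Qed.

Lemma powR_le1 (x e : R) : 0 <= x <= 1 -> 0 <= e -> x `^ e <= 1.
Proof.
move=> /andP[x0 x1] e0; have -> : 1 = 1 `^ e :> R by rewrite powR1.
by apply: ge0_ler_powR; rewrite ?nnegrE.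
Qed.

Lemma powR_ge1 (x e : R) : 1 <= x -> 0 <= e -> 1 <= x `^ e.
Proof.
move=> x1 e0; have -> : 1 = 1 `^ e :> R by rewrite powR1.
by apply: ge0_ler_powR; rewrite ?nnegrE ?(le_trans ler01 x1).
Qed.

Lemma powR_lt1 (r e : R) : 0 < r -> r < 1 -> 0 < e -> r `^ e < 1.
Proof.
move=> r0 r1 e0; have -> : 1 = 1 `^ e :> R by rewrite powR1.
by apply: gt0_ltr_powR; rewrite ?nnegrE ?(ltW r0).
Qed.

Definition geometric_const (r e1 e2 : R) : R :=
  (1 - r `^ e1)^-1 + (1 - r `^ e2)^-1.

(** A geometric progression crosses 1 at most once, so both of the one-sided
    sums are geometric series with first term at most 1. *)
Lemma geometric_min_sum (y r e1 e2 : R) K :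
  0 < y -> 0 < r -> r < 1 -> 0 < e1 -> 0 < e2 ->
  \sum_(k < K) Num.min ((y * r ^+ k) `^ e1) ((y * r ^+ k) `^ (- e2)) <=
  geometric_const r e1 e2.
Proof.
move=> y0 r0 r1 e10 e20.
have pw (e z : R) k : 0 < z -> (z * r ^+ k) `^ e = z `^ e * (r `^ e) ^+ k.
  by move=> z0; rewrite powRM ?exprn_ge0 ?(ltW z0) ?(ltW r0)// powR_expn// ltW.
have low z : 0 < z ->
    \sum_(k < K) (if z * r ^+ k <= 1 then (z * r ^+ k) `^ e1 else 0) <= (1 - r `^ e1)^-1.
  elim: K z => [|K IH] z z0.
    by rewrite big_ord0 invr_ge0 subr_ge0 ltW// powR_lt1.
  have [z1|z1] := leP z 1; last first.
    rewrite big_ord_recl /= expr0 mulr1 (lt_geF z1) add0r.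
    under eq_bigr do rewrite /bump/= add1n exprS mulrA.
    by apply: IH; rewrite mulr_gt0.
  apply: (@le_trans _ _ (\sum_(k < K.+1) (r `^ e1) ^+ k)); last first.
    by apply: geometric_sum_le; [exact: powR_ge0|exact: powR_lt1].
  apply: ler_sum => k _; case: ifP => _; last by rewrite exprn_ge0 ?powR_ge0.
  rewrite pw// ler_piMl ?exprn_ge0 ?powR_ge0//.
  by apply: powR_le1; [rewrite (ltW z0)|exact: ltW].
have high : \sum_(k < K) (if 1 < y * r ^+ k then (y * r ^+ k) `^ (- e2) else 0) <=
    (1 - r `^ e2)^-1.
  elim: (K) => [|K' IH]; first by rewrite big_ord0 invr_ge0 subr_ge0 ltW// powR_lt1.
  have [zK|zK] := ltP 1 (y * r ^+ K'); last first.
    by rewrite big_ord_recr/= (le_gtF zK) addr0.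
  apply: (@le_trans _ _ (\sum_(k < K'.+1) (r `^ e2) ^+ k)); last first.
    by apply: geometric_sum_le; [exact: powR_ge0|exact: powR_lt1].
  rewrite (reindex_inj rev_ord_inj)/=; apply: ler_sum => k _.
  case: ifP => _; last by rewrite exprn_ge0 ?powR_ge0.
  rewrite subSS powRN.
  have kK : (k <= K')%N by rewrite -ltnS.
  have yk0 : 0 < y * r ^+ (K' - k) by rewrite mulr_gt0// exprn_gt0.
  rewrite -[leRHS]invrK lef_pV2 ?posrE ?invr_gt0 ?powR_gt0 ?exprn_gt0//; last first.
    by rewrite powR_gt0.
  rewrite -[leLHS]mul1r ler_pdivrMr ?exprn_gt0 ?powR_gt0//.
  rewrite -pw// -mulrA -exprD subnK//.
  by apply: powR_ge1; exact: ltW.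
apply: le_trans (lerD (low _ y0) high); rewrite -big_split/=; apply: ler_sum => k _.
case: ltP => yk; rewrite ?add0r ?addr0.
  by rewrite ge_min lexx orbT.
by rewrite ge_min lexx.
Qed.

Section grids.
Context (d m : nat).
Implicit Types a : {ffun 'I_d -> 'I_m}.

Definition height a : nat := (\sum_j a j)%N.

Lemma sum_prod_grid (phi : 'I_m -> R) :
  \sum_(a : {ffun 'I_d -> 'I_m}) \prod_j phi (a j) = (\sum_i phi i) ^+ d.
Proof. by rewrite -(bigA_distr_bigA (fun=> phi)) prodr_const card_ord. Qed.

Lemma expr_height (x : R) a : x ^+ height a = \prod_j x ^+ a j.
Proof. by rewrite /height expr_sum. Qed.

Lemma sum_height_geometric (x : R) : 0 <= x -> x < 1 ->
  \sum_(a : {ffun 'I_d -> 'I_m}) x ^+ height a <= ((1 - x)^-1) ^+ d.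
Proof.
move=> x0 x1; under eq_bigr do rewrite expr_height.
rewrite (sum_prod_grid (fun i => x ^+ i)) lerXn2r ?nnegrE//.
- by rewrite sumr_ge0// => i _; rewrite exprn_ge0.
- by rewrite invr_ge0 subr_ge0 ltW.
- exact: geometric_sum_le.
Qed.

Lemma card_grid_slice (j : 'I_d) (x : 'I_m) :
  #|[set a : {ffun 'I_d -> 'I_m} | a j == x]| = (m ^ d.-1)%N.
Proof.
rewrite -sum1_card.
transitivity (\sum_(a : {ffun 'I_d -> 'I_m})
    \prod_(i < d) (if i == j then (a i == x : nat) else 1))%N.
  rewrite big_mkcond/=; apply: eq_bigr => a _; rewrite inE.
  rewrite (bigD1 j)//= eqxx big1 ?muln1; first by case: eqP.
  by move=> i /negbTE ->.
rewrite -(bigA_distr_bigA (fun i (y : 'I_m) => if i == j then (y == x : nat) else 1%N)).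
rewrite (bigD1 j)//= [X in (X * _)%N](_ : _ = 1%N).
  rewrite mul1n (eq_bigr (fun=> m)); last first.
    by move=> i /negbTE ->; rewrite sum1_card card_ord.
  by rewrite prod_nat_const cardC1 card_ord.
rewrite eqxx (bigD1 x)//= eqxx big1 ?addn0// => y /negbTE.
by move=> ->.
Qed.

(** The grid of indices and its translate by one differ by few elements, so the
    sum of the increments of a bounded function telescopes up to a boundary
    term. The cyclic shift is a bijection of the grid. *)
Lemma sum_increments (F : ('I_d -> nat) -> R) (lo hi : R) :
  (forall c, lo <= F c <= hi) ->
  \sum_(a : {ffun 'I_d -> 'I_m}) (F (fun j => (a j).+1) - F (fun j => a j)) <=
  d%:R * (m ^ d.-1)%:R * (hi - lo).
Proof.
move=> bF; pose s (a : {ffun 'I_d -> 'I_m}) : {ffun 'I_d -> 'I_m} := [ffun j => ordS (a j)].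
have s_inj : injective s.
  move=> a b /ffunP ab; apply/ffunP => j; have := ab j; rewrite !ffunE.
  exact: (can_inj (@ordSK m)).
rewrite big_split/= sumrN [X in _ - X](reindex_inj s_inj)/= -sumrB.
have hl : 0 <= hi - lo.
  by rewrite subr_ge0; case/andP: (bF (fun=> 0%N)) => l h; exact: le_trans h.
apply: (@le_trans _ _ (\sum_(a : {ffun 'I_d -> 'I_m})
    \sum_(j < d) (if (a j).+1 == m then hi - lo else 0))); last first.
  rewrite exchange_big/= -mulrA mulr_natl -[X in _ *+ X]card_ord -sumr_const.
  apply: ler_sum => j _.
  rewrite -big_mkcond/= sumr_const -[leLHS]mulr_natl.
  apply: ler_wpM2r => //; rewrite ler_nat.
  have [/existsP[x /eqP xm]|/existsPn nox] := boolP [exists x : 'I_m, x.+1 == m].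
    rewrite -(card_grid_slice j x); apply/eq_leq/eq_card => a.
    rewrite inE unfold_in; apply/eqP/eqP => [am|->//].
    by apply/val_inj/eq_add_S; rewrite am xm.
  rewrite (eq_card0 (A := fun a : {ffun 'I_d -> 'I_m} => (a j).+1 == m))//.
  by move=> a; rewrite unfold_in; exact/negbTE/nox.
apply: ler_sum => a _.
have [/existsP[j aj]|/existsPn noj] := boolP [exists j, (a j).+1 == m].
  rewrite (bigD1 j)//= aj (@le_trans _ _ (hi - lo))//.
    case/andP: (bF (fun j => (a j).+1)) => _ h; case/andP: (bF (fun j => s a j)) => l _.
    lra.
  by rewrite lerDl sumr_ge0// => i _; case: ifP.
rewrite (_ : (fun j => s a j : nat) = fun j => (a j).+1); last first.
  apply/funext => j; rewrite ffunE /= modn_small//.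
  by rewrite ltn_neqAle noj ltn_ord.
by rewrite subrr sumr_ge0// => i _; case: ifP.
Qed.

(** The double step is what the oscillation of a function over a cell and the
    next one on the diagonal requires. *)
Lemma sum_increments2 (F : ('I_d -> nat) -> R) (lo hi : R) :
  (forall c, lo <= F c <= hi) ->
  \sum_(a : {ffun 'I_d -> 'I_m}) (F (fun j => (a j).+2) - F (fun j => a j)) <=
  2 * (d%:R * (m ^ d.-1)%:R * (hi - lo)).
Proof.
move=> bF.
have H1 := sum_increments bF.
have H2 := @sum_increments (fun c => F (fun j => (c j).+1)) lo hi (fun c => bF _).
rewrite mulr_natl mulr2n; apply: le_trans (lerD H1 H2).
rewrite -big_split/=; apply: ler_sum => a _.
by rewrite addrC subrKA.
Qed.

End grids.

(** All coordinates but one determine the remaining one. *)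
Lemma card_height d m s : (0 < d)%N ->
  (#|[set a : {ffun 'I_d -> 'I_m} | height a == s]| <= m ^ d.-1)%N.
Proof.
case: d => [//|d'] _ /=; rewrite /height.
pose h (a : {ffun 'I_d'.+1 -> 'I_m}) : {ffun 'I_d' -> 'I_m} := [ffun j => a (lift ord0 j)].
have := @card_in_imset _ _ h [set a : {ffun 'I_d'.+1 -> 'I_m} | (\sum_j a j)%N == s].
move=> <-; first by rewrite (leq_trans (max_card _))// card_ffun !card_ord.
move=> a b; rewrite !inE !big_ord_recl => /eqP sa /eqP sb /ffunP ab.
have ab' j : a (lift ord0 j) = b (lift ord0 j) by have := ab j; rewrite !ffunE.
apply/ffunP => j; case: (unliftP ord0 j) => [k ->//|->]; apply/val_inj => /=.
apply/eqP; rewrite -(eqn_add2r (\sum_(i < d') a (lift ord0 i))).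
by rewrite sa -sb; apply/eqP; congr (_ + _)%N; apply: eq_bigr => i _; rewrite ab'.
Qed.

Lemma sum_height_le d m (phi : nat -> R) : (0 < d)%N -> (forall s, 0 <= phi s) ->
  \sum_(a : {ffun 'I_d -> 'I_m}) phi (height a) <=
  (m ^ d.-1)%:R * \sum_(s < (d * m).+1) phi s.
Proof.
move=> d0 phi0.
have hlt (a : {ffun 'I_d -> 'I_m}) : (height a < (d * m).+1)%N.
  rewrite ltnS /height -[X in (_ <= X * _)%N]card_ord -sum_nat_const.
  by apply: leq_sum => j _; exact: ltnW.
rewrite (partition_big (fun a => Ordinal (hlt a)) xpredT)//= mulr_sumr.
apply: ler_sum => s _.
rewrite (eq_bigr (fun=> phi s)); last by move=> a /eqP <-.
rewrite sumr_const -[X in X <= _]mulr_natl ler_wpM2r// ler_nat.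
apply: leq_trans (card_height m s d0); rewrite leq_eqVlt; apply/orP; left; apply/eqP.
by apply: eq_card => a; rewrite inE.
Qed.

End sums.

(** * The two terms of the rate *)
Section rates.
Context (R : realType).
Local Notation half := (2^-1 : R).

Lemma half_gt0 : 0 < half. Proof. by rewrite invr_gt0. Qed.
Lemma half_lt1 : half < 1. Proof. by rewrite invf_lt1// ltr1n. Qed.

Lemma half_expn k : half ^+ k = ((2 ^ k)%:R)^-1.
Proof. by rewrite exprVn natrX. Qed.

Lemma trunc_log_le n : (0 < n)%N -> (2 ^ trunc_log 2 n)%:R <= n%:R :> R.
Proof. by move=> n0; rewrite ler_nat trunc_logP. Qed.

Lemma trunc_log_gt n : n%:R < (2 ^ (trunc_log 2 n).+1)%:R :> R.
Proof. by rewrite ltr_nat trunc_log_ltn. Qed.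

Definition log_const : R := 3 / ln 2.

Lemma ln2_gt0 : 0 < ln 2 :> R. Proof. by rewrite ln_gt0// ltr1n. Qed.

Lemma trunc_log_ln n : (2 <= n)%N -> (trunc_log 2 n).+2%:R <= log_const * ln n%:R.
Proof.
move=> n2; have n0 : (0 < n)%N by exact: leq_trans n2.
have l2 := ln2_gt0.
have h1 : (trunc_log 2 n)%:R * ln 2 <= ln n%:R :> R.
  have := trunc_log_le n0; rewrite -ler_ln ?posrE ?ltr0n ?expn_gt0//.
  by rewrite natrX lnXn// mulr_natl.
have h2 : ln 2 <= ln n%:R :> R by rewrite ler_ln ?posrE ?ltr0n// ler_nat.
rewrite /log_const mulrAC ler_pdivlMr// -addn2 natrD; lra.
Qed.

(** The order of the q-th moment of a noise average over [y] expected points. *)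
Definition decay (q y : R) : R := Num.max 1 y `^ (- (q / 2)).

Lemma decay_ge0 q y : 0 <= decay q y. Proof. exact: powR_ge0. Qed.

Lemma decay_le q y : 0 < q -> 0 < y -> decay q y <= y `^ (- (q / 2)).
Proof.
move=> q0 y0; rewrite /decay !powRN lef_pV2 ?posrE ?powR_gt0 ?lt_max ?ltr01//.
apply: ge0_ler_powR; rewrite ?nnegrE ?(ltW y0) ?le_max ?ler01 ?lexx ?orbT//.
by rewrite divr_ge0// ltW.
Qed.

Section fixed_exponent.
Variables (d : nat) (q : R).
Hypotheses (d_gt0 : (0 < d)%N) (q_ge1 : 1 <= q).

Let q_gt0 : 0 < q. Proof. exact: lt_le_trans q_ge1. Qed.

Let x_pow (e : R) k : (half ^+ k) `^ e = (half `^ e) ^+ k.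
Proof. by rewrite powR_expn// ltW// half_gt0. Qed.

Let halfe (e : R) : 0 < e -> 0 <= half `^ e < 1.
Proof. by move=> e0; rewrite powR_ge0 powR_lt1 ?half_gt0 ?half_lt1. Qed.

(** If q < 2 the negative power of 2^-|a| leaves a convergent geometric series.
    If q = 2 all shells contribute equally, which gives (log n)^d. If q > 2 the
    sum over the heights is dominated by heights near log n, and there are about
    (log n)^(d-1) shells of a given height. *)
Lemma boundary_sum : exists2 C : R, 0 < C & forall n : nat, (2 <= n)%N ->
  \sum_(a : {ffun 'I_d -> 'I_(trunc_log 2 n).+2})
     half ^+ height a * decay q (n%:R * half ^+ height a) <=
  C * (ln n%:R ^+ (d * (q == 2%R) + (d - 1) * (2%R < q)%R) / n%:R `^ Num.min (q / 2) 1).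
Proof.
have [q2|q2|q2] := ltgtP q 2.
- have e0 : 0 < 1 - q / 2 by lra.
  have /andP[x0 x1] := halfe e0.
  exists ((1 - half `^ (1 - q / 2))^-1 ^+ d); first by rewrite exprn_gt0// invr_gt0 subr_gt0.
  move=> n n2; rewrite !muln0 expr0 mul1r.
  have n0 : 0 < n%:R :> R by rewrite ltr0n (leq_trans _ n2).
  have -> : Num.min (q / 2) 1 = q / 2 by apply/min_idPl; lra.
  rewrite -powRN.
  apply: le_trans (ler_wpM2r (powR_ge0 _ _) (sum_height_geometric d _ x0 x1)).
  rewrite mulr_suml; apply: ler_sum => a _.
  have h0 : 0 < half ^+ height a by rewrite exprn_gt0 ?half_gt0.
  have := decay_le q_gt0 (mulr_gt0 n0 h0) => /(ler_wpM2l (ltW h0)) H.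
  apply: (le_trans H); rewrite powRM ?(ltW n0) ?(ltW h0)// -x_pow.
  rewrite mulrCA [leLHS]mulrC ler_wpM2r ?powR_ge0// -{1}(powRr1 (ltW h0)).
  by rewrite -powRD//; apply/implyP => _; rewrite gt_eqF.
- have e0 : 0 < q / 2 - 1 by lra.
  pose G := geometric_const half 1 (q / 2 - 1).
  have /andP[x0 x1] := halfe ltr01; have /andP[x0' x1'] := halfe e0.
  have G0 : 0 < G by rewrite addr_gt0// invr_gt0 subr_gt0.
  have lc0 : 0 < log_const by rewrite divr_gt0 ?ln2_gt0.
  exists (log_const ^+ d.-1 * G); first by rewrite mulr_gt0 ?exprn_gt0.
  move=> n n2; rewrite muln0 add0n muln1 subn1.
  have n0 : 0 < n%:R :> R by rewrite ltr0n (leq_trans _ n2).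
  have -> : Num.min (q / 2) 1 = 1 by apply/min_idPr; lra.
  rewrite powRr1 ?(ltW n0)//.
  pose phi s : R := Num.min (n%:R * half ^+ s) ((n%:R * half ^+ s) `^ (- (q / 2 - 1))).
  have phi0 s : 0 <= phi s.
    by rewrite le_min powR_ge0 mulr_ge0 ?exprn_ge0 ?(ltW n0) ?(ltW half_gt0).
  apply: (@le_trans _ _ (n%:R^-1 * \sum_(a : {ffun 'I_d -> 'I_(trunc_log 2 n).+2}) phi (height a))).
    rewrite mulr_sumr; apply: ler_sum => a _.
    set y := n%:R * _; have y0 : 0 < y by rewrite mulr_gt0 ?exprn_gt0 ?half_gt0.
    have -> : half ^+ height a = n%:R^-1 * y by rewrite mulKf// gt_eqF.
    rewrite -mulrA ler_wpM2l ?invr_ge0 ?(ltW n0)// /phi -/y le_min; apply/andP; split.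
      rewrite ler_piMr ?(ltW y0)// /decay powRN invf_le1 ?powR_gt0 ?lt_max ?ltr01//.
      by apply: powR_ge1; rewrite ?le_max ?lexx// divr_ge0 ?(ltW q_gt0).
    apply: (le_trans (ler_wpM2l (ltW y0) (decay_le q_gt0 y0))).
    rewrite -{1}(powRr1 (ltW y0)) -powRD; last by apply/implyP => _; rewrite gt_eqF.
    by rewrite le_eqVlt; apply/orP; left; apply/eqP; congr (_ `^ _); ring.
  rewrite [leRHS](_ : _ = n%:R^-1 * ((log_const * ln n%:R) ^+ d.-1 * G)); last first.
    by rewrite (exprMn d.-1 log_const); set u := log_const ^+ _; set v := ln _ ^+ _; ring.
  apply: ler_wpM2l; first by rewrite invr_ge0 ltW.
  apply: (le_trans (sum_height_le _ d_gt0 phi0)); apply: ler_pM => //.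
  + by rewrite sumr_ge0.
  + rewrite natrX lerXn2r ?nnegrE ?trunc_log_ln// mulr_ge0 ?(ltW lc0)// ln_ge0// ler1n.
    exact: leq_trans n2.
  + apply: le_trans (geometric_min_sum _ n0 half_gt0 half_lt1 ltr01 e0).
    apply: ler_sum => s _; rewrite powRr1 /phi//.
- have lc0 : 0 < log_const by rewrite divr_gt0 ?ln2_gt0.
  exists (log_const ^+ d); first by rewrite exprn_gt0.
  move=> n n2; rewrite muln1 muln0 addn0 q2.
  have n0 : 0 < n%:R :> R by rewrite ltr0n (leq_trans _ n2).
  have -> : Num.min (2 / 2) 1 = 1 :> R by apply/min_idPr; lra.
  rewrite powRr1 ?(ltW n0)// mulrA -exprMn.
  apply: (@le_trans _ _ ((trunc_log 2 n).+2%:R ^+ d / n%:R)); last first.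
    rewrite ler_pM2r ?invr_gt0// lerXn2r ?nnegrE ?trunc_log_ln//.
    rewrite mulr_ge0 ?(ltW lc0)// ln_ge0// ler1n.
    exact: leq_trans n2.
  apply: (@le_trans _ _ (\sum_(a : {ffun 'I_d -> 'I_(trunc_log 2 n).+2}) n%:R^-1)); last first.
    by rewrite sumr_const card_ffun !card_ord -[leLHS]mulr_natl natrX.
  apply: ler_sum => a _.
  have h0 : 0 < half ^+ height a by rewrite exprn_gt0 ?half_gt0.
  have := decay_le (ltr0n _ 2 : 0 < 2) (mulr_gt0 n0 h0) => /(ler_wpM2l (ltW h0)) H.
  apply: (le_trans H); rewrite divff// powRN powRr1 ?mulr_ge0 ?(ltW n0) ?(ltW h0)//.
  by rewrite invfM mulrCA mulfV ?mulr1// gt_eqF.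
Qed.

(** The number of points expected, up to a constant, in a cell of level [k] of a
    shell of height [s]. *)
Definition level_pts (n s k : nat) : R := n%:R * half ^+ (s + k * d).

Let dr : R := d%:R.
Let dr_gt0 : 0 < dr. Proof. by rewrite ltr0n. Qed.
Let al : R := q * d%:R / (d%:R + 2).
Let th : R := q / (d%:R + 2).

(* The factor min(1, y) is split as y^al min(y^(1 - al), y^(- al)), which leaves
   a minimum whose sum over the levels is bounded when al < 1. *)
Let small_term N h D : 0 < N -> 0 < h -> 0 < D ->
  (N * h ^+ d) `^ (- (q / 2)) * Num.min 1 (h * D * (N * h ^+ d) `^ half) =
  D `^ al * N `^ (- th) *
  Num.min ((D * N `^ half * h `^ ((dr + 2) / 2)) `^ (1 - al))
          ((D * N `^ half * h `^ ((dr + 2) / 2)) `^ (- al)).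
Proof.
move=> N0 h0 D0.
rewrite -[N]lnK ?posrE// -[h]lnK ?posrE// -[D]lnK ?posrE//.
move: (ln N) (ln h) (ln D) => u v w.
have d2 : dr + 2 != 0 by rewrite gt_eqF// addr_gt0.
have EM (x y : R) : expR x `^ y = expR (x * y) by rewrite expRM.
have ED (x y : R) : expR x * expR y = expR (x + y) by rewrite expRD.
rewrite -!expRM_natl !(EM, ED) !minr_pMr ?expR_ge0// mulr1 !ED minC.
by congr (Num.min _ _); congr expR; rewrite /al /th -/dr; field.
Qed.

(* When al >= 1 the minimum is replaced by its second argument. *)
Let large_term N h D : 0 < N -> 0 < h -> 0 <= D ->
  (N * h ^+ d) `^ (- (q / 2)) * Num.min 1 (h * D * (N * h ^+ d) `^ half) <=
  D * N `^ (- dr^-1) * (N * h ^+ d) `^ (- ((q - 1) / 2 - dr^-1)).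
Proof.
move=> N0 h0 D0.
apply: (@le_trans _ _ ((N * h ^+ d) `^ (- (q / 2)) * (h * D * (N * h ^+ d) `^ half))).
  by rewrite ler_wpM2l ?powR_ge0// ge_min lexx orbT.
rewrite le_eqVlt; apply/orP; left; apply/eqP.
rewrite -[N]lnK ?posrE// -[h]lnK ?posrE//.
move: (ln N) (ln h) => u v.
have EM (x y : R) : expR x `^ y = expR (x * y) by rewrite expRM.
have ED (x y : R) : expR x * expR y = expR (x + y) by rewrite expRD.
rewrite -!expRM_natl !(EM, ED).
have -> : forall a b c : R, a * (b * D * c) = D * (a * b * c) by move=> *; ring.
rewrite -[RHS]mulrA !ED -/dr; congr (_ * expR _); field.
by rewrite gt_eqF.
Qed.

(** Let [al] be q d / (d + 2). Along the levels k, the factor of the minimum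
    decreases geometrically and the factor before it increases geometrically. If
    al < 1 the largest term is the one where the minimum crosses 1, and it is of
    order (Dl / n^(1/d))^al. If al > 1 it is that of the finest level, where
    n 2^-(|a| + k d) is of order 1. If al = 1 the bounds at all levels are equal,
    hence the logarithm. *)
Lemma bias_sum : exists2 C : R, 0 < C & forall (n : nat) (Dl : R)
    (Da : {ffun 'I_d -> 'I_(trunc_log 2 n).+2} -> R),
  (2 <= n)%N -> (forall a, 0 <= Da a <= Dl) ->
  \sum_a Da a <= 2 * (d%:R * ((trunc_log 2 n).+2 ^ d.-1)%:R * Dl) ->
  \sum_(a : {ffun 'I_d -> 'I_(trunc_log 2 n).+2})
    \sum_(k < (trunc_log 2 n).+1 | (height a + k * d <= trunc_log 2 n)%N)
      half ^+ height a * (level_pts n (height a) k `^ (- (q / 2)) *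
        Num.min 1 (half ^+ k * Da a * level_pts n (height a) k `^ half)) <=
  C * ((Dl / n%:R `^ d%:R^-1) `^ Num.min 1 (q * d%:R / (d%:R + 2)) *
       ln n%:R ^+ ((q * d%:R / (d%:R + 2))%R == 1%R)).
Proof.
have al0 : 0 < al by rewrite divr_gt0 ?mulr_gt0 ?addr_gt0.
have th0 : 0 < th by rewrite divr_gt0 ?addr_gt0.
have ptsE n s k : level_pts n s k = n%:R * half ^+ s * (half ^+ k) ^+ d.
  by rewrite /level_pts exprD exprM mulrA.
have ppos n s : (2 <= n)%N -> 0 < n%:R * half ^+ s.
  by move=> n2; rewrite mulr_gt0 ?exprn_gt0 ?half_gt0// ltr0n (leq_trans _ n2).
have Dl0 n Dl (Da : {ffun 'I_d -> 'I_(trunc_log 2 n).+2} -> R) :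
    (forall a, 0 <= Da a <= Dl) -> 0 <= Dl.
  by move=> H; have /andP[] := H [ffun=> ord0]; exact: le_trans.
have half_k k : 0 < half ^+ k by rewrite exprn_gt0 ?half_gt0.
have [al1|al1] := ltP al 1.
  pose r := half `^ ((dr + 2) / 2).
  have /andP[r0 r1] : 0 < r < 1.
    by rewrite powR_gt0 ?half_gt0// powR_lt1 ?half_gt0 ?half_lt1// divr_gt0 ?addr_gt0.
  pose G := geometric_const r (1 - al) al.
  have G0 : 0 < G.
    by rewrite addr_gt0// invr_gt0 subr_gt0 powR_lt1// subr_gt0.
  have th1 : th < 1.
    apply: le_lt_trans al1; rewrite /al mulrAC -/th ler_peMr ?(ltW th0)//.
    by rewrite ler1n.
  have /andP[x0 x1] : 0 <= half `^ (1 - th) < 1 by apply: halfe; rewrite subr_gt0.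
  exists (G * ((1 - half `^ (1 - th))^-1) ^+ d).
    by rewrite mulr_gt0 ?exprn_gt0 ?invr_gt0 ?subr_gt0.
  move=> n Dl Da n2 DaP _.
  have n0 : 0 < n%:R :> R by rewrite ltr0n (leq_trans _ n2).
  rewrite -/al (lt_eqF al1) expr0 mulr1.
  have := Dl0 _ _ _ DaP; rewrite le_eqVlt => /predU1P[D0|D0].
    rewrite big1 => [|a _]; first by rewrite -D0 mul0r powR0 ?mulr0// gt_eqF.
    rewrite big1// => k _; have -> : Da a = 0.
      by apply/eqP; rewrite eq_le andbC; have := DaP a; rewrite -D0.
    by rewrite mulr0 mul0r (_ : Num.min 1 0 = 0) ?mulr0//; apply/min_idPr.
  have inner (a : {ffun 'I_d -> 'I_(trunc_log 2 n).+2}) :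
      \sum_(k < (trunc_log 2 n).+1 | (height a + k * d <= trunc_log 2 n)%N)
      half ^+ height a * (level_pts n (height a) k `^ (- (q / 2)) *
        Num.min 1 (half ^+ k * Da a * level_pts n (height a) k `^ half)) <=
      half ^+ height a * (Dl `^ al * (n%:R * half ^+ height a) `^ (- th) * G).
    rewrite -mulr_sumr; apply: ler_wpM2l; first exact: ltW.
    set N := n%:R * _; have N0 : 0 < N by exact: ppos.
    have y0 : 0 < Dl * N `^ half by rewrite mulr_gt0 ?powR_gt0.
    have al1' : 0 < 1 - al by rewrite subr_gt0.
    apply: (@le_trans _ _ (\sum_(k < (trunc_log 2 n).+1) (Dl `^ al * N `^ (- th) *
        Num.min ((Dl * N `^ half * r ^+ k) `^ (1 - al))
                ((Dl * N `^ half * r ^+ k) `^ (- al))))); last first.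
      rewrite -mulr_sumr; apply: ler_wpM2l; first by rewrite mulr_ge0 ?powR_ge0.
      exact: geometric_min_sum.
    rewrite big_mkcond/=; apply: ler_sum => k _.
    have t0 : 0 <= Dl `^ al * N `^ (- th) * Num.min ((Dl * N `^ half * r ^+ k) `^ (1 - al))
                ((Dl * N `^ half * r ^+ k) `^ (- al)).
      by rewrite !mulr_ge0 ?powR_ge0// le_min !powR_ge0.
    case: ifP => // _.
    have -> : r ^+ k = (half ^+ k) `^ ((dr + 2) / 2) by rewrite x_pow.
    rewrite -small_term// ptsE -/N; apply: ler_wpM2l; first exact: powR_ge0.
    rewrite le_min ge_min lexx/= ge_min; apply/orP; right.
    apply: ler_wpM2r; first exact: powR_ge0.
    by apply: ler_wpM2l; [exact: ltW|case/andP: (DaP a)].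
  apply: (le_trans (ler_sum _ (fun a _ => inner a))).
  have -> : (Dl / n%:R `^ d%:R^-1) `^ al = Dl `^ al * n%:R `^ (- th).
    rewrite powRM ?(ltW D0)// ?invr_ge0 ?powR_ge0//; congr (_ * _).
    rewrite -powRN -powRrM; congr (_ `^ _).
    by rewrite /al /th -/dr; field; rewrite !gt_eqF// addr_gt0.
  rewrite [leRHS](_ : _ = Dl `^ al * n%:R `^ (- th) * G *
      (1 - half `^ (1 - th))^-1 ^+ d); last by ring.
  apply: le_trans (ler_wpM2l _ (sum_height_geometric d (trunc_log 2 n).+2 x0 x1)); last first.
    by rewrite !mulr_ge0 ?powR_ge0// ltW.
  rewrite mulr_sumr; apply: ler_sum => a _.
  rewrite powRM ?(ltW n0)// ?(ltW (half_k _))// -x_pow.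
  rewrite powRB ?(gt_eqF (half_k _)) ?implybT// powRr1 ?(ltW (half_k _))// -powRN.
  by rewrite le_eqVlt; apply/orP; left; apply/eqP; ring.
have minE : Num.min 1 al = 1 by apply/min_idPl.
pose ga := (q - 1) / 2 - dr^-1.
have gaE : ga = (al - 1) * ((dr + 2) / (2 * dr)).
  by rewrite /ga /al -/dr; field; rewrite !gt_eqF// addr_gt0.
pose K1 : R := if (d == 1)%N then 2 else ((1 - half `^ (1 - dr^-1))^-1) ^+ d.
have K10 : 0 < K1.
  rewrite /K1; case: eqP => // /eqP d1; rewrite exprn_gt0// invr_gt0 subr_gt0.
  rewrite powR_lt1 ?half_gt0 ?half_lt1// subr_gt0 invf_lt1// ltr1n.
  by rewrite ltn_neqAle eq_sym d1.
(* If d > 1 the weights are summable and each increment is at most [Dl]. If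
   d = 1 the weights are constant, and it is the bound on the sum of the
   increments that avoids a factor log n. *)
have outer n Dl (Da : {ffun 'I_d -> 'I_(trunc_log 2 n).+2} -> R) :
    (2 <= n)%N -> (forall a, 0 <= Da a <= Dl) ->
    \sum_a Da a <= 2 * (d%:R * ((trunc_log 2 n).+2 ^ d.-1)%:R * Dl) ->
    \sum_a half ^+ height a * (Da a * (n%:R * half ^+ height a) `^ (- dr^-1)) <=
    n%:R `^ (- dr^-1) * (K1 * Dl).
  move=> n2 DaP sumDa; have n0 : 0 < n%:R :> R by rewrite ltr0n (leq_trans _ n2).
  rewrite (eq_bigr (fun a => n%:R `^ (- dr^-1) *
      ((half ^+ height a) `^ (1 - dr^-1) * Da a))); last first.
    move=> a _; rewrite powRM ?(ltW n0)// ?(ltW (half_k _))//.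
    rewrite powRB ?(gt_eqF (half_k _)) ?implybT// powRr1 ?(ltW (half_k _))// -powRN.
    by ring.
  rewrite -mulr_sumr; apply: ler_wpM2l; first exact: powR_ge0.
  rewrite /K1; case: eqP => d1.
    have dr1 : dr = 1 by rewrite /dr d1.
    rewrite (eq_bigr Da); last first.
      by move=> a _; rewrite dr1 invr1 subrr powRr0 mul1r.
    apply: (le_trans sumDa); rewrite -/dr dr1 (_ : d.-1 = 0)%N; last by rewrite d1.
    by rewrite expn0 !mul1r.
  have d2 : (1 < d)%N by rewrite ltn_neqAle eq_sym; apply/andP; split => //; exact/eqP.
  have /andP[x0 x1] : 0 <= half `^ (1 - dr^-1) < 1.
    by apply: halfe; rewrite subr_gt0 invf_lt1// ltr1n.
  apply: le_trans (ler_wpM2r (Dl0 _ _ _ DaP)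
    (sum_height_geometric d (trunc_log 2 n).+2 x0 x1)).
  rewrite mulr_suml; apply: ler_sum => a _; rewrite x_pow.
  by apply: ler_wpM2l; [rewrite exprn_ge0|case/andP: (DaP a)].
have inner n Dl (Da : {ffun 'I_d -> 'I_(trunc_log 2 n).+2} -> R) (S : R) :
    (2 <= n)%N -> (forall a, 0 <= Da a <= Dl) -> 0 <= S ->
    (forall s, \sum_(k < (trunc_log 2 n).+1 | (s + k * d <= trunc_log 2 n)%N)
       level_pts n s k `^ (- ga) <= S) ->
    \sum_a Da a <= 2 * (d%:R * ((trunc_log 2 n).+2 ^ d.-1)%:R * Dl) ->
  \sum_(a : {ffun 'I_d -> 'I_(trunc_log 2 n).+2})
    \sum_(k < (trunc_log 2 n).+1 | (height a + k * d <= trunc_log 2 n)%N)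
      half ^+ height a * (level_pts n (height a) k `^ (- (q / 2)) *
        Num.min 1 (half ^+ k * Da a * level_pts n (height a) k `^ half)) <=
   n%:R `^ (- dr^-1) * (K1 * Dl) * S.
  move=> n2 DaP S0 HS sumDa.
  apply: le_trans (ler_wpM2r S0 (outer _ _ _ n2 DaP sumDa)).
  rewrite mulr_suml; apply: ler_sum => a _.
  apply: le_trans (ler_wpM2l _ (HS (height a))); last first.
    by rewrite !mulr_ge0 ?powR_ge0 ?(ltW (half_k _))//; case/andP: (DaP a).
  rewrite mulr_sumr; apply: ler_sum => k _; rewrite -[leRHS]mulrA.
  apply: ler_wpM2l; first exact: ltW.
  rewrite ptsE; apply: large_term; [exact: ppos|exact: half_k|].
  by case/andP: (DaP a).
move: al1; rewrite le_eqVlt => /predU1P[al1|al1].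
  have lc0 : 0 < log_const by rewrite divr_gt0 ?ln2_gt0.
  exists (K1 * log_const); first by rewrite mulr_gt0.
  move=> n Dl Da n2 DaP sumDa; rewrite -/al ?minE -al1 eqxx expr1.
  have n0 : 0 < n%:R :> R by rewrite ltr0n (leq_trans _ n2).
  have lnn : 0 <= log_const * ln n%:R.
    by rewrite mulr_ge0 ?(ltW lc0)// ln_ge0// ler1n (leq_trans _ n2).
  rewrite powRr1 ?divr_ge0 ?powR_ge0 ?(Dl0 _ _ _ DaP)//.
  apply: (le_trans (inner _ _ _ (log_const * ln n%:R) n2 DaP lnn _ sumDa)).
    move=> s; have -> : ga = 0 by rewrite gaE -al1 subrr mul0r.
    rewrite oppr0; under eq_bigr do rewrite powRr0.
    apply: le_trans (trunc_log_ln n2).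
    rewrite sumr_const -[leLHS]mulr_natl mulr1 ler_nat.
    by rewrite (leq_trans (max_card _))// card_ord.
  by rewrite powRN le_eqVlt; apply/orP; left; apply/eqP; ring.
have ga0 : 0 < ga.
  by rewrite gaE mulr_gt0 ?subr_gt0// divr_gt0 ?addr_gt0 ?mulr_gt0.
pose r := half ^+ d.
have r0 : 0 < r by exact: half_k.
have r1 : r < 1 by rewrite exprn_ilt1 ?(ltW half_gt0) ?half_lt1// -lt0n.
pose G := geometric_const r 1 ga.
have G0 : 0 < G by rewrite addr_gt0// invr_gt0 subr_gt0 powR_lt1.
exists (K1 * G); first by rewrite mulr_gt0.
move=> n Dl Da n2 DaP sumDa; rewrite -/al ?minE (gt_eqF al1) expr0 mulr1.
have n0 : 0 < n%:R :> R by rewrite ltr0n (leq_trans _ n2).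
rewrite powRr1 ?divr_ge0 ?powR_ge0 ?(Dl0 _ _ _ DaP)//.
apply: (le_trans (inner _ _ _ G n2 DaP (ltW G0) _ sumDa)); last first.
  by rewrite powRN le_eqVlt; apply/orP; left; apply/eqP; ring.
move=> s; apply: le_trans (geometric_min_sum (trunc_log 2 n).+1 (ppos n s n2) r0 r1 ltr01 ga0).
rewrite big_mkcond/=; apply: ler_sum => k _; case: ifP => [sk|_]; last first.
  by rewrite le_min !powR_ge0.
have -> : n%:R * half ^+ s * r ^+ k = level_pts n s k.
  by rewrite ptsE /r -!exprM mulnC.
rewrite le_min lexx andbT.
have B1 : 1 <= level_pts n s k.
  rewrite /level_pts half_expn ler_pdivlMr ?ltr0n ?expn_gt0// mul1r.
  apply: le_trans (trunc_log_le (leq_trans _ n2)) => //.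
  by rewrite ler_nat leq_pexp2l.
apply: (@le_trans _ _ 1); last by apply: powR_ge1.
by rewrite powRN invf_le1 ?powR_gt0 ?(lt_le_trans ltr01 B1)// powR_ge1// ltW.
Qed.

End fixed_exponent.
End rates.

(** * Dominating functions with bounded integrals *)

Section bounded_integrals.
Context (R : realType) (dU : measure_display) (U : measurableType dU).
Variables (mu : {measure set U -> \bar R}) (D : set U).
Hypothesis mD : measurable D.
Implicit Types (H : U -> R) (V : R).

(** What has to be carried along when a dominating function is assembled from
    nonnegative pieces. *)
Definition bounded_integral H V : Prop :=
  [/\ measurable_fun D H, forall x, D x -> 0 <= H x &
   (\int[mu]_(x in D) (H x)%:E <= V%:E)%E].

Lemma bounded_integral_le H V V' : V <= V' -> bounded_integral H V -> bounded_integral H V'.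
Proof.
by move=> VV' [mH H0 HV]; split=> //; apply: (le_trans HV); rewrite lee_fin.
Qed.

Lemma bounded_integral_add H1 V1 H2 V2 : bounded_integral H1 V1 -> bounded_integral H2 V2 ->
  bounded_integral (fun x => H1 x + H2 x) (V1 + V2).
Proof.
move=> [m1 p1 I1] [m2 p2 I2]; split.
- exact: measurable_funD.
- by move=> x Dx; rewrite addr_ge0 ?p1 ?p2.
under eq_integral do rewrite EFinD.
rewrite ge0_integralD//; first by rewrite EFinD leeD.
- exact/measurable_EFinP.
- exact/measurable_EFinP.
Qed.

Lemma bounded_integral_scale c H V : 0 <= c -> bounded_integral H V ->
  bounded_integral (fun x => c * H x) (c * V).
Proof.
move=> c0 [m p I]; split.
- exact: measurable_funM.
- by move=> x Dx; rewrite mulr_ge0 ?p.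
under eq_integral do rewrite EFinM.
rewrite ge0_integralZl//; first by rewrite EFinM lee_wpmul2l// lee_fin.
exact/measurable_EFinP.
Qed.

Lemma bounded_integral_eq H H' V : (forall x, D x -> H x = H' x) ->
  bounded_integral H V -> bounded_integral H' V.
Proof.
move=> HH [m p I]; split.
- by apply: eq_measurable_fun m => x; rewrite inE; exact: HH.
- by move=> x Dx; rewrite -HH ?p.
apply: le_trans I; rewrite le_eqVlt; apply/orP; left; apply/eqP.
by apply: eq_integral => x; rewrite inE => /HH ->.
Qed.

Lemma bounded_integral0 : bounded_integral (fun=> 0) 0.
Proof. by split => //; rewrite integral0. Qed.

Lemma bounded_integral_sum (I : Type) (s : seq I) (Q : pred I) (H : I -> U -> R)
    (V : I -> R) : (forall i, Q i -> bounded_integral (H i) (V i)) ->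
  bounded_integral (fun x => \sum_(i <- s | Q i) H i x) (\sum_(i <- s | Q i) V i).
Proof.
move=> HV; elim: s => [|i s IH].
  have -> : (fun x => \sum_(i <- [::] | Q i) H i x) = fun=> 0.
    by apply/funext => x; rewrite big_nil.
  by rewrite big_nil; exact: bounded_integral0.
have -> : (fun x => \sum_(i <- i :: s | Q i) H i x) =
    fun x => (if Q i then H i x else 0) + \sum_(i <- s | Q i) H i x.
  by apply/funext => x; rewrite big_cons; case: (Q i); rewrite ?add0r.
have -> : \sum_(j <- i :: s | Q j) V j =
    (if Q i then V i else 0) + \sum_(j <- s | Q j) V j.
  by rewrite big_cons; case: (Q i); rewrite ?add0r.
apply: bounded_integral_add => //.
have := HV i; case: (Q i) => [|_]; first exact.
exact: bounded_integral0.
Qed.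

Lemma bounded_integral_indic A V : measurable A -> (mu (A `&` D) <= V%:E)%E ->
  bounded_integral (\1_A) V.
Proof. by move=> mA AV; split => //; rewrite integral_indic. Qed.

End bounded_integrals.

(** * Noise averages over boxes with a given upper corner *)
Lemma split_exponent d k : (0 < d)%N -> (k.+2 * d = (k.+1 + d) + k.+1 * d.-1)%N.
Proof. by case: d => // d _; rewrite succnK; lia. Qed.

Section dyadic_scales.
Context (R : realType).
Local Notation half := (2^-1 : R).

Lemma dyadic_scale_below (y : R) K : 0 <= y <= 1 ->
  exists2 k : nat, (k <= K)%N & y <= half ^+ k /\ (k = K \/ half ^+ k.+1 <= y).
Proof.
move=> /andP[y0 y1]; elim: K => [|K [k kK [yk Hk]]].
  by exists 0%N => //; split; [rewrite expr0|left].
case: Hk => [kE|Hk]; last by exists k; [exact: leqW|split=> //; right].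
have [yK|yK] := leP (half ^+ K.+1) y.
  by exists k; [exact: leqW|split => //; right; rewrite kE].
by exists K.+1 => //; split; [exact: ltW|left].
Qed.

Lemma dyadic_scale_above (y s : R) e : 0 <= s -> s <= y -> y <= 2 ^+ e * s ->
  exists2 l : nat, (l <= e)%N & 2 ^+ l * s <= y <= 2 ^+ l.+1 * s.
Proof.
move=> s0 sy; elim: e => [|e IH] ye.
  rewrite expr0 mul1r in ye; exists 0%N => //; rewrite expr0 mul1r sy/= expr1; lra.
have [ye'|ye'] := leP y (2 ^+ e * s).
  by have [l le Hl] := IH ye'; exists l => //; exact: leqW.
by exists e; [exact: leqnSn|rewrite (ltW ye') ye].
Qed.

End dyadic_scales.

Section one_side.
Context (R : realType) (d n : nat) (dT : measure_display)
  (T : measurableType dT) (P : probability T R).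
Variables (X : 'I_n -> {RV P >-> d.-tuple R}) (eps : 'I_n -> {RV P >-> R}).
Variable law : probability (d.-tuple R) R.
Hypothesis iid : iid_with_law X law.
Variables (p q sigma : R).
Hypotheses (q_ge1 : 1 <= q) (qp : q <= p) (p_ge2 : 2 <= p) (sigma_gt0 : 0 < sigma).
Variable kap : 'I_n -> R.-pker (n.-tuple (d.-tuple R)) ~> R.
Hypothesis indep : independent_given_design X eps kap.
Hypothesis moments : {ae P, forall w, forall i : 'I_n,
      (\int[kap i (design X w)]_e e%:E = 0)%E /\
      (\int[kap i (design X w)]_e (`|e| `^ p)%:E <= (sigma `^ p)%:E)%E}.
(* The identity for upper bounds on the error, the reflection of the cube for
   lower bounds. *)
Variable g : d.-tuple R -> d.-tuple R.
Hypothesis mg : measurable_fun setT g.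
Hypothesis g_cube : forall i w, unit_cube (g (X i w)).
Variables rho1 rho2 : R.
Hypotheses (rho1_gt0 : 0 < rho1) (rho12 : rho1 <= rho2).
Hypothesis law_box : forall u v, unit_cube u -> unit_cube v -> vle u v ->
  rho1 * (\prod_(j < d) (tnth v j - tnth u j)) <= fine (law (g @^-1` box u v)) <=
  rho2 * (\prod_(j < d) (tnth v j - tnth u j)).
Hypotheses (d_gt0 : (0 < d)%N) (n_ge2 : (2 <= n)%N).

Local Notation half := (2^-1 : R).

Let q_gt0 : 0 < q. Proof. exact: lt_le_trans q_ge1. Qed.
Let n_gt0 : 0 < n%:R :> R. Proof. by rewrite ltr0n (leq_trans _ n_ge2). Qed.

Let lev (j : 'I_d) (D : n.-tuple (d.-tuple R)) (i : 'I_n) : R := tnth (g (tnth D i)) j.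

Let mlev j i : measurable_fun setT (fun D => lev j D i).
Proof.
apply: (measurableT_comp (measurable_tnth j)).
exact: (measurableT_comp mg (measurable_tnth i)).
Qed.

Definition mapped_design (w : T) : n.-tuple (d.-tuple R) :=
  [tuple g (X i w) | i < n].

Definition noise_sum u v w : R :=
  \sum_(i | vle u (g (X i w)) && vle (g (X i w)) v) eps i w.

Let mbox u v : measurable (g @^-1` box u v).
Proof. by rewrite -[X in measurable X]setTI; apply: mg => //; exact: measurable_box. Qed.

Let in_box w i u v :
  (tnth (design X w) i \in g @^-1` box u v) = vle u (g (X i w)) && vle (g (X i w)) v.
Proof.
rewrite tnth_mktuple; apply/idP/idP; rewrite inE /= /box/=; first by move=> [-> ->].
by move=> /andP.
Qed.

Let card_box w u v : #|point_set (g @^-1` box u v) (design X w)| = npts (mapped_design w) u v.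
Proof. by apply: eq_card => i; rewrite !inE in_box !tnth_mktuple. Qed.

(** A q-th power, like [shell_noise]. *)
Definition box_noise b' b v : T -> R :=
  shell_noise X eps q lev (g @^-1` box b v) (g @^-1` box b' v).

Lemma box_noise_ge0 b' b v w : 0 <= box_noise b' b v w.
Proof. exact: shell_noise_ge0. Qed.

Lemma measurable_box_noise b' b v : measurable_fun setT (box_noise b' b v).
Proof. exact: measurable_shell_noise. Qed.

(** The box from [b] to [v] is contained in the one from [u] to [v], so the
    number of its points bounds the denominator of the average. *)
Lemma noise_sum_le b' b u v w : vle b' u -> vle u b ->
  (0 < npts (mapped_design w) u v)%N ->
  `|noise_sum u v w| <= box_noise b' b v w `^ q^-1 * (npts (mapped_design w) u v)%:R.
Proof.
move=> b'u ub nu.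
set k : R := (npts _ _ _)%:R; have k1 : 1 <= k by rewrite ler1n.
have k0 : 0 < k by exact: lt_le_trans k1.
set M := level_norm [seq lev j (design X w) | j <- enum 'I_d]
  (keep (point_set (g @^-1` box b' v) (design X w)) (fun i => eps i w)).
have M0 : 0 <= M.
  have [N0 _ _] := level_norm_seminorm [seq lev j (design X w) | j <- enum 'I_d].
  exact: N0.
have SM : `|noise_sum u v w| <= M.
  apply: le_trans (level_norm_ge (enum 'I_d) (fun j => lev j (design X w)) (tnth u) _).
  rewrite le_eqVlt; apply/orP; left; apply/eqP; congr `|_|.
  rewrite /noise_sum big_mkcond [RHS]big_mkcond/=; apply: eq_bigr => i _.
  have -> : all (fun j => tnth u j <= lev j (design X w) i) (enum 'I_d) = vle u (g (X i w)).
    apply/allP/vleP => [H j|H j _].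
      by have := H j (mem_enum _ _); rewrite /lev tnth_mktuple.
    by rewrite /lev tnth_mktuple.
  case: (boolP (vle u (g (X i w)))) => //= ui.
  rewrite /keep inE in_box (vle_trans b'u ui)/=.
  by case: ifP.
have card_b : Num.max 1 #|point_set (g @^-1` box b v) (design X w)|%:R <= k.
  rewrite ge_max k1 ler_nat card_box; exact: leq_npts.
set c := Num.max 1 _ in card_b; have c0 : 0 < c by rewrite lt_max ltr01.
have -> : box_noise b' b v w `^ q^-1 = M * c^-1.
  rewrite /box_noise /shell_noise -/M -/c powRN -powR_inv1 ?powR_ge0//.
  rewrite powRAC powR_inv1 ?(ltW c0)// -powRM ?invr_ge0 ?(ltW c0)//.
  by rewrite -powRrM mulfV ?gt_eqF// powRr1// mulr_ge0 ?invr_ge0// ltW.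
apply: (le_trans SM); rewrite -mulrA ler_peMr//.
by rewrite mulrC ler_pdivlMr ?mul1r.
Qed.

Let rho2_gt0 : 0 < rho2. Proof. exact: lt_le_trans rho12. Qed.

Definition outer_const : R := Num.max 1 (rho2 * 2 ^+ d).

Definition box_const : R := shell_const p q d rho1 outer_const.

Lemma box_const_ge0 : 0 <= box_const.
Proof.
rewrite /box_const /shell_const mulr_ge0 ?addr_ge0 ?mulr_ge0 ?powR_ge0 ?expR_ge0//.
by rewrite addr_ge0 ?powR_ge0.
Qed.

Lemma box_noise_bound b' b v : unit_cube b' -> unit_cube b -> unit_cube v ->
  vle b' b -> vle b v ->
  n%:R * (\prod_(j < d) (tnth v j - tnth b' j)) <=
    2 ^+ d * Num.max 1 (n%:R * \prod_(j < d) (tnth v j - tnth b j)) ->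
  (\int[P]_w (box_noise b' b v w)%:E <=
   (box_const * sigma `^ q *
    decay q (n%:R * \prod_(j < d) (tnth v j - tnth b j)))%:E)%E.
Proof.
move=> cb' cb cv b'b bv vol.
have c2 : 1 <= outer_const by rewrite le_max lexx.
have v0 : 0 <= \prod_(j < d) (tnth v j - tnth b j).
  by apply: prodr_ge0 => j _; rewrite subr_ge0; exact/vleP.
have N0 : 0 <= n%:R * \prod_(j < d) (tnth v j - tnth b j) by rewrite mulr_ge0.
have /andP[l1 _] := law_box cb cv bv.
have /andP[_ l2] := law_box cb' cv (vle_trans b'b bv).
apply: (shell_noise_bound iid q_gt0 qp p_ge2 sigma_gt0 indep moments mlev _ _ rho1_gt0 c2 N0) => //.
  by rewrite mulrCA ler_pM2l.
apply: (@le_trans _ _ (rho2 * (n%:R * \prod_(j < d) (tnth v j - tnth b' j)))).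
  by rewrite [leRHS]mulrCA ler_pM2l.
apply: (@le_trans _ _ (rho2 * (2 ^+ d * Num.max 1 (n%:R * \prod_(j < d) (tnth v j - tnth b j))))).
  by rewrite ler_pM2l.
rewrite mulrA ler_wpM2r//; first by rewrite le_max ler01.
by rewrite le_max lexx orbT.
Qed.

(** * Boxes with the upper corner of the cube as a vertex *)

Let L := trunc_log 2 n.
Implicit Types a : {ffun 'I_d -> 'I_L.+2}.

(** A shell consists of the points at distance between [2^-(a_j + 1)] and
    [2^-a_j] from 1 in coordinate [j]; the last index collects all points nearer
    to 1. *)
Definition shell_lo (a : 'I_d -> nat) : d.-tuple R := [tuple 1 - half ^+ a j | j < d].

Definition shell_hi (a : 'I_d -> nat) : d.-tuple R :=
  [tuple if (a j <= L)%N then 1 - half ^+ (a j).+1 else 1 | j < d].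

Let half_pos k : 0 < half ^+ k. Proof. by rewrite exprn_gt0 ?half_gt0. Qed.
Let half_le1 k : half ^+ k <= 1.
Proof. by rewrite exprn_ile1 ?ltW ?half_gt0 ?half_lt1. Qed.

Lemma shell_lo_cube (a : 'I_d -> nat) : unit_cube (shell_lo a).
Proof.
split; apply/vleP => j; rewrite !tnth_mktuple; first by rewrite subr_ge0.
by rewrite lerBlDr lerDl ltW.
Qed.

Lemma shell_hi_cube (a : 'I_d -> nat) : unit_cube (shell_hi a).
Proof.
split; apply/vleP => j; rewrite !tnth_mktuple; case: ifP => _ //.
  by rewrite subr_ge0.
Qed.

Lemma shell_lo_hi (a : 'I_d -> nat) : vle (shell_lo a) (shell_hi a).
Proof.
apply/vleP => j; rewrite !tnth_mktuple; case: ifP => _.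
  rewrite lerB// exprS ler_piMl// ltW ?half_lt1//.
by rewrite lerBlDr lerDl ltW.
Qed.

Lemma shell_cover x : unit_cube x ->
  exists a, vle (shell_lo (fun j => a j)) x /\ vle x (shell_hi (fun j => a j)).
Proof.
move=> [/vleP x0 /vleP x1].
have /fin_all_exists[a aP] (j : 'I_d) : exists k : 'I_L.+2,
    1 - half ^+ k <= tnth x j <= (if (k <= L)%N then 1 - half ^+ k.+1 else 1).
  have := x0 j; have := x1 j; rewrite !tnth_mktuple => xj1 xj0.
  have [|k kL [yk Hk]] := @dyadic_scale_below R (1 - tnth x j) L.+1; first by lra.
  exists (Ordinal (kL : k < L.+2)%N) => /=; apply/andP; split; first by lra.
  case: ifP => // kL'; case: Hk => [kE|]; last by lra.
  by move: kL'; rewrite kE ltnn.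
exists [ffun j => a j]; split; apply/vleP => j; rewrite !tnth_mktuple ffunE.
  by case/andP: (aP j).
by case/andP: (aP j).
Qed.

Lemma vol_shell (a : 'I_d -> nat) :
  \prod_(j < d) (tnth (vcst 1) j - tnth (shell_lo a) j) = half ^+ (\sum_j a j).
Proof.
rewrite expr_sum; apply: eq_bigr => j _.
by rewrite !tnth_mktuple opprB addrCA subrr addr0.
Qed.

Lemma decay_anti x y : x <= y -> decay q y <= decay q x.
Proof.
move=> xy; rewrite /decay !powRN lef_pV2 ?posrE ?powR_gt0 ?lt_max ?ltr01//.
have m0 z : 0 <= Num.max 1 z :> R by rewrite le_max ler01.
apply: ge0_ler_powR; rewrite ?nnegrE//; first by rewrite divr_ge0// ltW.
by rewrite ge_max !le_max lexx xy orbT.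
Qed.

Lemma decay_scale c y : 1 <= c -> decay q (y / c) <= c `^ (q / 2) * decay q y.
Proof.
move=> c1; have c0 : 0 < c by exact: lt_le_trans c1.
have -> : c `^ (q / 2) * decay q y = (Num.max 1 y / c) `^ (- (q / 2)).
  rewrite powRM ?invr_ge0 ?(ltW c0) ?le_max ?ler01// mulrC; congr (_ * _).
  by rewrite -(powR_inv1 (ltW c0)) -powRrM mulN1r opprK.
rewrite /decay !powRN lef_pV2 ?posrE ?powR_gt0 ?divr_gt0 ?lt_max ?ltr01//.
have m0 z : 0 <= Num.max 1 z :> R by rewrite le_max ler01.
have m1 z : 1 <= Num.max 1 z :> R by rewrite le_max lexx.
apply: ge0_ler_powR; rewrite ?nnegrE//.
- by rewrite divr_ge0// ltW.
- by rewrite divr_ge0// ltW.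
rewrite ler_pdivrMr// ge_max; apply/andP; split.
  by rewrite -[leLHS]mulr1 ler_pM.
by rewrite -ler_pdivrMr// le_max lexx orbT.
Qed.

Definition corner_noise (a : 'I_d -> nat) : T -> R :=
  box_noise (shell_lo a) (shell_hi a) (vcst 1).

Definition corner_const : R := box_const * (2 ^+ d) `^ (q / 2).

Let one_cube := @unit_cube1 R d.

(** If all indices are at most [L] the shell stays away from the faces of the
    cube, and its two boxes have volumes that differ by the factor 2^d.
    Otherwise the larger box is expected to contain a bounded number of points,
    and both sides are of order 1. *)
Lemma corner_noise_bound a :
  (\int[P]_w (corner_noise (fun j => a j) w)%:E <=
   (corner_const * sigma `^ q * decay q (n%:R * half ^+ height a))%:E)%E.
Proof.
rewrite /corner_noise; set lo := shell_lo _; set hi := shell_hi _.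
have chi : unit_cube hi by exact: shell_hi_cube.
have hi1 : vle hi (vcst 1) by case: chi.
have volE := vol_shell (fun j => a j); rewrite -/lo -/(height a) in volE.
set V := n%:R * \prod_(j < d) (tnth (vcst 1) j - tnth hi j).
have V0 : 0 <= V.
  by rewrite mulr_ge0// prodr_ge0// => j _; rewrite subr_ge0; exact/vleP.
have key : n%:R * half ^+ height a / 2 ^+ d <= V \/ n%:R * half ^+ height a <= 1.
  have [/forallP al|/existsP[j jl]] := boolP [forall j, (a j <= L)%N].
    left; rewrite /V -mulrA ler_pM2l// le_eqVlt; apply/orP; left; apply/eqP.
    rewrite /height expr_sum -exprVn -[X in _ ^+ X]card_ord -prodr_const -big_split/=.
    apply: eq_bigr => j _; rewrite !tnth_mktuple al exprS.
    by rewrite opprB addrCA subrr addr0 mulrC.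
  have {}jl : (L < a j)%N by rewrite ltnNge.
  right; rewrite half_expn ler_pdivrMr ?ltr0n ?expn_gt0// mul1r.
  apply: (le_trans (ltW (trunc_log_gt R n))); rewrite ler_nat leq_pexp2l//.
  by apply: (leq_trans jl); rewrite /height (bigD1 j)//= leq_addr.
have c1 : 1 <= 2 ^+ d :> R by rewrite exprn_ege1// ler1n.
have c0 : 0 < 2 ^+ d :> R by exact: lt_le_trans c1.
have m1 : 1 <= Num.max 1 V by rewrite le_max lexx.
have mV : V <= Num.max 1 V by rewrite le_max lexx orbT.
apply: (le_trans (box_noise_bound (shell_lo_cube _) chi one_cube (shell_lo_hi _) hi1 _)).
  rewrite -/lo volE -/V; case: key => [H|H].
    rewrite ler_pdivrMr// in H; apply: (le_trans H).
    by rewrite mulrC ler_pM2l.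
  by apply: (le_trans H); rewrite -[leLHS]mulr1 ler_pM.
rewrite -/V lee_fin /corner_const.
have bc := box_const_ge0; have sq : 0 <= sigma `^ q by exact: powR_ge0.
set Y := n%:R * _ in key *.
suff H : decay q V <= (2 ^+ d) `^ (q / 2) * decay q Y.
  apply: (le_trans (ler_wpM2l (mulr_ge0 bc sq) H)).
  by rewrite le_eqVlt; apply/orP; left; apply/eqP; ring.
case: key => [H|H].
  exact: (le_trans (decay_anti H) (decay_scale _ c1)).
have -> : decay q Y = 1 by rewrite /decay max_l// powR1.
rewrite mulr1; apply: (@le_trans _ _ 1).
  have := decay_anti V0; by rewrite [decay q 0]/decay max_l// powR1.
by apply: powR_ge1 => //; rewrite divr_ge0// ltW.
Qed.

(** * Boxes whose lower corner is bounded away from the upper one *)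

Section peel.
Variables (b v : d.-tuple R) (e : 'I_d -> nat) (m : nat).
Hypotheses (cb : unit_cube b) (cv : unit_cube v).
Hypothesis side : forall j, tnth v j - tnth b j = half ^+ e j.
Hypothesis em : forall j, (e j < m)%N.
Implicit Types l : {ffun 'I_d -> 'I_m}.

(** The lower corners are classified by the dyadic size, relative to the box
    from [b] to [v], of their distance to [v] in each coordinate. *)
Definition peel_lo l : d.-tuple R :=
  [tuple Num.max 0 (tnth v j - 2 ^+ (l j).+1 * half ^+ e j) | j < d].

Definition peel_hi l : d.-tuple R := [tuple tnth v j - 2 ^+ l j * half ^+ e j | j < d].

Definition peel_noise : T -> R :=
  fun w => \sum_(l | vle (vcst 0) (peel_hi l)) box_noise (peel_lo l) (peel_hi l) v w.

Let two_pos k : 0 < 2 ^+ k :> R. Proof. by rewrite exprn_gt0. Qed.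

Lemma peel_cover u : unit_cube u -> vle u b ->
  exists l, [/\ vle (vcst 0) (peel_hi l), vle (peel_lo l) u & vle u (peel_hi l)].
Proof.
move=> [/vleP u0 /vleP u1] /vleP ub.
have /fin_all_exists[l lP] (j : 'I_d) : exists k : 'I_m,
    2 ^+ k * half ^+ e j <= tnth v j - tnth u j <= 2 ^+ k.+1 * half ^+ e j.
  have [_ /vleP v1] := cv; have := v1 j; have := u0 j; have := ub j; have := side j.
  rewrite !tnth_mktuple => sj ubj u0j v1j.
  have [|||k ke kP] := @dyadic_scale_above R (tnth v j - tnth u j) (half ^+ e j) (e j).
  - exact: ltW.
  - by rewrite -sj lerB.
  - by rewrite -exprMn mulfV// expr1n; lra.
  by exists (Ordinal (leq_ltn_trans ke (em j))).
exists [ffun j => l j]; split; apply/vleP => j; rewrite !tnth_mktuple ?ffunE;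
  have := u0 j; rewrite tnth_mktuple; have /andP[] := lP j; rewrite ?ge_max; lra.
Qed.

Lemma peel_noise_le u w : unit_cube u -> vle u b -> (0 < npts (mapped_design w) u v)%N ->
  `|noise_sum u v w| <= peel_noise w `^ q^-1 * (npts (mapped_design w) u v)%:R.
Proof.
move=> cu ub nu; have [l [ok lou uhi]] := peel_cover cu ub.
apply: (le_trans (noise_sum_le lou uhi nu)); rewrite ler_wpM2r//.
apply: ge0_ler_powR; rewrite ?nnegrE ?invr_ge0 ?(ltW q_gt0) ?box_noise_ge0//.
  by apply: sumr_ge0 => *; exact: box_noise_ge0.
rewrite /peel_noise (bigD1 l)//= lerDl; apply: sumr_ge0 => *; exact: box_noise_ge0.
Qed.

Lemma measurable_peel_noise : measurable_fun setT peel_noise.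
Proof.
have -> : peel_noise = fun w => \sum_l
    (if vle (vcst 0) (peel_hi l) then box_noise (peel_lo l) (peel_hi l) v w else 0).
  by apply/funext => w; rewrite /peel_noise big_mkcond.
by apply: measurable_sum => l; case: (vle _ _) => //; exact: measurable_box_noise.
Qed.

Lemma peel_noise_ge0 w : 0 <= peel_noise w.
Proof. by apply: sumr_ge0 => *; exact: box_noise_ge0. Qed.

Definition peel_const : R := box_const * ((1 - half `^ (q / 2))^-1) ^+ d.

(** The boxes of the piece [l] are expected to contain 2^|l| times as many points
    as the box from [b] to [v], so their contributions decrease geometrically in
    [l]. *)
Lemma peel_noise_bound :
  (\int[P]_w (peel_noise w)%:E <=
   (peel_const * sigma `^ q * (n%:R * \prod_j half ^+ e j) `^ (- (q / 2)))%:E)%E.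
Proof.
set N := n%:R * _.
have N0 : 0 < N by rewrite mulr_gt0// prodr_gt0.
have bc := box_const_ge0; have sq : 0 <= sigma `^ q by exact: powR_ge0.
have q20 : 0 < q / 2 by rewrite divr_gt0.
under eq_integral do rewrite /peel_noise big_mkcond -sumEFin.
rewrite ge0_integral_sum; [|by []|
  by move=> l; apply/measurable_EFinP; case: (vle _ _) => //; exact: measurable_box_noise|
  by move=> l w _; case: (vle _ _) => //; rewrite lee_fin box_noise_ge0].
have one l : vle (vcst 0) (peel_hi l) ->
    (\int[P]_w (box_noise (peel_lo l) (peel_hi l) v w)%:E <=
     (box_const * sigma `^ q * (N `^ (- (q / 2)) * (half `^ (q / 2)) ^+ height l))%:E)%E.
  move=> ok.
  have volE : n%:R * \prod_(j < d) (tnth v j - tnth (peel_hi l) j) = N * 2 ^+ height l.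
    rewrite /N -mulrA expr_height -big_split/=; congr (_ * _).
    by apply: eq_bigr => j _; rewrite tnth_mktuple opprB addrCA subrr addr0 mulrC.
  have hiv : vle (peel_hi l) v.
    by apply/vleP => j; rewrite tnth_mktuple lerBlDr lerDl mulr_ge0// ltW.
  have [/vleP v0 v1] := cv.
  have chi : unit_cube (peel_hi l) by split => //; exact: vle_trans hiv v1.
  have lohi : vle (peel_lo l) (peel_hi l).
    apply/vleP => j; rewrite !tnth_mktuple; have /vleP/(_ j) := ok; rewrite !tnth_mktuple.
    rewrite ge_max => ->/=; rewrite lerB// ler_wpM2r ?(ltW (half_pos _))//.
    by rewrite exprS ler_peMl ?ler1n// ltW.
  have clo : unit_cube (peel_lo l).
    split; last by apply: vle_trans lohi _; case: chi.
    by apply/vleP => j; rewrite !tnth_mktuple le_max lexx.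
  apply: (le_trans (box_noise_bound clo chi cv lohi hiv _)); rewrite ?volE.
    apply: (@le_trans _ _ (2 ^+ d * (N * 2 ^+ height l))); last first.
      by rewrite ler_pM2l// le_max lexx orbT.
    rewrite -volE mulrCA ler_pM2l// -[X in 2 ^+ X]card_ord -prodr_const -big_split/=.
    apply: ler_prod => j _; rewrite !tnth_mktuple; apply/andP; split.
      rewrite subr_ge0 ge_max; have := v0 j; rewrite tnth_mktuple => ->/=.
      by rewrite lerBlDr lerDl mulr_ge0// ltW.
    rewrite opprB addrCA subrr addr0 mulrA -exprS.
    by rewrite lerBlDr -lerBlDl le_max lexx orbT.
  rewrite lee_fin; apply: ler_wpM2l; first exact: mulr_ge0.
  apply: (le_trans (decay_le q_gt0 _)); first exact: mulr_gt0.
  rewrite powRM ?(ltW N0) ?(ltW (two_pos _))// le_eqVlt; apply/orP; left; apply/eqP.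
  congr (_ * _); rewrite powR_expn//; congr (_ ^+ _).
  by rewrite -(powR_inv1 (ler0n _ 2)) -[in RHS]powRrM mulN1r.
have one' l : (\int[P]_w
       (if vle (vcst 0) (peel_hi l) then box_noise (peel_lo l) (peel_hi l) v w else 0)%:E <=
     (box_const * sigma `^ q * (N `^ (- (q / 2)) * (half `^ (q / 2)) ^+ height l))%:E)%E.
  have := one l; case: (vle _ _) => [H|_]; first exact: H.
  have N1 : 0 <= N `^ (- (q / 2)) * half `^ (q / 2) ^+ height l.
    by rewrite mulr_ge0 ?powR_ge0 ?exprn_ge0 ?powR_ge0.
  by rewrite integral0 lee_fin; apply: mulr_ge0 => //; exact: mulr_ge0.
apply: (le_trans (lee_sum _ (fun l _ => one' l))); rewrite sumEFin lee_fin -!mulr_sumr.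
have H := sum_height_geometric d m (powR_ge0 _ _) (powR_lt1 (half_gt0 R) (half_lt1 R) q20).
apply: (le_trans (ler_wpM2l (mulr_ge0 bc sq) (ler_wpM2l (powR_ge0 _ _) H))).
by rewrite le_eqVlt; apply/orP; left; apply/eqP; rewrite /peel_const; ring.
Qed.

End peel.

(** An empty box is one term of the negative moment of the number of its
    points. *)
Lemma empty_box_pr u v : unit_cube u -> unit_cube v -> vle u v ->
  (P [set w | npts (mapped_design w) u v = 0%N] <=
   (inv_moment_const rho1 (q / 2) *
    decay q (n%:R * \prod_(j < d) (tnth v j - tnth u j)))%:E)%E.
Proof.
move=> cu cv uv; set A := g @^-1` box u v.
have q20 : 0 < q / 2 by rewrite divr_gt0.
have -> : [set w | npts (mapped_design w) u v = 0%N] =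
    design X @^-1` [set D | point_set A D = finset.set0].
  apply/seteqP; split => w /=; rewrite -card_box; first by move/eqP; rewrite cards_eq0 => /eqP.
  by move=> ->; rewrite cards0.
rewrite (point_set_pr iid)//; last exact: mbox.
have lA : 0 <= fine (law A) <= 1.
  rewrite fine_ge0//= -lee_fin fineK ?fin_num_measure//; do ?[exact: mbox]; exact: probability_le1 (mbox _ _).
have /andP[l0 l1] := lA.
have /andP[lo _] := law_box cu cv uv.
have v0 : 0 <= \prod_(j < d) (tnth v j - tnth u j).
  by apply: prodr_ge0 => j _; rewrite subr_ge0; exact/vleP.
rewrite lee_fin.
have H := @trials_inv_moment R n (fine (law A)) l0 l1 (q / 2) rho1
  (n%:R * \prod_(j < d) (tnth v j - tnth u j)) q20 rho1_gt0 (mulr_ge0 (ltW n_gt0) v0) _.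
apply: le_trans (H _); last by rewrite mulrCA ler_pM2l.
rewrite (bigD1 finset.set0)//= cards0 max_l// powR1 mul1r lerDl.
by apply: sumr_ge0 => S _; rewrite mulr_ge0 ?powR_ge0// trials_pr_ge0.
Qed.

(** * One-sided errors *)

Variables (F : d.-tuple R -> R) (D : R).
Hypothesis F_mono : nondecreasing_on_cube F.
Hypothesis D_ge0 : 0 <= D.
Hypothesis F_range : F (vcst 1) - F (vcst 0) <= D * sigma.

(** What the definition of a block estimator gives about the positive part of
    its error: any upper corner [v] with a nonempty box below it yields a bound
    by a bias and by a maximal deviation. *)
Definition one_sided x w err : Prop :=
  0 <= err /\ forall v K, unit_cube v -> vle x v ->
  (0 < npts (mapped_design w) x v)%N \/ v = vcst 1 -> 0 <= K ->
  (forall u, unit_cube u -> vle u x -> (0 < npts (mapped_design w) u v)%N ->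
     `|noise_sum u v w| <= K * (npts (mapped_design w) u v)%:R) ->
  err <= F v - F x + K.

Definition corner_sum x w : R :=
  \sum_(a : {ffun 'I_d -> 'I_L.+2} | vle (shell_lo (fun j => a j)) x)
    corner_noise (fun j => a j) w.

Lemma corner_sum_ge0 x w : 0 <= corner_sum x w.
Proof. by apply: sumr_ge0 => a _; exact: box_noise_ge0. Qed.

Definition corner_rate x : R :=
  \sum_(a : {ffun 'I_d -> 'I_L.+2} | vle (shell_lo (fun j => a j)) x)
    decay q (n%:R * half ^+ height a).

Lemma corner_rate_ge0 x : 0 <= corner_rate x.
Proof. by apply: sumr_ge0 => a _; exact: decay_ge0. Qed.

Lemma corner_sum_bound x :
  bounded_integral P setT (corner_sum x) (corner_const * sigma `^ q * corner_rate x).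
Proof.
rewrite /corner_rate mulr_sumr; apply: bounded_integral_sum => // a _.
split => [|w _|]; [exact: measurable_box_noise|exact: box_noise_ge0|exact: corner_noise_bound].
Qed.

Lemma F_bound u v : unit_cube u -> unit_cube v -> F v - F u <= D * sigma.
Proof.
move=> cu cv; apply: le_trans F_range; apply: lerB.
  by apply: F_mono => //; case: cv.
by apply: F_mono => //; [exact: unit_cube0|case: cu].
Qed.

Let pow_le (x y : R) : 0 <= x -> x <= y -> x `^ q <= y `^ q.
Proof. by move=> x0 xy; apply: ge0_ler_powR; rewrite ?nnegrE ?(ltW q_gt0) ?(le_trans x0 xy). Qed.

Let powq_root (x : R) : 0 <= x -> (x `^ q^-1) `^ q = x.
Proof. by move=> x0; rewrite -powRrM mulVf ?gt_eqF// powRr1. Qed.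

(** The choice [v = 1]. *)
Lemma one_sided_corner x w err : unit_cube x -> one_sided x w err ->
  err `^ q <= 2 `^ q * ((D * sigma) `^ q + corner_sum x w).
Proof.
move=> cx [e0 H].
have {}H := H (vcst 1) (corner_sum x w `^ q^-1) one_cube.
have Ds0 : 0 <= D * sigma by rewrite mulr_ge0// ltW.
have e1 : err <= D * sigma + corner_sum x w `^ q^-1.
  apply: (@le_trans _ _ (F (vcst 1) - F x + corner_sum x w `^ q^-1)); last first.
    by rewrite lerD2r F_bound.
  apply: H; [by case: cx|by right|exact: powR_ge0|].
  move=> u cu ux nu; have [a [lou uhi]] := shell_cover cu.
  apply: (le_trans (noise_sum_le lou uhi nu)); rewrite ler_wpM2r//.
  apply: ge0_ler_powR; rewrite ?nnegrE ?invr_ge0 ?(ltW q_gt0) ?box_noise_ge0 ?corner_sum_ge0//.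
  rewrite /corner_sum (bigD1 a)/=; last exact: vle_trans ux.
  by rewrite lerDl; apply: sumr_ge0 => *; exact: box_noise_ge0.
apply: (le_trans (pow_le e0 e1)).
apply: (le_trans (powR_addM _ _ _)); rewrite ?powR_ge0 ?(ltW q_gt0)//.
by rewrite powq_root// corner_sum_ge0.
Qed.

(** If the box from [b] to [v] contains a design point, [v] is an admissible
    corner for all [x] below [b]; otherwise one falls back on the upper corner
    of the cube. *)
Lemma one_sided_peel b v e m t x w err :
  unit_cube b -> unit_cube v -> (forall j, tnth v j - tnth b j = half ^+ e j) ->
  (forall j, (e j < m)%N) -> unit_cube x -> vle x b -> F v - F x <= t -> 0 <= t ->
  one_sided x w err ->
  err `^ q <= 2 `^ q * (t `^ q + @peel_noise v e m w +
    (D * sigma) `^ q * \1_[set w | npts (mapped_design w) b v = 0%N] w + corner_sum x w).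
Proof.
move=> cb cv side em cx xb Ft t0 H.
have p0 : 0 <= @peel_noise v e m w by exact: peel_noise_ge0.
have [n0|n0] := posnP (npts (mapped_design w) b v).
  rewrite indicE mem_set// mulr1.
  apply: (le_trans (one_sided_corner cx H)); rewrite ler_wpM2l ?powR_ge0//.
  by rewrite lerD2r lerDr addr_ge0// powR_ge0.
rewrite indicE memNset ?mulr0; last by rewrite /= => e0; rewrite e0 in n0.
case: H => e0 H.
have bv : vle b v by apply/vleP => j; rewrite -subr_ge0 side ltW.
have e1 : err <= t + peel_noise v e m w `^ q^-1.
  apply: (@le_trans _ _ (F v - F x + peel_noise v e m w `^ q^-1)); last by rewrite lerD2r.
  apply: H => //; [exact: vle_trans bv|left|exact: powR_ge0|].
    exact: leq_trans n0 (leq_npts _ _ xb).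
  move=> u cu ux nu; apply: (peel_noise_le cv side em cu _ nu); exact: vle_trans xb.
apply: (le_trans (pow_le e0 e1)).
apply: (le_trans (powR_addM _ _ _)); rewrite ?powR_ge0 ?(ltW q_gt0)//.
rewrite powq_root// ler_wpM2l ?powR_ge0// addr0 lerDl; exact: corner_sum_ge0.
Qed.

(** * Multiscale grid *)

(** In coordinate [j] the mesh is half the side of a shell divided by [2^k], so a
    shell is covered by [2^k.+1] cells and one more diagonal step stays within
    the cube. *)
Definition grid_pt (a : 'I_d -> nat) (k : nat) (c : 'I_d -> nat) : d.-tuple R :=
  [tuple 1 - half ^+ a j + (c j)%:R * half ^+ (a j + k.+2) | j < d].

(** [sigma] times the power of [level_pts] is the standard deviation of a noise
    average over a cell. *)
Definition steep a k (c : 'I_d -> nat) : bool :=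
  sigma * level_pts R d n (height a) k `^ (- half) <
  F (grid_pt (fun j => a j) k (fun j => (c j).+2)) - F (grid_pt (fun j => a j) k c).

Definition in_cell a k (c : 'I_d -> nat) x : bool :=
  vle (grid_pt (fun j => a j) k c) x && vle x (grid_pt (fun j => a j) k (fun j => (c j).+1)).

Lemma grid_pt_cube (a : 'I_d -> nat) k (c : 'I_d -> nat) :
  (forall j, (c j <= (2 ^ k.+1).+1)%N) -> unit_cube (grid_pt a k c).
Proof.
move=> cb; split; apply/vleP => j; rewrite !tnth_mktuple.
  by rewrite addr_ge0 ?subr_ge0// mulr_ge0// ltW.
rewrite -lerBrDl opprB addrCA subrr addr0 exprD mulrCA.
rewrite -[leRHS]mulr1 ler_pM2l// half_expn ler_pdivrMr ?ltr0n ?expn_gt0// mul1r ler_nat.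
apply: (leq_trans (cb j)); rewrite [X in (_ <= X)%N]expnS mul2n -addnn -addn1 leq_add2l.
by rewrite expn_gt0.
Qed.

Lemma grid_pt_le (a : 'I_d -> nat) k (c c' : 'I_d -> nat) :
  (forall j, (c j <= c' j)%N) -> vle (grid_pt a k c) (grid_pt a k c').
Proof.
move=> cc; apply/vleP => j; rewrite !tnth_mktuple lerD2l ler_wpM2r ?ler_nat//.
Qed.

Lemma shell_in_cell a k x : vle (shell_lo (fun j => a j)) x ->
  vle x (shell_hi (fun j => a j)) -> (forall j, (a j <= L)%N) ->
  exists c : {ffun 'I_d -> 'I_(2 ^ k.+1)}, in_cell a k (fun j => c j) x.
Proof.
move=> /vleP lox /vleP xhi aL.
have cell (j : 'I_d) : exists c : 'I_(2 ^ k.+1),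
    1 - half ^+ a j + c%:R * half ^+ (a j + k.+2) <= tnth x j <=
    1 - half ^+ a j + c.+1%:R * half ^+ (a j + k.+2).
  have := lox j; have := xhi j; rewrite !tnth_mktuple aL => xj lj.
  pose y := (tnth x j - (1 - half ^+ a j)) / half ^+ (a j + k.+2).
  have h0 := half_pos (a j + k.+2).
  have y0 : 0 <= y by rewrite divr_ge0 ?subr_ge0// ltW.
  have yM : y <= (2 ^ k.+1)%:R.
    have MU : (2 ^ k.+1)%:R * half ^+ k.+1 = 1.
      by rewrite half_expn mulfV// pnatr_eq0 -lt0n expn_gt0.
    by rewrite ler_pdivrMr// -addSnnS exprD mulrCA MU mulr1; move: xj; rewrite exprS; lra.
  have M0 : (0 < 2 ^ k.+1)%N by rewrite expn_gt0.
  suff [c cM /andP[c1 c2]] : exists2 c : nat, (c < 2 ^ k.+1)%N & c%:R <= y <= c.+1%:R.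
    exists (Ordinal cM) => /=; apply/andP; split.
      by move: c1; rewrite ler_pdivlMr//; lra.
    by move: c2; rewrite ler_pdivrMr//; lra.
  elim: (2 ^ k.+1)%N M0 yM => // -[|M] IH _ yM; first by exists 0%N => //; rewrite y0.
  have [yM'|yM'] := leP y M.+1%:R.
    by have [c cM H] := IH isT yM'; exists c => //; exact: ltnW.
  by exists M.+1 => //; rewrite (ltW yM').
have /fin_all_exists[c cP] := cell.
exists [ffun j => c j]; apply/andP; split; apply/vleP => j; rewrite !tnth_mktuple ffunE;
  by have /andP[] := cP j.
Qed.

Definition level_const : R :=
  1 + (peel_const + D `^ q * inv_moment_const rho1 (q / 2)) * (2 ^+ (2 * d)) `^ (q / 2).

Let level_pos a k : 0 < level_pts R d n (height a) k.
Proof. by rewrite /level_pts mulr_gt0. Qed.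

(** In a cell that is not steep, the next cell on the diagonal serves as the box
    from [b] to [v]: it is above [x], it has the volume of a cell, and the bias
    is at most the noise level. *)
Lemma level_bounded a k (c : 'I_d -> nat) x : (forall j, (c j < 2 ^ k.+1)%N) ->
  unit_cube x -> in_cell a k c x -> ~~ steep a k c ->
  exists H, (forall w err, one_sided x w err -> err `^ q <= H w) /\
  bounded_integral P setT H (2 `^ q * (level_const * sigma `^ q *
     level_pts R d n (height a) k `^ (- (q / 2)) +
     corner_const * sigma `^ q * corner_rate x)).
Proof.
move=> cM cx /andP[cx1 cx2]; rewrite /steep -leNgt; set lp := level_pts _ _ _ _ _ => flat.
have lp0 : 0 < lp by exact: level_pos.
set b := grid_pt _ _ _ in cx2; set v := grid_pt _ _ _ in flat; set u := grid_pt _ _ _ in cx1 flat.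
have cb : unit_cube b by apply: grid_pt_cube => j; exact/leqW.
have cv : unit_cube v by apply: grid_pt_cube => j; rewrite ltnS; exact: cM.
have cu : unit_cube u by apply: grid_pt_cube => j; exact/leqW/ltnW.
pose e j := (a j + k.+2)%N; pose m := (L.+2 + k.+2)%N.
have side j : tnth v j - tnth b j = half ^+ e j.
  by rewrite !tnth_mktuple -/(e j) -[(c j).+2%:R]natr1; ring.
have em j : (e j < m)%N by rewrite /e /m ltn_add2r.
have bv : vle b v by apply/vleP => j; rewrite -subr_ge0 side ltW.
pose t := sigma * lp `^ (- half).
have t0 : 0 <= t by rewrite mulr_ge0 ?powR_ge0// ltW.
have Ft : F v - F x <= t by apply: le_trans flat; rewrite lerB// F_mono.
have NE : n%:R * \prod_j half ^+ e j = lp / 2 ^+ (2 * d).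
  rewrite /lp /level_pts -mulrA -exprVn -exprD -expr_sum; congr (_ * _ ^+ _).
  by rewrite /e big_split/= sum_nat_const card_ord -addnA -mulnDl mulnC addn2 mulnC.
have volE : n%:R * \prod_(j < d) (tnth v j - tnth b j) = lp / 2 ^+ (2 * d).
  by rewrite -NE; congr (_ * _); apply: eq_bigr => j _; exact: side.
have scale : (lp / 2 ^+ (2 * d)) `^ (- (q / 2)) =
    (2 ^+ (2 * d)) `^ (q / 2) * lp `^ (- (q / 2)).
  rewrite powRM ?(ltW lp0)// ?invr_ge0 ?exprn_ge0// mulrC; congr (_ * _).
  rewrite -powR_inv1 ?exprn_ge0//.
  by rewrite -powRrM mulN1r opprK.
pose E : set T := [set w | npts (mapped_design w) b v = 0%N].
exists (fun w => 2 `^ q * (t `^ q + peel_noise v e m w +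
    (D * sigma) `^ q * \1_E w + corner_sum x w)); split.
  by move=> w err; apply: one_sided_peel.
apply: bounded_integral_scale => //.
apply: bounded_integral_add => //; last exact: corner_sum_bound.
have mE : measurable E.
  have -> : E = design X @^-1` [set D | point_set (g @^-1` box b v) D = finset.set0].
    apply/seteqP; split => w /=; rewrite /E/= -card_box; first by move/eqP; rewrite cards_eq0 => /eqP.
    by move=> ->; rewrite cards0.
  rewrite -[X in measurable X]setTI; apply: measurable_design => //.
  exact: measurable_point_set (mbox _ _).
have ic0 : 0 <= inv_moment_const rho1 (q / 2).
  by rewrite /inv_moment_const addr_ge0// mulr_ge0 ?addr_ge0 ?powR_ge0.
have sig0 := ltW sigma_gt0; have lpq0 : 0 <= lp `^ (- half) by exact: powR_ge0.
apply: (@bounded_integral_le _ _ _ _ _ _ (t `^ q +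
   peel_const * sigma `^ q * (lp / 2 ^+ (2 * d)) `^ (- (q / 2)) +
   (D * sigma) `^ q * (inv_moment_const rho1 (q / 2) * (lp / 2 ^+ (2 * d)) `^ (- (q / 2))))).
  rewrite scale /t (powRM _ sig0 lpq0) (powRM _ D_ge0 sig0).
  have -> : (lp `^ (- half)) `^ q = lp `^ (- (q / 2)).
    by rewrite -powRrM; congr (_ `^ _); ring.
  by rewrite le_eqVlt; apply/orP; left; apply/eqP; rewrite /level_const; ring.
apply: bounded_integral_add => //; first apply: bounded_integral_add => //.
- split => // [w _|]; first exact: powR_ge0.
  rewrite integral_cst// (_ : (P : {measure set T -> \bar R}) setT = 1%E) ?mule1//; exact: probability_setT.
- split => [|w _|]; [exact: measurable_peel_noise|exact: peel_noise_ge0|].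
  by rewrite -NE; exact: peel_noise_bound.
apply: bounded_integral_scale => //; first exact: powR_ge0.
apply: bounded_integral_indic => //; rewrite setIT.
apply: (le_trans (empty_box_pr cb cv bv)); rewrite volE lee_fin ler_wpM2l//.
by apply: decay_le => //; rewrite divr_gt0// exprn_gt0.
Qed.

Let pow_scale (y c : R) : 0 <= y -> 0 <= c ->
  (y / c) `^ (- (q / 2)) = c `^ (q / 2) * y `^ (- (q / 2)).
Proof.
move=> y0 c0; rewrite powRM// ?invr_ge0// mulrC; congr (_ * _).
by rewrite -(powR_inv1 c0) -powRrM mulN1r opprK.
Qed.

Definition steep_rate x : R :=
  \sum_(a : {ffun 'I_d -> 'I_L.+2})
    \sum_(k < L.+1 | (height a + k * d <= L)%N)
      \sum_(c : {ffun 'I_d -> 'I_(2 ^ k.+1)} |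
            steep a k (fun j => c j) && in_cell a k (fun j => c j) x)
        level_pts R d n (height a) k `^ (- (q / 2)).

Lemma steep_rate_ge x a k (c : {ffun 'I_d -> 'I_(2 ^ k.+1)}) :
  (height a + k * d <= L)%N -> steep a k (fun j => c j) -> in_cell a k (fun j => c j) x ->
  level_pts R d n (height a) k `^ (- (q / 2)) <= steep_rate x.
Proof.
move=> hk st ic; have kL : (k < L.+1)%N.
  by rewrite ltnS (leq_trans _ hk)// (leq_trans _ (leq_addl _ _))// leq_pmulr.
have t0 b i : 0 <= level_pts R d n b i `^ (- (q / 2)) by exact: powR_ge0.
rewrite /steep_rate (bigD1 a)//= (bigD1 (Ordinal kL))//= (bigD1 c)/=; last by rewrite st ic.
rewrite -!addrA lerDl !addr_ge0//; do ?[apply: sumr_ge0 => *] => //.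
Qed.

Lemma steep_rate_ge0 x : 0 <= steep_rate x.
Proof. by do ?[apply: sumr_ge0 => *]; exact: powR_ge0. Qed.

Definition boundary_const : R := 2 `^ q * (level_const + D `^ q + corner_const).

Definition steep_const : R := 2 `^ q * ((level_const + D `^ q) * (2 ^+ d) `^ (q / 2)).

Lemma level_const_ge0 : 0 <= level_const.
Proof.
rewrite /level_const addr_ge0// mulr_ge0 ?powR_ge0// addr_ge0//.
  rewrite /peel_const mulr_ge0 ?box_const_ge0// exprn_ge0// invr_ge0 subr_ge0.
  apply: powR_le1; last by rewrite divr_ge0// ltW.
  by rewrite (ltW (half_gt0 R)) (ltW (half_lt1 R)).
by rewrite mulr_ge0 ?powR_ge0// /inv_moment_const addr_ge0// mulr_ge0 ?addr_ge0 ?powR_ge0.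
Qed.

Lemma boundary_const_ge0 : 0 <= boundary_const.
Proof.
have cc : 0 <= corner_const by apply: mulr_ge0; [exact: box_const_ge0|exact: powR_ge0].
exact: (mulr_ge0 (powR_ge0 _ _) (addr_ge0 (addr_ge0 level_const_ge0 (powR_ge0 _ _)) cc)).
Qed.

Lemma steep_const_ge0 : 0 <= steep_const.
Proof.
exact: (mulr_ge0 (powR_ge0 _ _) (mulr_ge0 (addr_ge0 level_const_ge0 (powR_ge0 _ _)) (powR_ge0 _ _))).
Qed.

(** Let [k0] be the first level at which the cell of [x] is not steep, among the
    levels at which cells are expected to contain a point. If [k0 = 0] the noise
    level of that cell is accounted for by [corner_rate]. If [k0 > 0] it is
    comparable to the noise level of the steep cell one level before. If all
    cells are steep, the last one is expected to contain a bounded number of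
    points, so its noise level is of order 1 and the trivial bound
    suffices. *)
Lemma one_sided_bounded x : unit_cube x ->
  exists H, (forall w err, one_sided x w err -> err `^ q <= H w) /\
  bounded_integral P setT H
    (sigma `^ q * (boundary_const * corner_rate x + steep_const * steep_rate x)).
Proof.
move=> cx; have [a [lox xhi]] := shell_cover cx.
have lc := level_const_ge0; have Dq : 0 <= D `^ q by exact: powR_ge0.
have c2 : 0 <= (2 ^+ d) `^ (q / 2) :> R by exact: powR_ge0.
have sr := steep_rate_ge0 x; have cr := corner_rate_ge0 x.
have key V : V <= (level_const + D `^ q) * corner_rate x +
      (level_const + D `^ q) * (2 ^+ d) `^ (q / 2) * steep_rate x ->
    2 `^ q * (sigma `^ q * V + corner_const * sigma `^ q * corner_rate x) <=
    sigma `^ q * (boundary_const * corner_rate x + steep_const * steep_rate x).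
  move=> /(ler_wpM2l (mulr_ge0 (powR_ge0 2 q) (powR_ge0 sigma q))) HV.
  rewrite /boundary_const /steep_const; move: HV.
  by rewrite -subr_ge0 => HV; rewrite -subr_ge0; apply: (le_trans HV);
    rewrite le_eqVlt; apply/orP; left; apply/eqP; ring.
have corner : D `^ q <= (level_const + D `^ q) * corner_rate x +
      (level_const + D `^ q) * (2 ^+ d) `^ (q / 2) * steep_rate x ->
    exists H, (forall w err, one_sided x w err -> err `^ q <= H w) /\
    bounded_integral P setT H
    (sigma `^ q * (boundary_const * corner_rate x + steep_const * steep_rate x)).
  move=> DV; exists (fun w => 2 `^ q * ((D * sigma) `^ q + corner_sum x w)); split.
    by move=> w err; exact: one_sided_corner.
  apply: bounded_integral_le (key _ DV) _.
  apply: bounded_integral_scale => //.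
  apply: bounded_integral_add => //; last exact: corner_sum_bound.
  split => // [w _|]; first exact: powR_ge0.
  rewrite integral_cst// (_ : (P : {measure set T -> \bar R}) setT = 1%E).
    by rewrite mule1 powRM ?(ltW sigma_gt0)// mulrC.
  exact: probability_setT.
have level k (c : {ffun 'I_d -> 'I_(2 ^ k.+1)}) : in_cell a k (fun j => c j) x ->
    ~~ steep a k (fun j => c j) ->
    level_const * level_pts R d n (height a) k `^ (- (q / 2)) <=
      (level_const + D `^ q) * corner_rate x +
      (level_const + D `^ q) * (2 ^+ d) `^ (q / 2) * steep_rate x ->
    exists H, (forall w err, one_sided x w err -> err `^ q <= H w) /\
    bounded_integral P setT H
    (sigma `^ q * (boundary_const * corner_rate x + steep_const * steep_rate x)).
  move=> ic nst HV; have [H [H1 H2]] := level_bounded (fun j => ltn_ord (c j)) cx ic nst.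
  exists H; split => //; apply: bounded_integral_le H2.
  by rewrite mulrAC -[X in _ * (X + _)]mulrC; exact: key.
have dec : decay q (n%:R * half ^+ height a) <= corner_rate x.
  rewrite /corner_rate (bigD1 a)//= lerDl; apply: sumr_ge0 => *; exact: decay_ge0.
have E0 : 0 <= (level_const + D `^ q) * (2 ^+ d) `^ (q / 2) * steep_rate x.
  by rewrite !mulr_ge0// addr_ge0.
have grow : (level_const + D `^ q) * (2 ^+ d) `^ (q / 2) * steep_rate x <=
    (level_const + D `^ q) * corner_rate x +
    (level_const + D `^ q) * (2 ^+ d) `^ (q / 2) * steep_rate x.
  by rewrite lerDr mulr_ge0// addr_ge0.
have [hL|hL] := ltnP L (height a).
  apply: corner; rewrite -[leLHS]addr0 lerD// -[leLHS]mul1r mulrC.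
  apply: ler_pM => //; first by rewrite lerDr.
  apply: le_trans dec; rewrite /decay max_l ?powR1//.
  rewrite half_expn ler_pdivrMr ?ltr0n ?expn_gt0// mul1r.
  by apply: (le_trans (ltW (trunc_log_gt R n))); rewrite ler_nat leq_pexp2l.
have aL j : (a j <= L)%N by apply: leq_trans hL; rewrite /height (bigD1 j)//= leq_addr.
pose c k := projT1 (cid (shell_in_cell k lox xhi aL)).
have cP k : in_cell a k (fun j => c k j) x by rewrite /c; case: cid.
pose K := ((L - height a) %/ d)%N.
have hK k : (k <= K)%N -> (height a + k * d <= L)%N.
  move=> kK; rewrite -leq_subRL//; apply: leq_trans (leq_trunc_div _ d).
  by rewrite leq_mul2r kK orbT.
have [k0 Pk0 mink0] := @ex_minnP (fun k => ~~ steep a k (fun j => c k j) || (k == K.+1))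
  (ex_intro _ K.+1 (introT orP (or_intror (eqxx _)))).
have k0K : (k0 <= K.+1)%N by apply: mink0; rewrite eqxx orbT.
case: k0 Pk0 mink0 k0K => [|k] Pk0 mink0 k0K.
  rewrite orbF in Pk0.
  apply: (level 0%N (c 0%N)) => //.
  rewrite -[leLHS]addr0 lerD//; apply: ler_pM => //; first exact: powR_ge0.
    by rewrite lerDl.
  apply: le_trans dec; rewrite /decay /level_pts mul0n addn0 max_r//.
  rewrite half_expn ler_pdivlMr ?ltr0n ?expn_gt0// mul1r.
  by apply: le_trans (trunc_log_le R (ltnW n_ge2)); rewrite ler_nat leq_pexp2l.
have stk : steep a k (fun j => c k j).
  apply/negPn/negP => nst; have := mink0 k; rewrite nst ltnn => H.
  by have := H isT.
have G := steep_rate_ge (hK _ k0K) stk (cP k).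
set lp := level_pts _ _ _ _ _ in G; have lp0 : 0 < lp by exact: level_pos.
have [nst|st] := boolP (steep a k.+1 (fun j => c k.+1 j)).
  rewrite nst/= eqSS in Pk0; apply: corner.
  apply: (le_trans _ grow).
  rewrite -mulrA -[leLHS]mulr1; apply: ler_pM => //; first by rewrite lerDr.
  apply: le_trans (ler_wpM2l c2 G).
  rewrite -pow_scale ?(ltW lp0) ?exprn_ge0// powRN.
  rewrite invf_ge1 ?powR_gt0 ?divr_gt0 ?exprn_gt0//.
  apply: powR_le1; last by rewrite divr_ge0// ltW.
  rewrite divr_ge0 ?(ltW lp0) ?exprn_ge0//= ler_pdivrMr ?exprn_gt0// mul1r.
  rewrite /lp /level_pts half_expn ler_pdivrMr ?ltr0n ?expn_gt0//.
  apply: (le_trans (ltW (trunc_log_gt R n))); rewrite -natrX -natrM ler_nat -expnD leq_pexp2l//.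
  rewrite addnCA -mulSn (eqP Pk0) -ltn_subLR ?muln_gt0//.
  exact: ltn_ceil.
apply: (level k.+1 (c k.+1)) => //.
apply: (le_trans _ grow); rewrite -mulrA.
apply: ler_pM => //; first exact: powR_ge0.
  by rewrite lerDl.
apply: le_trans (ler_wpM2l c2 G); rewrite -pow_scale ?(ltW lp0) ?exprn_ge0//.
rewrite le_eqVlt; apply/orP; left; apply/eqP; congr (_ `^ _).
by rewrite /lp /level_pts -mulrA -exprVn -exprD mulSn addnAC addnA.
Qed.

(** * Integration over the cube *)

Hypothesis g_map : forall x, unit_cube x -> unit_cube (g x).
Hypothesis cube_box : forall u v, unit_cube u -> unit_cube v -> vle u v ->
  (lebesgue_tuple R d ((g @^-1` box u v) `&` unit_cube) <=
   (\prod_(j < d) (tnth v j - tnth u j))%:E)%E.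

Local Notation lebesgue := (lebesgue_tuple R d).

Let m_cube : measurable (unit_cube : set (d.-tuple R)).
Proof. exact: measurable_box. Qed.

Lemma box_bounded u v (V : R) : unit_cube u -> unit_cube v -> vle u v ->
  \prod_(j < d) (tnth v j - tnth u j) = V ->
  bounded_integral lebesgue unit_cube (fun x => (vle u (g x) && vle (g x) v)%:R) V.
Proof.
move=> cu cv uv volE.
have -> : (fun x => (vle u (g x) && vle (g x) v)%:R) = \1_(g @^-1` box u v) :> (_ -> R).
  apply/funext => x; rewrite indicE; congr (nat_of_bool _)%:R.
  apply/idP/idP; rewrite inE /= /box/=; first by move=> /andP.
  by move=> [-> ->].
by apply: bounded_integral_indic => //; rewrite -volE; exact: cube_box.
Qed.

Lemma corner_rate_integral :
  bounded_integral lebesgue unit_cube (fun x => corner_rate (g x))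
    (\sum_(a : {ffun 'I_d -> 'I_L.+2}) half ^+ height a * decay q (n%:R * half ^+ height a)).
Proof.
have one a : bounded_integral lebesgue unit_cube
    (fun x => decay q (n%:R * half ^+ height a) *
       (vle (shell_lo (fun j => a j)) (g x) && vle (g x) (vcst 1))%:R)
    (half ^+ height a * decay q (n%:R * half ^+ height a)).
  rewrite [half ^+ height a * _]mulrC; apply: bounded_integral_scale => //; first exact: decay_ge0.
  apply: box_bounded => //; [exact: shell_lo_cube|by case: (shell_lo_cube (fun j => a j))|].
  exact: vol_shell.
have S := @bounded_integral_sum _ _ _ lebesgue unit_cube m_cube _ (index_enum _) predT _ _
  (fun a _ => one a).
apply: bounded_integral_eq S => //= x cx.
rewrite /corner_rate [RHS]big_mkcond/=; apply: eq_bigr => a _.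
have [_ ->] := g_map cx; rewrite andbT.
by case: (vle _ _); rewrite ?mulr1 ?mulr0.
Qed.

(** The total increment of [F] over the shell and the next one. *)
Definition increment a : R :=
  (F (shell_lo (fun j => (a j).+2)) - F (shell_lo (fun j => a j))) / sigma.

Lemma increment_bound a : 0 <= increment a <= (F (vcst 1) - F (vcst 0)) / sigma.
Proof.
have cl b := shell_lo_cube b; apply/andP; split.
  rewrite divr_ge0 ?(ltW sigma_gt0)// subr_ge0 F_mono//.
  apply/vleP => j; rewrite !tnth_mktuple lerB// !exprS.
  by have := half_pos (a j); lra.
rewrite ler_pM2r ?invr_gt0// lerB// F_mono//; [by case: (cl (fun j => (a j).+2))| |].
  exact: unit_cube0.
by case: (cl (fun j => a j)).
Qed.

Lemma sum_increment : \sum_a increment a <=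
  2 * (d%:R * (L.+2 ^ d.-1)%:R * ((F (vcst 1) - F (vcst 0)) / sigma)).
Proof.
pose G (c : 'I_d -> nat) := F (shell_lo c) / sigma.
rewrite [X in _ <= _ * (_ * X)]mulrBl.
have := @sum_increments2 R d L.+2 G (F (vcst 0) / sigma) (F (vcst 1) / sigma).
move=> H; apply: le_trans (H _).
  by rewrite le_eqVlt; apply/orP; left; apply/eqP; apply: eq_bigr => a _; rewrite /G -mulrBl.
move=> c; have cc := shell_lo_cube c.
rewrite !ler_pM2r ?invr_gt0// !F_mono//; try (by case: cc).
exact: unit_cube0.
Qed.

(** Each steep cell uses up an increment of at least the threshold, and the
    increments over all cells of the shell telescope along the diagonals. *)
Lemma card_steep a k :
  half ^+ (k.+2 * d) *
    #|[pred c : {ffun 'I_d -> 'I_(2 ^ k.+1)} | steep a k (fun j => c j)]|%:R <=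
  2 * d%:R * Num.min 1 (half ^+ k * increment a * level_pts R d n (height a) k `^ half).
Proof.
set S := #|_|; set lp := level_pts _ _ _ _ _; set M := (2 ^ k.+1)%N.
have lp0 : 0 < lp by exact: level_pos.
have d1 : 1 <= d%:R :> R by rewrite ler1n.
have /andP[i0 _] := increment_bound a.
have p2 e : (2 ^ e)%:R * half ^+ e = 1 :> R by rewrite half_expn mulfV// pnatr_eq0 -lt0n expn_gt0.
rewrite minr_pMr ?mulr_ge0// le_min; apply/andP; split.
  rewrite mulr1; apply: (@le_trans _ _ 1); last by lra.
  have SM : (S <= M ^ d)%N by apply: (leq_trans (max_card _)); rewrite card_ffun !card_ord.
  apply: (@le_trans _ _ (half ^+ (k.+2 * d) * (2 ^ (k.+2 * d))%:R)); last by rewrite mulrC p2.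
  rewrite ler_pM2l// ler_nat (leq_trans SM)// /M -expnM leq_pexp2l// leq_mul2r.
  by rewrite ltnW ?orbT.
pose G (c : 'I_d -> nat) := F (grid_pt (fun j => a j) k (fun j => minn (c j) M.+1)).
have gc c : unit_cube (grid_pt (fun j => a j) k (fun j => minn (c j) M.+1)).
  by apply: grid_pt_cube => j; exact: geq_minr.
have GI := @sum_increments2 R d M G (F (shell_lo (fun j => a j)))
  (F (shell_lo (fun j => (a j).+2))).
have {}GI : \sum_(c : {ffun 'I_d -> 'I_M}) (G (fun j => (c j).+2) - G (fun j => c j)) <=
    2 * (d%:R * (M ^ d.-1)%:R * (sigma * increment a)).
  rewrite [sigma * _]mulrC divfK ?gt_eqF//; apply: GI => c.
  rewrite !F_mono//; do ?[exact: shell_lo_cube].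
    apply/vleP => j; rewrite !tnth_mktuple.
    have H1 : (minn (c j) M.+1)%:R <= M%:R + 1 :> R by rewrite natr1 ler_nat geq_minr.
    have := ler_wpM2r (ltW (half_pos (a j + k.+2))) H1.
    have -> : (M%:R + 1) * half ^+ (a j + k.+2) = half ^+ (a j).+1 + half ^+ (a j + k.+2).
      rewrite mulrDl mul1r; congr (_ + _); rewrite -addSnnS exprD mulrCA p2 mulr1//.
    have : half ^+ (a j + k.+2) <= half ^+ (a j).+2.
      by rewrite ler_wiXn2l ?(ltW (half_lt1 R)) ?(ltW (half_gt0 R))// -addn2 leq_add2l.
    rewrite !exprS; lra.
  by apply/vleP => j; rewrite !tnth_mktuple lerDl mulr_ge0// ltW.
have SG : S%:R * (sigma * lp `^ (- half)) <=
    \sum_(c : {ffun 'I_d -> 'I_M}) (G (fun j => (c j).+2) - G (fun j => c j)).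
  rewrite mulr_natl -sumr_const big_mkcond/=; apply: ler_sum => c _.
  have cl j : minn (c j) M.+1 = c j by apply/minn_idPl; exact/leqW/ltnW/ltn_ord.
  have cl2 j : minn (c j).+2 M.+1 = (c j).+2 by apply/minn_idPl; rewrite ltnS ltn_ord.
  have -> : G (fun j => c j) = F (grid_pt (fun j => a j) k (fun j => c j)).
    by congr F; congr grid_pt; apply/funext.
  have -> : G (fun j => (c j).+2) = F (grid_pt (fun j => a j) k (fun j => (c j).+2)).
    by congr F; congr grid_pt; apply/funext.
  rewrite inE; case: ifP => [|_]; first exact: ltW.
  rewrite subr_ge0 F_mono//; do ?[apply: grid_pt_cube => j].
  - exact/leqW/ltnW/ltn_ord.
  - by rewrite ltnS; exact: ltn_ord.
  - by apply: grid_pt_le => j; rewrite leqW.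
have sl0 : 0 < sigma * lp `^ (- half) by rewrite mulr_gt0 ?powR_gt0.
have SB : S%:R <= 2 * (d%:R * (M ^ d.-1)%:R * (increment a * lp `^ half)).
  rewrite -(ler_pM2r sl0); apply: (le_trans SG); apply: (le_trans GI).
  rewrite le_eqVlt; apply/orP; left; apply/eqP.
  have : lp `^ half * lp `^ (- half) = 1.
    by rewrite powRN mulfV // gt_eqF // powR_gt0.
  by move=> e; rewrite -[LHS]mulr1 -[X in _ * X = _]e; ring.
apply: (le_trans (ler_wpM2l (ltW (half_pos _)) SB)).
have MB : half ^+ (k.+2 * d) * (M ^ d.-1)%:R <= half ^+ k.
  rewrite (split_exponent k d_gt0).
  rewrite exprD -mulrA /M -expnM [_ * (2 ^ _)%:R]mulrC p2 mulr1.
  by rewrite ler_wiXn2l ?(ltW (half_lt1 R)) ?(ltW (half_gt0 R))// addSn leqW// leq_addr.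
have := ler_wpM2r (mulr_ge0 (mulr_ge0 (ler0n R 2) (ler0n R d)) (mulr_ge0 i0 (powR_ge0 lp half))) MB.
by rewrite -subr_ge0 => H; rewrite -subr_ge0; apply: (le_trans H);
  rewrite le_eqVlt; apply/orP; left; apply/eqP; ring.
Qed.

Lemma vol_cell a k (c : 'I_d -> nat) :
  \prod_(j < d) (tnth (grid_pt (fun j => a j) k (fun j => (c j).+1)) j -
                 tnth (grid_pt (fun j => a j) k c) j) =
  half ^+ height a * half ^+ (k.+2 * d).
Proof.
rewrite -exprD.
have -> : (height a + k.+2 * d = \sum_(j < d) (a j + k.+2))%N.
  by rewrite big_split/= sum_nat_const card_ord mulnC.
rewrite expr_sum; apply: eq_bigr => j _.
by rewrite !tnth_mktuple -[(c j).+1%:R]natr1; ring.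
Qed.

Lemma steep_rate_integral :
  bounded_integral lebesgue unit_cube (fun x => steep_rate (g x))
    (\sum_(a : {ffun 'I_d -> 'I_L.+2}) \sum_(k < L.+1 | (height a + k * d <= L)%N)
      2 * d%:R * (half ^+ height a * (level_pts R d n (height a) k `^ (- (q / 2)) *
        Num.min 1 (half ^+ k * increment a * level_pts R d n (height a) k `^ half)))).
Proof.
apply: bounded_integral_sum => // a _; apply: bounded_integral_sum => // k _.
set lq := level_pts _ _ _ _ _ `^ (- (q / 2)); have lq0 : 0 <= lq by exact: powR_ge0.
have one (c : {ffun 'I_d -> 'I_(2 ^ k.+1)}) : bounded_integral lebesgue unit_cube
    (fun x => lq * (in_cell a k (fun j => c j) (g x))%:R)
    (lq * (half ^+ height a * half ^+ (k.+2 * d))).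
  apply: bounded_integral_scale => //; apply: box_bounded; last exact: vol_cell.
  - by apply: grid_pt_cube => j; exact/leqW/ltnW/ltn_ord.
  - by apply: grid_pt_cube => j; rewrite ltnS ltnW.
  - exact: grid_pt_le.
have S := @bounded_integral_sum _ _ _ lebesgue unit_cube m_cube _ (index_enum _)
  (fun c : {ffun 'I_d -> 'I_(2 ^ k.+1)} => steep a k (fun j => c j)) _ _ (fun c _ => one c).
apply: bounded_integral_eq (bounded_integral_le _ S) => [x cx|].
  rewrite [RHS]big_mkcondr/=; apply: eq_bigr => c _.
  by case: (in_cell _ _ _ _); rewrite ?mulr1 ?mulr0.
rewrite sumr_const -[leLHS]mulr_natr.
have := ler_wpM2l (mulr_ge0 lq0 (ltW (half_pos (height a)))) (card_steep a k).
set m := Num.min _ _; set N := #|_|.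
by rewrite -subr_ge0 => H; rewrite -subr_ge0; apply: (le_trans H);
  rewrite le_eqVlt; apply/orP; left; apply/eqP; ring.
Qed.

(** [G] is the bound of [one_sided_bounded]; its integral replaces indicators of
    shells and cells by their volumes. *)
Lemma one_sided_integral : exists G : d.-tuple R -> R,
  (forall x, unit_cube x -> exists H,
     (forall w err, one_sided (g x) w err -> err `^ q <= H w) /\
     bounded_integral P setT H (G x)) /\
  bounded_integral lebesgue unit_cube G
    (sigma `^ q * (boundary_const *
       (\sum_(a : {ffun 'I_d -> 'I_L.+2}) half ^+ height a * decay q (n%:R * half ^+ height a)) +
     steep_const * (2 * d%:R *
       \sum_(a : {ffun 'I_d -> 'I_L.+2}) \sum_(k < L.+1 | (height a + k * d <= L)%N)
         half ^+ height a * (level_pts R d n (height a) k `^ (- (q / 2)) *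
         Num.min 1 (half ^+ k * increment a * level_pts R d n (height a) k `^ half))))).
Proof.
exists (fun x => sigma `^ q * (boundary_const * corner_rate (g x) +
  steep_const * steep_rate (g x))); split.
  by move=> x cx; apply: one_sided_bounded; exact: g_map.
have bc := boundary_const_ge0; have sc := steep_const_ge0.
apply: bounded_integral_scale => //; first exact: powR_ge0.
apply: bounded_integral_add => //.
  by apply: bounded_integral_scale => //; exact: corner_rate_integral.
apply: bounded_integral_scale => //.
apply: bounded_integral_le steep_rate_integral.
rewrite mulr_sumr; apply: ler_sum => a _; rewrite mulr_sumr.
by apply: ler_sum => k _.
Qed.

End one_side.

(** * The risk of a block estimator *)

(** The integral of a nonnegative function is the supremum over the simple
    functions below it, so it is monotone for nonmeasurable functions as well. *)
Lemma le_integral_ge0 (R : realType) (dU : measure_display) (U : measurableType dU)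
    (mu : {measure set U -> \bar R}) (D : set U) (h1 h2 : U -> \bar R) :
  (forall x, D x -> (0 <= h1 x)%E) -> (forall x, D x -> (h1 x <= h2 x)%E) ->
  (\int[mu]_(x in D) h1 x <= \int[mu]_(x in D) h2 x)%E.
Proof.
move=> h10 h12; rewrite !ge0_integralE//; last first.
  by move=> x Dx; exact: le_trans (h10 x Dx) (h12 x Dx).
apply: ereal_sup_le => _ [s sh <-];
exists s => // x; apply: (le_trans (sh x)); rewrite !patchE; case: ifP => //.
by rewrite inE => /h12.
Qed.

Section reflected_boxes.
Context (R : realType) (d : nat).

Lemma measurable_reflection : measurable_fun setT (@reflection R d).
Proof.
apply/measurable_fun_tnthP => j.
rewrite (_ : _ \o _ = fun x : d.-tuple R => 1 - tnth x j).
  by apply: measurable_funB => //; exact: measurable_tnth.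
by apply/funext => x /=; rewrite tnth_mktuple.
Qed.

Lemma preimage_reflection_box u v :
  @reflection R d @^-1` box u v = box (reflection v) (reflection u).
Proof.
apply/seteqP; split => x; rewrite /box/= => -[a b]; split.
- by rewrite -vle_reflection reflectionK.
- by rewrite -vle_reflection reflectionK.
- by rewrite -[u]reflectionK vle_reflection.
- by rewrite -[v]reflectionK vle_reflection.
Qed.

Lemma vol_reflection u v :
  \prod_(j < d) (tnth (reflection u) j - tnth (reflection v) j) =
  \prod_(j < d) (tnth v j - tnth u j) :> R.
Proof. by apply: eq_bigr => j _; rewrite !tnth_mktuple; ring. Qed.

End reflected_boxes.

Section risk_bound.
Context (R : realType) (d n : nat) (dT : measure_display)
  (T : measurableType dT) (P : probability T R).
Variables (X : 'I_n -> {RV P >-> d.-tuple R}) (eps : 'I_n -> {RV P >-> R}).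
Variables (law : probability (d.-tuple R) R) (f : d.-tuple R -> R).
Variables (rho1 rho2 q sigma D : R).
Variable fhat : n.-tuple (d.-tuple R) -> n.-tuple R -> d.-tuple R -> R.
Hypotheses (d_gt0 : (0 < d)%N) (rho1_gt0 : 0 < rho1) (rho12 : rho1 <= rho2).
Hypotheses (q_ge1 : 1 <= q) (n_ge2 : (2 <= n)%N) (sigma_gt0 : 0 < sigma).
Hypothesis model : random_design_model X eps rho1 rho2 q sigma law f.
Hypothesis block : block_estimator fhat.
Hypotheses (D_ge0 : 0 <= D) (f_range : f (vcst 1) - f (vcst 0) <= D * sigma).

Local Notation p := (Num.max q 2).
Local Notation half := (2^-1 : R).

Let xs_cube w : design_in_cube (design X w).
Proof. by move=> i; rewrite tnth_mktuple; exact: model_cube model _ _. Qed.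

Let ysE w i : tnth (responses X eps f w) i = f (tnth (design X w) i) + eps i w.
Proof. by rewrite !tnth_mktuple. Qed.

Let law_box u v : unit_cube u -> unit_cube v -> vle u v ->
  rho1 * (\prod_(j < d) (tnth v j - tnth u j)) <= fine (law (box u v)) <=
  rho2 * (\prod_(j < d) (tnth v j - tnth u j)).
Proof.
move=> cu cv uv; have := model_law model cu cv uv.
rewrite lebesgue_tuple_box// -!EFinM -!lee_fin fineK//.
by rewrite fin_num_measure//; exact: measurable_box.
Qed.

Let upper_error w x : unit_cube x ->
  one_sided X eps id f x w (Num.max 0 (fhat (design X w) (responses X eps f w) x - f x)).
Proof.
move=> cx; split; first by rewrite le_max lexx.
move=> v K cv xv nv K0 HK; rewrite ge_max addr_ge0 ?subr_ge0 ?(model_mono model)//=.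
rewrite lerBlDr addrAC subrK.
have n0 : (0 < n)%N by exact: leq_trans n_ge2.
apply: (block_upper block n0 (@xs_cube w) (model_mono model) (ysE w) cx cv xv nv).
move=> u cu ux nu; apply: le_trans (HK u cu ux nu).
rewrite le_eqVlt; apply/orP; left; apply/eqP; congr `|_|.
by apply: eq_bigl => i; rewrite tnth_mktuple.
Qed.

Let lower_error w x : unit_cube x ->
  one_sided X eps (@reflection R d) (fun y => - f (reflection y)) (reflection x) w
    (Num.max 0 (f x - fhat (design X w) (responses X eps f w) x)).
Proof.
move=> cx; split; first by rewrite le_max lexx.
have cx' : unit_cube (reflection x) by exact/unit_cube_reflection.
have xsE : mapped_design X (@reflection R d) w = reflect_design (design X w).
  by apply: eq_from_tnth => i; rewrite !tnth_mktuple.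
move=> v K cv xv nv K0 HK; rewrite xsE in nv HK.
rewrite reflectionK ge_max addr_ge0//=; last first.
  rewrite subr_ge0 lerN2 (model_mono model)//; first exact/unit_cube_reflection.
  by rewrite -vle_reflection reflectionK.
rewrite opprK addrAC addrC lerD2l.
have n0 : (0 < n)%N by exact: leq_trans n_ge2.
have := @block_lower _ _ _ _ block n0 (design X w) (responses X eps f w) f
  (fun i => eps i w) (reflection x) v K (@xs_cube w) (model_mono model) (ysE w) cx' cv xv nv.
rewrite reflectionK [- f _ + K]addrC; apply => u cu ux nu; apply: le_trans (HK u cu ux nu).
rewrite le_eqVlt; apply/orP; left; apply/eqP; congr `|_|.
by apply: eq_bigl => i; rewrite !tnth_mktuple.
Qed.

Variables CB CM rB rM : R.
Hypothesis boundary : \sum_(a : {ffun 'I_d -> 'I_(trunc_log 2 n).+2})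
  half ^+ height a * decay q (n%:R * half ^+ height a) <= CB * rB.
Hypothesis bias : forall Da : {ffun 'I_d -> 'I_(trunc_log 2 n).+2} -> R,
  (forall a, 0 <= Da a <= Delta01 f sigma) ->
  \sum_a Da a <= 2 * (d%:R * ((trunc_log 2 n).+2 ^ d.-1)%:R * Delta01 f sigma) ->
  \sum_(a : {ffun 'I_d -> 'I_(trunc_log 2 n).+2})
    \sum_(k < (trunc_log 2 n).+1 | (height a + k * d <= trunc_log 2 n)%N)
      half ^+ height a * (level_pts R d n (height a) k `^ (- (q / 2)) *
        Num.min 1 (half ^+ k * Da a * level_pts R d n (height a) k `^ half)) <= CM * rM.

Let rate : R := sigma `^ q * (boundary_const d p q rho1 rho2 D * (CB * rB) +
  steep_const d p q rho1 rho2 D * (2 * d%:R * (CM * rM))).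

Let one_sided_rate (g : d.-tuple R -> d.-tuple R) (F : d.-tuple R -> R) :
  measurable_fun setT g ->
  (forall u v, unit_cube u -> unit_cube v -> vle u v ->
     rho1 * (\prod_(j < d) (tnth v j - tnth u j)) <= fine (law (g @^-1` box u v)) <=
     rho2 * (\prod_(j < d) (tnth v j - tnth u j))) ->
  nondecreasing_on_cube F -> F (vcst 1) - F (vcst 0) = f (vcst 1) - f (vcst 0) ->
  (forall x, unit_cube x -> unit_cube (g x)) ->
  (forall u v, unit_cube u -> unit_cube v -> vle u v ->
    (lebesgue_tuple R d ((g @^-1` box u v) `&` unit_cube) <=
     (\prod_(j < d) (tnth v j - tnth u j))%:E)%E) ->
  exists G : d.-tuple R -> R,
  (forall x, unit_cube x -> exists H,
     (forall w err, one_sided X eps g F (g x) w err -> err `^ q <= H w) /\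
     bounded_integral P setT H (G x)) /\
  bounded_integral (lebesgue_tuple R d) unit_cube G rate.
Proof.
move=> mg lawg mF FE g_map g_box.
have q_gt0 : 0 < q by exact: lt_le_trans q_ge1.
have [kap [indep moments]] := model_noise model.
have qp : q <= p by rewrite le_max lexx.
have p2 : 2 <= p by rewrite le_max lexx orbT.
have Fr : F (vcst 1) - F (vcst 0) <= D * sigma by rewrite FE.
have [G [GH GV]] := one_sided_integral (model_iid model) q_ge1 qp p2 sigma_gt0 indep moments
  mg rho1_gt0 rho12 lawg d_gt0 n_ge2 mF D_ge0 Fr g_map g_box.
exists G; split => //; apply: bounded_integral_le GV.
rewrite /rate ler_wpM2l ?powR_ge0// lerD//.
  by rewrite ler_wpM2l// boundary_const_ge0.
rewrite ler_wpM2l ?steep_const_ge0//.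
rewrite ler_wpM2l ?mulr_ge0//; apply: bias.
  by move=> a; have := increment_bound sigma_gt0 mF a; rewrite FE.
by have := sum_increment n sigma_gt0 mF; rewrite FE.
Qed.

(** The positive and the negative part of the error are one-sided errors for
    [f] and for the reflected problem. *)
Lemma risk_le : (risk X eps q f fhat <= (rate + rate)%:E)%E.
Proof.
have q_gt0 : 0 < q by exact: lt_le_trans q_ge1.
have [|G1 [H1 B1]] := @one_sided_rate id f (@measurable_id _ _ _) law_box (model_mono model) erefl (fun _ => id).
  move=> u v cu cv uv; rewrite -lebesgue_tuple_box//; apply: le_measure; rewrite ?inE.
  - by apply: measurableI; exact: measurable_box.
  - exact: measurable_box.
  - by move=> x [].
have refl_law u v : unit_cube u -> unit_cube v -> vle u v ->
     rho1 * (\prod_(j < d) (tnth v j - tnth u j)) <=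
     fine (law (@reflection R d @^-1` box u v)) <=
     rho2 * (\prod_(j < d) (tnth v j - tnth u j)).
  move=> cu cv uv; rewrite preimage_reflection_box -vol_reflection; apply: law_box.
  - exact/unit_cube_reflection.
  - exact/unit_cube_reflection.
  - by rewrite vle_reflection.
have refl_range : - f (reflection (vcst 1)) - - f (reflection (vcst 0)) =
    f (vcst 1) - f (vcst 0) by rewrite reflection0 reflection1 opprK addrC.
have [||G2 [H2 B2]] := @one_sided_rate (@reflection R d) _ (@measurable_reflection R d)
    refl_law (nondecreasing_reflect (model_mono model)) refl_range.
- by move=> x cx; exact/unit_cube_reflection.
- move=> u v cu cv uv; rewrite preimage_reflection_box -vol_reflection.
  rewrite -lebesgue_tuple_box ?vle_reflection//; apply: le_measure; rewrite ?inE.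
  - by apply: measurableI; exact: measurable_box.
  - exact: measurable_box.
  - by move=> x [].
have [_ _] := bounded_integral_add (measurable_box _ _) B1 B2; apply: le_trans.
apply: le_integral_ge0 => x cx; rewrite unlock.
  by apply: integral_ge0 => w _; rewrite lee_fin powR_ge0.
have [h1 [e1 b1]] := H1 x cx; have [h2 [e2 b2]] := H2 x cx.
have [_ p1 _] := b1; have [_ p2 _] := b2.
have [_ _] := bounded_integral_add measurableT b1 b2; apply: le_trans.
apply: le_integral_ge0 => w _; first by rewrite lee_fin powR_ge0.
have {}e1 := e1 w _ (@upper_error w x cx).
have {}e2 := e2 w _ (@lower_error w x cx).
rewrite lee_fin; set y := fhat _ _ _ in e1 e2 *.
have [yf|yf] := leP (f x) y.
  apply: (@le_trans _ _ (h1 w)); last by rewrite lerDl p2.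
  by move: e1; rewrite max_r ?subr_ge0// ger0_norm// subr_ge0.
apply: (@le_trans _ _ (h2 w)); last by rewrite lerDr p1.
by move: e2; rewrite max_r ?subr_ge0 ?(ltW yf)// distrC ger0_norm// subr_ge0 ltW.
Qed.

End risk_bound.

Section rates_of_convergence.
Context (R : realType).

Lemma ln_nat_ge0 n : (2 <= n)%N -> 0 <= ln n%:R :> R.
Proof. by move=> n2; rewrite ln_ge0// ler1n (leq_trans _ n2). Qed.

Lemma Delta01_ge0 d (f : d.-tuple R -> R) sigma :
  nondecreasing_on_cube f -> 0 < sigma -> 0 <= Delta01 f sigma.
Proof.
move=> mf s0; rewrite divr_ge0 ?(ltW s0)// subr_ge0 mf//.
- exact: unit_cube0.
- exact: unit_cube1.
by apply/vleP => j; rewrite !tnth_mktuple.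
Qed.

Lemma risk_rate (d : nat) (rho1 rho2 D q : R)
    (d_gt0 : (0 < d)%N) (rho1_gt0 : 0 < rho1) (rho12 : rho1 <= rho2) : 1 <= q ->
  exists2 C : R, 0 < C &
    forall (n : nat) (dT : measure_display) (T : measurableType dT)
      (P : probability T R) (X : 'I_n -> {RV P >-> d.-tuple R})
      (eps : 'I_n -> {RV P >-> R}) (law : probability (d.-tuple R) R)
      (f : d.-tuple R -> R) (sigma : R)
      (fhat : n.-tuple (d.-tuple R) -> n.-tuple R -> d.-tuple R -> R),
      (2 <= n)%N -> 0 < sigma ->
      random_design_model X eps rho1 rho2 q sigma law f ->
      block_estimator fhat ->
      Delta01 f sigma <= D ->
      (risk X eps q f fhat <=
        (C * (sigma `^ q *
          ((Delta01 f sigma / n%:R `^ d%:R^-1)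
              `^ Num.min 1 (q * d%:R / (d%:R + 2))
            * ln n%:R ^+ ((q * d%:R / (d%:R + 2))%R == 1%R)
          + ln n%:R ^+ (d * (q == 2%R) + (d - 1) * (2%R < q)%R)
            / n%:R `^ Num.min (q / 2) 1)))%:E)%E.
Proof.
move=> q1; set p := Num.max q 2; set D1 := Num.max D 0.
have D10 : 0 <= D1 by rewrite le_max lexx orbT.
have [CB CB0 HB] := boundary_sum d_gt0 q1.
have [CM CM0 HM] := bias_sum d_gt0 q1.
set bc := boundary_const d p q rho1 rho2 D1.
set sc := steep_const d p q rho1 rho2 D1.
have bc0 : 0 <= bc by exact: boundary_const_ge0.
have sc0 : 0 <= sc by exact: steep_const_ge0.
set E1 := bc * CB; set E2 := sc * (2 * d%:R * CM).
have E10 : 0 <= E1 by rewrite mulr_ge0// ltW.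
have E20 : 0 <= E2 by rewrite mulr_ge0// mulr_ge0 ?(ltW CM0)// mulr_ge0.
exists (1 + 2 * (E1 + E2)); first by rewrite ltr_pwDl// mulr_ge0// addr_ge0.
move=> n dT T P X eps law f sigma fhat n2 s0 model block DD.
have fr : f (vcst 1) - f (vcst 0) <= D1 * sigma.
  by rewrite -ler_pdivrMr// (le_trans DD)// le_max lexx.
have De := Delta01_ge0 (model_mono model) s0.
apply: (le_trans (risk_le d_gt0 rho1_gt0 rho12 q1 n2 s0 model block D10 fr (HB n n2)
  (fun Da => HM n _ Da n2))).
set rB := ln _ ^+ _ / _ `^ _; set rM := (_ / _) `^ _ * _.
rewrite lee_fin -/p -/bc -/sc.
have ln0 := ln_nat_ge0 n2.
have rB0 : 0 <= rB by rewrite divr_ge0 ?exprn_ge0 ?powR_ge0.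
have rM0 : 0 <= rM by rewrite mulr_ge0 ?exprn_ge0 ?powR_ge0.
have sq : 0 <= sigma `^ q by exact: powR_ge0.
have -> : sigma `^ q * (bc * (CB * rB) + sc * (2 * d%:R * (CM * rM))) =
    sigma `^ q * (E1 * rB + E2 * rM) by rewrite /E1 /E2; ring.
rewrite [leRHS]mulrCA -mulrDr; apply: ler_wpM2l => //.
by have := mulr_ge0 E10 rM0; have := mulr_ge0 E20 rB0; nra.
Qed.

(** This and the next bound show that the rate is bounded. *)
Lemma ln_le_sqrt n : (0 < n)%N -> ln n%:R <= 2 * n%:R `^ (2^-1) :> R.
Proof.
move=> n0; have n0' : 0 < n%:R :> R by rewrite ltr0n.
have -> : n%:R `^ (2^-1) = expR (ln n%:R / 2) :> R.
  by rewrite /powR gt_eqF// mulrC.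
have := expR_ge1Dx (ln n%:R / 2 : R); lra.
Qed.

Lemma ln_expn_le d n : (0 < d)%N -> (2 <= n)%N ->
  ln n%:R ^+ d <= d%:R `^ d%:R * n%:R :> R.
Proof.
move=> d0 n2; have := @powR_le_expR R d%:R (ln n%:R).
rewrite ltr0n lnK ?posrE ?ltr0n ?(leq_trans _ n2)// powR_mulrn ?ln_nat_ge0//.
by apply => //; exact: ln_nat_ge0.
Qed.

End rates_of_convergence.

Theorem theorem7 (R : realType) (d : nat) (rho1 rho2 D : R)
    (d_gt0 : (0 < d)%N) (rho1_gt0 : 0 < rho1) (rho12 : rho1 <= rho2) :
  (forall q : R, 1 <= q ->
    exists2 C : R, 0 < C &
    forall (n : nat) (dT : measure_display) (T : measurableType dT)
      (P : probability T R) (X : 'I_n -> {RV P >-> d.-tuple R})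
      (eps : 'I_n -> {RV P >-> R}) (law : probability (d.-tuple R) R)
      (f : d.-tuple R -> R) (sigma : R)
      (fhat : n.-tuple (d.-tuple R) -> n.-tuple R -> d.-tuple R -> R),
      (2 <= n)%N -> 0 < sigma ->
      random_design_model X eps rho1 rho2 q sigma law f ->
      block_estimator fhat ->
      Delta01 f sigma <= D ->
      (risk X eps q f fhat <=
        (C * (sigma `^ q *
          ((Delta01 f sigma / n%:R `^ d%:R^-1)
              `^ Num.min 1 (q * d%:R / (d%:R + 2))
            * ln n%:R ^+ ((q * d%:R / (d%:R + 2))%R == 1%R)
          + ln n%:R ^+ (d * (q == 2%R) + (d - 1) * (2%R < q)%R)
            / n%:R `^ Num.min (q / 2) 1)))%:E)%E)
  /\
  ((2 <= d)%N ->
    exists2 C : R, 0 < C &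
    forall (n : nat) (dT : measure_display) (T : measurableType dT)
      (P : probability T R) (X : 'I_n -> {RV P >-> d.-tuple R})
      (eps : 'I_n -> {RV P >-> R}) (law : probability (d.-tuple R) R)
      (f : d.-tuple R -> R) (sigma : R)
      (fhat : n.-tuple (d.-tuple R) -> n.-tuple R -> d.-tuple R -> R),
      (2 <= n)%N -> 0 < sigma ->
      random_design_model X eps rho1 rho2 2 sigma law f ->
      block_estimator fhat ->
      Delta01 f sigma <= D ->
      (risk X eps 2 f fhat <=
        (C * (sigma ^+ 2 *
          Num.min 1
            (Delta01 f sigma / n%:R `^ d%:R^-1 * ln n%:R ^+ (d == 2)%N
            + ln n%:R ^+ d / n%:R)))%:E)%E).
Proof.
split=> [q q1|d2]; first exact: risk_rate.
have [C C0 HC] := risk_rate D d_gt0 rho1_gt0 rho12 (ler1n R 2 : 1 <= 2).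
set D1 := Num.max D 0.
have D10 : 0 <= D1 by rewrite le_max lexx orbT.
pose M : R := Num.max 1 (2 * D1 + d%:R `^ d%:R).
have M1 : 1 <= M by rewrite le_max lexx.
exists (C * M); first by rewrite mulr_gt0// (lt_le_trans ltr01 M1).
move=> n dT T P X eps law f sigma fhat n2 s0 model block DD.
apply: (le_trans (HC n dT T P X eps law f sigma fhat n2 s0 model block DD)).
have De := Delta01_ge0 (model_mono model) s0.
have dr : 0 < d%:R + 2 :> R by rewrite ltr_wpDl.
have d2R : 2 <= d%:R :> R by rewrite ler_nat.
have n0 : 0 < n%:R :> R by rewrite ltr0n (leq_trans _ n2).
have n1 : 1 <= n%:R `^ d%:R^-1 :> R.
  by apply: powR_ge1; rewrite ?ler1n ?(leq_trans _ n2)// invr_ge0.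
have nd0 : 0 < n%:R `^ d%:R^-1 :> R by exact: lt_le_trans n1.
have ln0 := ln_nat_ge0 R n2.
have -> : ((2 * d%:R / (d%:R + 2))%R == 1%R :> R) = (d == 2)%N.
  rewrite -(inj_eq (mulIf (lt0r_neq0 dr))) divfK ?lt0r_neq0// mul1r -subr_eq0.
  by rewrite (_ : _ - _ = d%:R - 2%:R); [rewrite subr_eq0 eqr_nat|ring].
rewrite min_l; last by rewrite ler_pdivlMr// mul1r; lra.
rewrite divff// minxx eqxx ltxx muln1 muln0 addn0 !powRr1 ?(ltW n0)//; last exact: (divr_ge0 De (ltW nd0)).
rewrite powR_mulrn ?(ltW s0)//.
set x := _ / _ * _; set y := _ / _.
rewrite lee_fin -mulrA ler_pM2l// mulrCA ler_pM2l ?exprn_gt0//.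
have x0 : 0 <= x by rewrite mulr_ge0 ?exprn_ge0// divr_ge0// ltW.
have y0 : 0 <= y by rewrite divr_ge0 ?exprn_ge0// ltW.
have DD1 : Delta01 f sigma <= D1 by rewrite (le_trans DD)// le_max lexx.
have xD : x <= 2 * D1.
  rewrite /x; case: eqP => [d2E|_].
    rewrite expr1 mulrAC ler_pdivrMr//.
    have -> : d%:R = 2 :> R by rewrite d2E.
    have := ler_pM De ln0 DD1 (ln_le_sqrt R (ltnW n2)); lra.
  rewrite expr0 mulr1 ler_pdivrMr//; apply: (le_trans DD1).
  by rewrite -[leLHS]mulr1 ler_pM//; lra.
have yD : y <= d%:R `^ d%:R by rewrite ler_pdivrMr// ln_expn_le.
have xyM : x + y <= M by rewrite le_max (lerD xD yD) orbT.
have [xy1|xy1] := leP 1 (x + y); first by rewrite mulr1.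
by rewrite ler_peMl// addr_ge0.
Qed.
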